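(* Let $0<a<1$ and let $f\in L^2(\mathbb{R})$ be such that $$|\mathcal{G}f(x,\omega)|^2=\mathrm{e}^{-\pi(x^2+\omega^2)}=|\mathcal{G}\varphi(x,\omega)|^2,\qquad (x,\omega)\in a\mathbb{Z}^2.$$ Then there exists an $\alpha\in\mathbb{R}$ such that $f=\mathrm{e}^{\mathrm{i}\alpha}\varphi$.
   Context: $\varphi(t)=2^{1/4}\mathrm{e}^{-\pi t^2}$, $t\in\mathbb{R}$, is the normalized Gaussian. The Gabor transform of a (complex-valued) $f\in L^2(\mathbb{R})$ is $$\mathcal{G}f(x,\omega)=2^{1/4}\int_{\mathbb{R}}f(t)\,\mathrm{e}^{-\pi(t-x)^2}\mathrm{e}^{-2\pi\mathrm{i}t\omega}\,\mathrm{d}t,\qquad (x,\omega)\in\mathbb{R}^2.$$ (One has $|\mathcal{G}\varphi(x,\omega)|=\mathrm{e}^{-\frac{\pi}{2}(x^2+\omega^2)}$ for all $(x,\omega)\in\mathbb{R}^2$.) *)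

(* Defs.v *)
From mathcomp Require Import all_boot all_order all_algebra.
From mathcomp Require Import all_classical all_reals all_analysis.
From mathcomp Require Import complex.

Set Implicit Arguments.
Unset Strict Implicit.
Unset Printing Implicit Defensive.

Import Order.TTheory GRing.Theory Num.Theory.
Import numFieldNormedType.Exports.
Import ComplexField.Normc.

Local Open Scope classical_set_scope.
Local Open Scope ring_scope.
Local Open Scope complex_scope.

Section GaborTransform.
Variable R : realType.
Local Notation mu := (@lebesgue_measure R).

Definition expi (theta : R) : R[i] := cos theta +i* sin theta.

(* Elements of L^2 are represented by Borel functions; equality in L^2 is then
   equality almost everywhere. *)
Definition square_integrable (f : R -> R[i]) : Prop :=
  [/\ measurable_fun setT (fun t => complex.Re (f t)),
      measurable_fun setT (fun t => complex.Im (f t)) &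
      (\int[mu]_t (normc (f t) ^+ 2)%:E < +oo)%E].

(* Meaningful when Re g and Im g are integrable, since Rintegral sends infinite
   integrals to 0; this holds for the Gabor integrand of any f in L^2. *)
Definition cintegral (g : R -> R[i]) : R[i] :=
  Rintegral mu setT (fun t => complex.Re (g t))
    +i* Rintegral mu setT (fun t => complex.Im (g t)).

Definition gaussian (t : R) : R[i] := (2 `^ 4^-1 * expR (- pi * t ^+ 2))%:C.

Definition gabor (f : R -> R[i]) (x omega : R) : R[i] :=
  (2 `^ 4^-1)%:C *
  cintegral (fun t => f t * (expR (- pi * (t - x) ^+ 2))%:C
                          * expi (- 2 * pi * t * omega)).

Definition square_lattice (a : R) : set (R * R) :=
  [set p | exists k l : int, p = (a * k%:~R, a * l%:~R)].

End GaborTransform.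

(* Main.v *)
(** Put [G t = f t * e^(- pi t^2)].  The samples of [|gabor f|] give the moduli of
    [L k l = \int G t * e^(2 pi a k t) * e^(- 2 pi i a l t) dt], namely
    [2^(-1/4) e^(pi a^2 (k^2 - l^2) / 2)].  There are rapidly decaying
    coefficients [psi] with [\sum_k psi (k - j) e^(2 pi k n) = 0] for [n != 0]
    and [= C0 > 0] for [n = 0].  For fixed [k], the [L k l] are the Fourier
    coefficients of the [1/a]-periodization of [G t * e^(2 pi a k t)], so that
    Fejér summation in [l] and summation against [psi (k - j)] in [k] recover
    [G] almost everywhere: for every integer [j],
      [C0 / a * G x = \sum_(k, l) psi (k - j) L k l e^(- 2 pi a (k - i l) x)].
    The series on the right, multiplied by [e^(2 pi x^2)], extends to an entire
    function [E_j] of [x].  All the [E_j] agree, because they agree almost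
    everywhere on the real line, and the moduli of the [L k l] bound [E_j z],
    uniformly in [j], when [|a j - 2 Re z| <= a].  Hence [E_0] is bounded, and
    constant by Liouville's theorem, so that [f] is a multiple of the Gaussian;
    the sample at the origin gives the modulus of the factor.

    Entire functions are handled as locally uniform limits of polynomials, for
    which Cauchy's estimates follow from averaging over roots of unity. *)

Require Import Defs.
From mathcomp Require Import all_boot all_order all_algebra.
From mathcomp Require Import all_classical all_reals all_analysis.
From mathcomp Require Import measurable_realfun complex ring lra zify.

Set Implicit Arguments.
Unset Strict Implicit.
Unset Printing Implicit Defensive.

Import Order.TTheory GRing.Theory Num.Theory.
Import numFieldNormedType.Exports.
Import ComplexField.Normc.

Local Open Scope classical_set_scope.
Local Open Scope ring_scope.
Local Open Scope complex_scope.

(** * The complex exponential and its approximation by polynomials *)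

Section ComplexExponential.
Context {R : realType}.
Implicit Types (x y : R) (z w : R[i]).

(** The data fix the moduli of the samples but not their phases, so the series has to be controlled
    term by term. At complex [z], after completing squares, the terms grow like
    [e^(pi/2 (a k - 2 Re z)^2)] in [k]; the decay [e^(- pi (k - j)^2)] of [psi (k - j)] beats this,
    uniformly once [j] sits near [2 Re z / a]. The shift [j] is available for free: in
    [\sum_k psi (k - j) w^k] it only produces a factor [w^j], so the zeros at [w = e^(2 pi n)]
    survive. They are the zeros of a theta function; dividing it by [1 - w] removes the one at
    [w = 1], and annihilating all translates becomes isolating one of them.

    The reconstruction is proved in integrated form, over intervals shorter than [1/a]. Both
    summations then act on the indicator of the interval instead of on [G], of which only the
    integrability of [G t * e^(pi b t^2)] for [b < 1] is known. The summed test functions stay below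
    a multiple of such an [e^(pi b t^2)] because [a < 1]. The factor [e^(2 pi x^2)] turns the
    expected answer, a multiple of [e^(- 2 pi x^2)], into a constant, within reach of Liouville's
    theorem. *)

Lemma normc_sum (I : Type) (s : seq I) (P : pred I) (F : I -> R[i]) :
  normc (\sum_(i <- s | P i) F i) <= \sum_(i <- s | P i) normc (F i).
Proof.
elim/big_rec2: _ => [|i x z _ le_zx]; first by rewrite normc0.
by rewrite (le_trans (le_normcD _ _))// lerD2l.
Qed.

Lemma normcX z n : normc (z ^+ n) = normc z ^+ n.
Proof. by elim: n => [|n IH]; rewrite ?expr0 ?normc1// !exprS normcM IH. Qed.

Lemma normc_real x : normc x%:C = `|x|.
Proof. by rewrite /= expr0n addr0 sqrtr_sqr. Qed.

Lemma normc_ge0 z : 0 <= normc z.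
Proof. by case: z => x y; rewrite /= sqrtr_ge0. Qed.

Lemma normc_expi x : normc (expi x) = 1.
Proof. by rewrite /= cos2Dsin2 sqrtr1. Qed.

Lemma sqr_normcE z :
  normc z ^+ 2 = complex.Re z ^+ 2 + complex.Im z ^+ 2.
Proof. by case: z => x y /=; rewrite sqr_sqrtr// addr_ge0// sqr_ge0. Qed.

Lemma ler_Re_normc z : `|complex.Re z| <= normc z.
Proof.
rewrite -(@ler_pXn2r _ 2)// ?nnegrE ?normc_ge0// sqr_normcE real_normK ?num_real//.
by rewrite lerDl sqr_ge0.
Qed.

Lemma ler_Im_normc z : `|complex.Im z| <= normc z.
Proof.
rewrite -(@ler_pXn2r _ 2)// ?nnegrE ?normc_ge0// sqr_normcE real_normK ?num_real//.
by rewrite lerDr sqr_ge0.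
Qed.

Lemma ler_normc_ReIm z : normc z <= `|complex.Re z| + `|complex.Im z|.
Proof.
rewrite -(@ler_pXn2r _ 2)// ?nnegrE ?normc_ge0// ?addr_ge0// sqr_normcE.
rewrite sqrrD !real_normK ?num_real//.
by rewrite -addrA lerD2l lerDr mulrn_wge0// mulr_ge0.
Qed.

Lemma expiD x y : expi (x + y) = expi x * expi y.
Proof.
by rewrite /expi cosD sinD; apply/eqP; rewrite eq_complex/= eqxx addrC eqxx.
Qed.

Lemma expi0 : expi 0 = 1 :> R[i].
Proof. by rewrite /expi cos0 sin0. Qed.

Lemma expiMn x n : expi (x *+ n) = expi x ^+ n.
Proof. by elim: n => [|n IH]; rewrite ?mulr0n ?expi0// mulrS exprS expiD IH. Qed.

Definition cexp (z : R[i]) : R[i] :=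
  (expR (complex.Re z))%:C * expi (complex.Im z).

Lemma cexpD z w : cexp (z + w) = cexp z * cexp w.
Proof.
rewrite /cexp; case: z => x y; case: w => u v /=.
by rewrite expRD expiD rmorphM/=; ring.
Qed.

Lemma cexp0 : cexp 0 = 1.
Proof. by rewrite /cexp /= expR0 expi0 mulr1. Qed.

Lemma cexp_real x : cexp x%:C = (expR x)%:C.
Proof. by rewrite /cexp /= expi0 mulr1. Qed.

Lemma normc_cexp z : normc (cexp z) = expR (complex.Re z).
Proof. by rewrite normcM normc_expi mulr1 normc_real ger0_norm// expR_ge0. Qed.

Lemma cexp_nat z n : cexp (z *+ n) = cexp z ^+ n.
Proof.
by elim: n => [|n IH]; rewrite ?mulr0n ?cexp0// mulrS exprS cexpD IH.
Qed.

(** Only [e^x >= 1 + x] is used: at [- x] it gives [e^x (1 - x) <= 1], and [(1 + x + 2 x^2) (1 - x)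
    = 1 + x^2 (1 - 2 x) >= 1] for [x <= 1/2]. *)
Lemma expR_sub1_bound x : `|x| <= 2^-1 -> `|expR x - 1 - x| <= 2 * x ^+ 2.
Proof.
rewrite ler_norml => /andP[x1 x2].
have lb := expR_ge1Dx x; have ub := expR_ge1Dx (- x).
have ee := expRxMexpNx_1 x.
have ex := expR_gt0 x.
have h : expR x * (1 - x) <= expR x * expR (- x) by rewrite ler_wpM2l// ltW.
rewrite ee in h; rewrite ler_norml; apply/andP; split; first nra.
have h2 : expR x <= 1 + x + 2 * x ^+ 2 by nra.
lra.
Qed.

Lemma normr_sinB x : 0 <= x -> `|sin x| <= x /\ `|x - sin x| <= x ^+ 2
   /\ `|1 - cos x| <= x ^+ 2.
Proof.
move=> x0.
have sinx y : 0 <= y -> `|sin y| <= y.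
  rewrite le_eqVlt => /predU1P[<-|y0]; first by rewrite sin0 normr0.
  have [c _ ] := @MVT R sin cos 0 y y0 (fun t _ => is_derive_sin t)
    (continuous_subspaceT (@continuous_sin R)).
  rewrite sin0 !subr0 => ->; rewrite normrM (gtr0_norm y0).
  by rewrite ler_piMl// ?cos_max// ltW.
have cosx y : 0 <= y -> 0 <= 1 - cos y <= y ^+ 2.
  rewrite subr_ge0 cos_le1 /= => y0.
  have yE : y = (y / 2) *+ 2 by rewrite -mulr_natr divfK.
  have : `|sin (y / 2)| <= y / 2 by apply: sinx; lra.
  rewrite [in cos y]yE cos_mulr2n cos2sin2 => sy.
  have : sin (y / 2) ^+ 2 <= (y / 2) ^+ 2.
    by rewrite -[leLHS]real_normK ?num_real// ler_pXn2r// nnegrE//; lra.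
  by nra.
split; first exact: sinx.
split; last by have /andP[h1 h2] := cosx _ x0; rewrite ger0_norm.
move: x0; rewrite le_eqVlt => /predU1P[<-|x0].
  by rewrite sin0 subr0 normr0 expr0n.
pose f t : R := t - sin t.
have df (t : R) : is_derive t 1 f (1 - cos t).
  by apply: is_deriveB.
have cf : continuous f.
  by move=> t; apply: differentiable_continuous; apply/derivable1_diffP.
have [c] := @MVT R f (fun t => 1 - cos t) 0 x x0 (fun t _ => df t)
   (continuous_subspaceT cf).
rewrite in_itv /= => /andP[c0 cx].
rewrite {1 2}/f sin0 !subr0 => ->.
rewrite normrM (gtr0_norm x0).
rewrite expr2 ler_pM2r//.
rewrite ger0_norm; last by rewrite subr_ge0 cos_le1.
(* It remains to see [1 - cos c <= x]: clear when [x >= 2]; otherwise [1 - cos c = 2 sin^2 (c / 2)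
   <= c^2 / 2 <= c], because [c < x < 2]. *)
have [x1|x1] := lerP 2 x.
  have := cos_geN1 c; lra.
have /andP[_ h] := cosx _ (ltW c0).
have yE : c = (c / 2) *+ 2 by rewrite -mulr_natr divfK.
have : `|sin (c / 2)| <= c / 2 by apply: sinx; lra.
rewrite [in cos c]yE cos_mulr2n cos2sin2 => sy.
have : sin (c / 2) ^+ 2 <= (c / 2) ^+ 2.
  by rewrite -[leLHS]real_normK ?num_real// ler_pXn2r// nnegrE//; lra.
by nra.
Qed.

(** The real and imaginary parts contribute at most [3 x^2 + 7 y^2] together; the constant is
    generous. *)
Lemma cexp_sub1_bound z : normc z <= 2^-1 ->
  normc (cexp z - 1 - z) <= 20 * normc z ^+ 2.
Proof.
move=> z2; rewrite sqr_normcE.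
apply: (le_trans (ler_normc_ReIm _)).
have := ler_Re_normc z; have := ler_Im_normc z; move: z2.
case: z => x y; set r := normc _ => /= r2 yr xr.
have hx : `|x| <= 2^-1 by lra.
have [s0 [s1 s2]] : `|sin y| <= `|y| /\ `|y - sin y| <= y ^+ 2 /\ `|1 - cos y| <= y ^+ 2.
  have [y0|y0] := lerP 0 y.
    by rewrite (ger0_norm y0); exact: normr_sinB.
  have /normr_sinB : 0 <= - y by lra.
  rewrite sinN cosN sqrrN (normrN (sin y)) (ltr0_norm y0).
  by rewrite (_ : - y - - sin y = - (y - sin y)) ?normrN//; ring.
have ex := expR_sub1_bound hx.
have e3 : expR x <= 3.
  move: ex hx; rewrite !ler_norml => /andP[_ ?] /andP[? ?]; nra.
have e0 := expR_gt0 x.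
have A : `|expR x * cos y - 1 - x| <= 2 * x ^+ 2 + 3 * y ^+ 2.
  rewrite (_ : _ - _ = (expR x - 1 - x) - expR x * (1 - cos y)); last by ring.
  apply: (le_trans (ler_normB _ _)); apply: lerD => //.
  by rewrite normrM (gtr0_norm e0) ler_pM// ltW.
have B : `|expR x * sin y - y| <= 3 * y ^+ 2 + 2 * `|x| * `|y|.
  rewrite (_ : _ - _ = (expR x - 1) * y - expR x * (y - sin y)); last by ring.
  rewrite addrC; apply: (le_trans (ler_normD _ _)); apply: lerD.
    by rewrite normrN normrM (gtr0_norm e0) ler_pM// ltW.
  rewrite normrM ler_wpM2r//.
  rewrite (_ : _ - 1 = (expR x - 1 - x) + x); last by ring.
  apply: (le_trans (ler_normD _ _)).
  rewrite mulr_natl mulr2n lerD2r (le_trans ex)//.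
  rewrite -(@real_normK _ x) ?num_real//.
  by have := normr_ge0 x; nra.
have -> : expR x * sin y + 0 * cos y - 0 - y = expR x * sin y - y by ring.
have -> : expR x * cos y - 0 * sin y - 1 - x = expR x * cos y - 1 - x by ring.
have h : 2 * `|x| * `|y| <= x ^+ 2 + y ^+ 2.
  rewrite -(@real_normK _ x) ?num_real// -(@real_normK _ y) ?num_real//.
  by have := sqr_ge0 (`|x| - `|y|); nra.
have := sqr_ge0 x; have := sqr_ge0 y; lra.
Qed.

(** With [N = n + 1], [e^z] is the [N]-th power of [e^(z/N)]. Factoring a difference of [N]-th
    powers leaves one factor of order [(|z| / N)^2] and [N] summands of modulus at most [e^|z|]. The
    approximants are polynomials, as [entire] requires. *)
Lemma cexp_approx z n : (2 * normc z <= n.+1%:R) ->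
  normc (cexp z - (1 + z / n.+1%:R) ^+ n.+1) <=
  20 * normc z ^+ 2 * expR (normc z) / n.+1%:R.
Proof.
set N := n.+1 => zn.
have N0 : 0 < N%:R :> R by rewrite ltr0n.
pose v := z / N%:R.
have nN : normc (N%:R : R[i]) = N%:R.
  by rewrite -[N%:R](rmorph_nat (real_complex R)) normc_real ger0_norm// ltW.
have nv : normc v = normc z / N%:R by rewrite normcM normcV nN.
have vz : cexp z = cexp v ^+ N.
  rewrite -cexp_nat; congr cexp.
  by rewrite -[RHS]mulr_natr /v divfK// pnatr_eq0.
have v2 : normc v <= 2^-1 by rewrite nv ler_pdivrMr//; lra.
rewrite vz -/v subrXX; apply: (le_trans (_ : _ <= normc (cexp v - (1 + v)) *
  \sum_(i < N) expR (normc z))).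
  rewrite normcM ler_wpM2l ?normc_ge0//.
  apply: (le_trans (normc_sum _ _ _)); apply: ler_sum => i _.
  rewrite normcM !normcX.
  have h1 : normc (cexp v) <= expR (normc v).
    by rewrite normc_cexp ler_expR (le_trans _ (ler_Re_normc _))// ler_norm.
  have h2 : normc (1 + v) <= expR (normc v).
    by rewrite (le_trans (le_normcD _ _))// normc1 expR_ge1Dx.
  apply: (le_trans (_ : _ <= expR (normc v) ^+ (N.-1 - i) * expR (normc v) ^+ i)).
    by apply: ler_pM; rewrite ?exprn_ge0 ?normc_ge0// lerXn2r// nnegrE ?normc_ge0 ?expR_ge0.
  rewrite -exprD subnK; last by rewrite -ltnS prednK.
  rewrite -expRM_natl ler_expR nv mulrCA ler_piMr ?normc_ge0//.
  by rewrite ler_pdivrMr// mul1r ler_nat leq_pred.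
rewrite sumr_const card_ord -(mulr_natr (expR _)).
rewrite opprD addrA.
apply: (le_trans (_ : _ <= 20 * normc v ^+ 2 * (expR (normc z) * N%:R))).
  by rewrite ler_wpM2r ?mulr_ge0 ?expR_ge0 ?ler0n// cexp_sub1_bound.
rewrite nv le_eqVlt; apply/orP; left; apply/eqP.
by field; rewrite lt0r_neq0.
Qed.

End ComplexExponential.

(** * Entire functions: Cauchy estimates, Liouville's theorem, the identity theorem *)

Section EntireFunctions.
Context {R : realType}.
Implicit Types (p : {poly R[i]}) (g h : R[i] -> R[i]) (z w : R[i]).

(* The usual notion, up to Taylor expansion: an entire function is a locally
   uniform limit of polynomials. *)
Definition entire (g : R[i] -> R[i]) : Prop :=
  forall r e : R, 0 < e ->
    exists p, forall z, normc z <= r -> normc (g z - p.[z]) <= e.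

Lemma entire_unif_limit g :
  (forall r e : R, 0 < e -> exists h, entire h /\
     forall z, normc z <= r -> normc (g z - h z) <= e) -> entire g.
Proof.
move=> gh r e e0; have e2 : 0 < e / 2 by rewrite divr_gt0.
have [h [/(_ r _ e2)[p hp] {}gh]] := gh r _ e2.
exists p => z zr.
rewrite (_ : _ - _ = (g z - h z) + (h z - p.[z])); last by ring.
by apply: (le_trans (le_normcD _ _)); rewrite (splitr e) lerD ?gh ?hp.
Qed.

Lemma entireB g h : entire g -> entire h -> entire (fun z => g z - h z).
Proof.
move=> eg eh r e e0; have e2 : 0 < e / 2 by rewrite divr_gt0.
have [p gp] := eg r _ e2; have [q hq] := eh r _ e2.
exists (p - q) => z zr; rewrite hornerD hornerN.
rewrite (_ : _ - _ = (g z - p.[z]) - (h z - q.[z])); last by ring.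
apply: (le_trans (le_normcD _ _)); rewrite normcN (splitr e) lerD//.
- exact: gp.
- exact: hq.
Qed.

Lemma entireD g h : entire g -> entire h -> entire (fun z => g z + h z).
Proof.
move=> eg eh r e e0; have e2 : 0 < e / 2 by rewrite divr_gt0.
have [p gp] := eg r _ e2; have [q hq] := eh r _ e2.
exists (p + q) => z zr; rewrite hornerD.
rewrite (_ : _ - _ = (g z - p.[z]) + (h z - q.[z])); last by ring.
apply: (le_trans (le_normcD _ _)); rewrite (splitr e) lerD//.
- exact: gp.
- exact: hq.
Qed.

Lemma entire_cst c : entire (fun=> c).
Proof.
move=> r e e0; exists c%:P => z _.
by rewrite hornerC subrr normc0 ltW.
Qed.

Lemma entireZ c g : entire g -> entire (fun z => c * g z).
Proof.
move=> eg r e e0.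
have c1 : 0 < normc c + 1 by rewrite ltr_wpDl// normc_ge0.
have [p gp] := eg r _ (divr_gt0 e0 c1).
exists (c *: p) => z zr; rewrite hornerZ -mulrBr normcM.
apply: (le_trans (ler_wpM2l (normc_ge0 _) (gp _ zr))).
rewrite mulrCA ler_piMr ?(ltW e0)// ler_pdivrMr// mul1r.
by rewrite lerDl.
Qed.

Lemma entire_sum (I : Type) (s : seq I) (G : I -> R[i] -> R[i]) :
  (forall i, entire (G i)) -> entire (fun z => \sum_(i <- s) G i z).
Proof.
move=> eG; elim: s => [|i s IH].
  rewrite (_ : (fun z => _) = (fun=> 0)); first exact: entire_cst.
  by apply/funext => z; rewrite big_nil.
rewrite (_ : (fun z => _) = (fun z => G i z + \sum_(j <- s) G j z)).
  exact: entireD.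
by apply/funext => z; rewrite big_cons.
Qed.

Lemma entire_cexp_quadratic (a b : R[i]) :
  entire (fun z => cexp (a * z ^+ 2 + b * z)).
Proof.
move=> r0 e e0; pose r := Num.max r0 0.
have r_ge0 : 0 <= r by rewrite /r le_max lexx orbT.
pose W := normc a * r ^+ 2 + normc b * r.
have W0 : 0 <= W by rewrite addr_ge0// mulr_ge0 ?normc_ge0// exprn_ge0.
pose K := 20 * W ^+ 2 * expR W.
have K0 : 0 <= K by rewrite !mulr_ge0 ?exprn_ge0 ?expR_ge0.
(* [W] bounds the exponent on the disc. The summand [2 W] meets the hypothesis of [cexp_approx], and
   [K / e] brings its error below [e]. *)
pose n := (Num.trunc (2 * W + K / e)).
have nK : 2 * W + K / e <= n.+1%:R.
  rewrite ltW// truncnS_gt//.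
exists ((1 + (n.+1%:R^-1 *: (a *: 'X^2 + b *: 'X))) ^+ n.+1) => z zr0.
have zr : normc z <= r by rewrite /r le_max zr0.
rewrite !hornerE/= -mulrA -expr2.
set w := a * z ^+ 2 + b * z.
have wW : normc w <= W.
  apply: (le_trans (le_normcD _ _)); rewrite lerD// !normcM ler_wpM2l ?normc_ge0//.
  by rewrite ler_pM ?normc_ge0.
rewrite [_^-1 * _]mulrC.
apply: (le_trans (cexp_approx _)).
  apply: le_trans nK; rewrite -[leLHS]addr0 lerD ?divr_ge0 ?(ltW e0)//.
  by rewrite ler_wpM2l.
rewrite ler_pdivrMr ?ltr0n//.
apply: (@le_trans _ _ K).
  apply: ler_pM; rewrite ?mulr_ge0 ?exprn_ge0 ?expR_ge0 ?normc_ge0 ?ler_expR//.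
  by rewrite ler_wpM2l// lerXn2r// nnegrE normc_ge0.
rewrite mulrC -ler_pdivrMr//.
by apply: le_trans nK; rewrite lerDr mulr_ge0.
Qed.

Lemma sum_roots_unity (n m : nat) : (0 < m < n)%N ->
  \sum_(j < n) expi ((2 * pi * m%:R / n%:R) *+ j) = 0 :> R[i].
Proof.
move=> /andP[m0 mn].
have n0 : (0 < n)%N by rewrite (leq_trans _ mn).
have nR : 0 < n%:R :> R by rewrite ltr0n.
pose x : R[i] := expi (2 * pi * m%:R / n%:R).
under eq_bigr do rewrite expiMn -/x.
have xn : x ^+ n = 1.
  rewrite -expiMn -[X in expi X]mulr_natr divfK ?gt_eqF//.
  have -> : 2 * pi * m%:R = 0 + pi *+ 2 *+ m :> R.
    by rewrite add0r mulr_natl mulr_natr.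
  rewrite /expi.
  rewrite (periodicn (@cosD2pi R)) (periodicn (@sinD2pi R)).
  by rewrite cos0 sin0.
(* The real part is [1 - 2 sin^2 (pi m / n)], and [pi m / n] lies strictly between [0] and [pi]. *)
have x1 : x != 1.
  rewrite eq_complex /= negb_and; apply/orP; left.
  have tE : 2 * pi * m%:R / n%:R = (pi * m%:R / n%:R) *+ 2 :> R by ring.
  rewrite tE cos_mulr2n cos2sin2.
  have : 0 < sin (pi * m%:R / n%:R : R).
    apply: sin_gt0_pi; rewrite divr_gt0 ?mulr_gt0 ?pi_gt0 ?ltr0n//=.
    by rewrite ltr_pdivrMr// ltr_pM2l ?pi_gt0// ltr_nat.
  move=> s0; rewrite lt_eqF//.
  by have := exprn_gt0 2 s0; lra.
have := subrX1 x n; rewrite xn subrr => /esym/eqP.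
by rewrite mulf_eq0 subr_eq0 (negPf x1) /= => /eqP.
Qed.

(* Averaging [p (r v) v ^ (- m)] over the roots of unity [v] of large order
   extracts the coefficient [p_m r ^ m] exactly. *)
Lemma poly_cauchy_estimate p (r M : R) m : 0 <= r ->
  (forall z, normc z <= r -> normc p.[z] <= M) -> normc p`_m * r ^+ m <= M.
Proof.
move=> r0 pM.
(* With [n] above all exponents of [p] and above [m], a difference [i - m] is a multiple of [n] only
   for [i = m], so no other coefficient is aliased onto [p_m]. *)
pose n := (maxn (size p) m.+1).
have mn : (m < n)%N by rewrite leq_max ltnSn orbT.
have n0 : (0 < n)%N by rewrite (leq_trans _ mn).
have nR : 0 < n%:R :> R by rewrite ltr0n.
have [th thE] : exists th : R, th = 2 * pi / n%:R by eexists.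
have key : \sum_(j < n) p.[r%:C * expi (th *+ j)] * expi (- (th *+ (j * m))) =
    n%:R * (p`_m * r%:C ^+ m).
  under eq_bigr => j _.
    rewrite (@horner_coef_wide _ n) ?leq_maxl// mulr_suml.
    under eq_bigr => i _.
      rewrite exprMn -mulrA -mulrA -expiMn -expiD -mulrnA.
      over.
    over.
  rewrite exchange_big /=.
  rewrite (bigD1 (Ordinal mn)) //= [X in _ + X]big1 ?addr0 => [|i im].
    under eq_bigr do rewrite subrr expi0 mulr1.
    by rewrite sumr_const card_ord mulr_natl.
  under eq_bigr do rewrite mulrA.
  rewrite -mulr_sumr.
  have [lt_im|lt_mi|eq_im] := ltngtP i m; last first.
  - by rewrite -val_eqE /= eq_im eqxx in im.
  - under eq_bigr => j _.
      rewrite (_ : th *+ (j * i) - th *+ (j * m) =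
        (2 * pi * (i - m)%N%:R / n%:R) *+ j); last first.
        rewrite ![(j * _)%N]mulnC !mulrnA -mulrnBl; congr (_ *+ j).
        have -> : (i - m)%:R = i%:R - m%:R :> R by rewrite natrB// ltnW.
        have -> : th *+ i = th * i%:R by rewrite mulr_natr.
        have -> : th *+ m = th * m%:R by rewrite mulr_natr.
        rewrite thE.
        by move: (i%:R : R) (m%:R : R) (n%:R^-1 : R) => I K N; ring.
      over.
    rewrite sum_roots_unity ?mulr0// subn_gt0 lt_mi /=.
    by rewrite (leq_ltn_trans (leq_subr _ _)).
  (* Here [i - m < 0]; adding a full turn replaces it by the exponent [n - (m - i)], which lies
     between [0] and [n]. *)
  - under eq_bigr => j _.
      rewrite (_ : th *+ (j * i) - th *+ (j * m) =
        (2 * pi * (n - (m - i))%N%:R / n%:R) *+ j - (pi *+ 2) *+ j); last first.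
        rewrite ![(j * _)%N]mulnC !mulrnA -!mulrnBl; congr (_ *+ j).
        have -> : (n - (m - i))%:R = n%:R - (m%:R - i%:R) :> R.
          rewrite natrB; last by rewrite (leq_trans (leq_subr _ _))// ltnW.
          by rewrite natrB// ltnW.
        have -> : th *+ i = th * i%:R by rewrite mulr_natr.
        have -> : th *+ m = th * m%:R by rewrite mulr_natr.
        rewrite thE.
        move: (i%:R : R) (m%:R : R) (n%:R : R) nR => I K N /gt_eqF/negbT N0.
        by field.
      rewrite expiD [X in _ * X](_ : _ = 1) ?mulr1; last first.
        rewrite -[X in expi X]add0r -mulNrn; have := expi0 (R := R).
        move=> <-; rewrite -[in RHS](addNr ((pi *+ 2) *+ j)) /expi.
        rewrite (periodicn (@cosD2pi R)) (periodicn (@sinD2pi R)) add0r mulNrn//.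
      over.
    rewrite sum_roots_unity ?mulr0// subn_gt0.
    rewrite (leq_ltn_trans (leq_subr _ _))//= ltn_subrL subn_gt0 lt_im /=.
    by [].
have : normc (n%:R * (p`_m * r%:C ^+ m)) <= n%:R * M.
  rewrite -key; apply: (le_trans (normc_sum _ _ _)).
  apply: (@le_trans _ _ (\sum_(j < n) M)); last first.
    by rewrite sumr_const card_ord mulr_natl.
  apply: ler_sum => j _; rewrite normcM normc_expi mulr1; apply: pM.
  by rewrite normcM normc_expi mulr1 normc_real ger0_norm.
rewrite normcM -[n%:R : R[i]](rmorph_nat (real_complex R)) normc_real.
rewrite (gtr0_norm nR) ler_pM2l// normcM normcX normc_real ger0_norm//.
Qed.

(** By the Cauchy estimates the tail is dominated by a geometric series of ratio [|w| / r <= 1/2],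
    whence the factor 2. The bound does not involve the degree of [p], so it applies uniformly to
    approximating polynomials. *)
Lemma poly_taylor_bound p (r M : R) d w : 0 < r ->
  (forall z, normc z <= r -> normc p.[z] <= M) -> 2 * normc w <= r ->
  normc (p.[w] - \sum_(m < d) p`_m * w ^+ m) <= 2 * M * (normc w / r) ^+ d.
Proof.
move=> r0 pM wr.
have [n dn pn] : exists2 n, (d <= n)%N & (size p <= n)%N.
  by exists (maxn (size p) d); rewrite ?leq_maxl ?leq_maxr.
pose x := normc w / r.
have x0 : 0 <= x by rewrite divr_ge0 ?normc_ge0// ltW.
have x2 : x <= 2^-1 by rewrite ler_pdivrMr//; lra.
have M0 : 0 <= M.
  by apply: le_trans (pM 0 _); rewrite ?normc_ge0// normc0 ltW.
rewrite (horner_coef_wide _ pn) -(subnKC dn) big_split_ord /= addrAC subrr add0r.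
apply: (le_trans (normc_sum _ _ _)).
apply: (@le_trans _ _ (\sum_(i < n - d) M * x ^+ d * x ^+ i)).
  apply: ler_sum => i _; rewrite -mulrA -exprD normcM normcX /x.
  rewrite expr_div_n mulrA ler_pdivlMr ?exprn_gt0//.
  rewrite mulrAC ler_wpM2r ?exprn_ge0 ?normc_ge0//.
  by apply: poly_cauchy_estimate => //; exact: ltW.
have Mx : 0 <= M * x ^+ d by rewrite mulr_ge0// exprn_ge0.
have -> : 2 * M * (normc w / r) ^+ d = M * x ^+ d * 2 by rewrite /x; ring.
rewrite -mulr_sumr ler_wpM2l//.
have := subrX1 x (n - d); set S := \sum_(i < _) _ => e.
have xn : 0 <= x ^+ (n - d) by rewrite exprn_ge0.
have S0 : 0 <= S by apply: sumr_ge0 => i _; rewrite exprn_ge0.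
nra.
Qed.

(** The approximating polynomial depends on [r], but its bound [C + e / 4] on the disc does not. The
    Taylor bound of order 1 then makes [p.[w] - p.[0]] of order [1 / r]; the explicit [r] makes it
    at most [e / 4]. *)
Lemma liouville g (C : R) : entire g -> (forall z, normc (g z) <= C) ->
  forall w, g w = g 0.
Proof.
move=> eg gC w; apply/eqP; rewrite -subr_eq0; apply/eqP/eq0_normc/eqP.
rewrite eq_le normc_ge0 andbT; apply/ler_addgt0Pl => e e0; rewrite addr0.
have C0 : 0 <= C by apply: le_trans (gC 0); exact: normc_ge0.
have e3 : 0 < e / 4 by rewrite divr_gt0.
pose W := normc w.
have W0 : 0 <= W by exact: normc_ge0.
pose r := 2 * W + 8 * (C + e / 4) * W / e + 1.
have r0 : 0 < r.
  have : 0 <= 8 * (C + e / 4) * W / e.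
    by rewrite divr_ge0 ?mulr_ge0 ?addr_ge0// ltW.
  rewrite /r; lra.
have rW : 2 * W <= r.
  have : 0 <= 8 * (C + e / 4) * W / e.
    by rewrite divr_ge0 ?mulr_ge0 ?addr_ge0// ltW.
  rewrite /r; lra.
have [p gp] := eg r _ e3.
have pM z : normc z <= r -> normc p.[z] <= C + e / 4.
  move=> zr; rewrite (_ : p.[z] = g z - (g z - p.[z])); last by ring.
  by apply: (le_trans (le_normcD _ _)); rewrite normcN lerD// gp.
have := poly_taylor_bound 1 r0 pM rW; rewrite big_ord_recl big_ord0 expr0 mulr1.
rewrite addr0 expr1 -horner_coef0 => h.
rewrite (_ : g w - g 0 = (g w - p.[w]) - (g 0 - p.[0]) + (p.[w] - p.[0])).
  2: by ring.
apply: (le_trans (le_normcD _ _)).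
have h1 : normc (g w - p.[w] - (g 0 - p.[0])) <= e / 4 + e / 4.
  apply: (le_trans (le_normcD _ _)); rewrite normcN lerD// gp//.
    by rewrite -/W; lra.
  by rewrite normc0 ltW.
have h2 : 2 * (C + e / 4) * (W / r) <= e / 4.
  rewrite mulrA ler_pdivrMr// /r.
  have -> : e / 4 * (2 * W + 8 * (C + e / 4) * W / e + 1) =
    e / 4 * (2 * W) + 2 * (C + e / 4) * W + e / 4 by field; rewrite gt_eqF.
  have : 0 <= e / 4 * (2 * W) by rewrite !mulr_ge0// ltW.
  lra.
rewrite -/W in h; lra.
Qed.

(** No power series of [g] is at hand. Instead, any polynomial close enough to [g] has small
    low-order coefficients: by induction on the order, evaluation at a tiny zero [x] of [g] isolates
    the next coefficient. The closeness depends on the order and on [eta], but not on the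
    polynomial. *)
Lemma entire_identity g : entire g ->
  (forall d : R, 0 < d -> exists x, 0 < x <= d /\ g x%:C = 0) ->
  forall w, g w = 0.
Proof.
move=> eg g0 w.
pose W := normc w; have W0 : 0 <= W by exact: normc_ge0.
pose r := 2 * W + 2; have r0 : 0 < r by rewrite /r; lra.
have rW : 2 * W <= r by rewrite /r; lra.
have [p0 gp0] := eg r 1 ltr01.
(* One bound for all approximants of error at most 1: compare [p] with the fixed [p0] through [g],
   which costs at most [1 + 1]. *)
pose M := \sum_(i < size p0) normc p0`_i * r ^+ i + 2.
have pM (e : R) p : e <= 1 -> (forall z, normc z <= r -> normc (g z - p.[z]) <= e) ->
    forall z, normc z <= r -> normc p.[z] <= M.
  move=> e1 gp z zr.
  rewrite (_ : p.[z] = p0.[z] + ((g z - p0.[z]) - (g z - p.[z]))); last by ring.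
  apply: (le_trans (le_normcD _ _)); rewrite lerD//.
    rewrite horner_coef; apply: (le_trans (normc_sum _ _ _)); apply: ler_sum => i _.
    by rewrite normcM normcX ler_wpM2l ?normc_ge0// lerXn2r// nnegrE ?normc_ge0// ltW.
  apply: (le_trans (le_normcD _ _)); rewrite normcN.
  rewrite -[2]/(1 + 1 : R) lerD ?gp0//.
  by rewrite (le_trans (gp _ _)).
have M0 : 0 < M.
  by rewrite ltr_wpDl// sumr_ge0// => i _; rewrite mulr_ge0 ?normc_ge0// exprn_ge0// ltW.
have coef_small m : forall eta : R, 0 < eta -> exists e : R, 0 < e <= 1 /\
    forall p, (forall z, normc z <= r -> normc (g z - p.[z]) <= e) ->
      forall i, (i < m)%N -> normc p`_i <= eta.
  elim: m => [|m IH] eta eta0; first by exists 1; rewrite ltr01 lexx; split.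
  (* At a zero [x <= d] the Taylor remainder of order [m + 1] is at most [eta x^m / 4]. *)
  pose d := Num.min 1 (eta * r ^+ m.+1 / (8 * M)).
  have d0 : 0 < d.
    by rewrite /d lt_min ltr01 !mulr_gt0 ?exprn_gt0// invr_gt0 mulr_gt0.
  have [x [/andP[x0 xd] gx]] := g0 _ d0.
  have x1 : x <= 1 by rewrite (le_trans xd)// /d ge_min lexx.
  have xeta : 2 * M * x <= eta / 4 * r ^+ m.+1.
    have : x <= eta * r ^+ m.+1 / (8 * M) by rewrite (le_trans xd)// /d ge_min lexx orbT.
    rewrite ler_pdivlMr ?mulr_gt0//; lra.
  (* The [m] lower terms at [x] then add up to at most [eta x^m / 4]. The tolerance [e] below gives
     the value of [p] at [x] the same bound, and three quarters of [eta x^m] remain for the term of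
     order [m]. *)
  pose eta' := Num.min eta (eta * x ^+ m / (4 * m.+1%:R)).
  have eta'0 : 0 < eta'.
    by rewrite /eta' lt_min eta0 !mulr_gt0 ?exprn_gt0// invr_gt0 mulr_gt0// ltr0n.
  have [e1 [/andP[e10 e11] he1]] := IH _ eta'0.
  pose e := Num.min e1 (eta * x ^+ m / 4).
  have e0 : 0 < e by rewrite /e lt_min e10 !mulr_gt0 ?exprn_gt0// invr_gt0.
  have ee1 : e <= e1 by rewrite /e ge_min lexx.
  exists e; split; first by rewrite e0 (le_trans ee1).
  move=> p gp i; rewrite ltnS leq_eqVlt => /predU1P[->|im]; last first.
    have := he1 p (fun z zr => le_trans (gp z zr) ee1) _ im.
    by move/le_trans; apply; rewrite /eta' ge_min lexx.
  have xr : 2 * normc x%:C <= r by rewrite normc_real gtr0_norm// /r; lra.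
  have xr' : normc x%:C <= r.
    by apply: le_trans xr; rewrite mulr_natl mulr2n lerDl normc_ge0.
  have := poly_taylor_bound m.+1 r0 (pM _ _ (le_trans ee1 e11) gp) xr.
  rewrite normc_real (gtr0_norm x0) => hT.
  have hx := gp _ xr'; rewrite gx sub0r normcN in hx.
  rewrite big_ord_recr /= in hT.
  have hS : normc (\sum_(i < m) p`_i * x%:C ^+ i) <= eta * x ^+ m / 4.
    apply: (le_trans (normc_sum _ _ _)).
    apply: (@le_trans _ _ (\sum_(i < m) eta')).
      apply: ler_sum => j _; rewrite normcM normcX normc_real (gtr0_norm x0).
      apply: (@le_trans _ _ (normc p`_j)).
        by rewrite ler_piMr ?normc_ge0// exprn_ile1// ltW.
      exact: (he1 p (fun z zr => le_trans (gp z zr) ee1)).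
    rewrite sumr_const card_ord -[leLHS]mulr_natr.
    apply: (@le_trans _ _ (eta * x ^+ m / (4 * m.+1%:R) * m.+1%:R)).
      rewrite ler_pM ?ler0n ?(ltW eta'0)// ?ler_nat//.
      by rewrite /eta' ge_min lexx orbT.
    rewrite le_eqVlt; apply/orP; left; apply/eqP; field.
    by rewrite nat1r pnatr_eq0.
  have xm : 0 < x ^+ m by rewrite exprn_gt0.
  have hT' : 2 * M * (x / r) ^+ m.+1 <= eta / 4 * x ^+ m.
    rewrite expr_div_n mulrA ler_pdivrMr ?exprn_gt0// exprS.
    rewrite (_ : 2 * M * _ = (2 * M * x) * x ^+ m); last by ring.
    rewrite (_ : eta / 4 * _ * _ = (eta / 4 * r ^+ m.+1) * x ^+ m); last by ring.
    by rewrite ler_wpM2r// ltW.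
  have : normc (p`_m * x%:C ^+ m) <= eta * x ^+ m.
    set S := \sum_(i < m) _ in hT hS.
    rewrite (_ : p`_m * x%:C ^+ m = p.[x%:C] - S - (p.[x%:C] - (S + p`_m * x%:C ^+ m)));
      last by ring.
    apply: (le_trans (le_normcD _ _)); rewrite normcN.
    have hh := le_normcD p.[x%:C] (- S); rewrite normcN in hh.
    have eE : e <= eta * x ^+ m / 4 by rewrite /e ge_min lexx orbT.
    have ex := mulr_gt0 eta0 xm.
    lra.
  by rewrite normcM normcX normc_real (gtr0_norm x0) ler_pM2r.
apply: eq0_normc; apply/eqP; rewrite eq_le normc_ge0 andbT.
apply/ler_addgt0Pl => e e0; rewrite addr0.
(* At [w] the ratio [|w| / r] is at most [1/2], so [d] coefficients determine the value up to
   [e / 3]; [d < 2^d] supplies such a [d]. *)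
have [d hd] : exists d, 2 * M * (2^-1) ^+ d <= e / 3.
  pose d := Num.trunc (6 * M / e); exists d.
  have hd : 6 * M / e < d.+1%:R by rewrite truncnS_gt.
  rewrite exprVn ler_pdivrMr ?exprn_gt0//.
  have : 2 * M <= e / 3 * d.+1%:R by move: hd; rewrite ltr_pdivrMr// => /ltW; lra.
  move/le_trans; apply; rewrite ler_wpM2l ?divr_ge0 ?(ltW e0)//.
  by rewrite -natrX ler_nat ltn_expl.
pose B := \sum_(i < d) W ^+ i + 1.
have B0 : 0 < B by rewrite ltr_wpDl// sumr_ge0// => i _; rewrite exprn_ge0.
have eB : 0 < e / (3 * B) by rewrite divr_gt0// mulr_gt0.
have [e1 [/andP[e10 e11] he1]] := coef_small d _ eB.
pose e2 := Num.min e1 (e / 3).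
have e20 : 0 < e2 by rewrite lt_min e10 divr_gt0.
have [p gp] := eg r _ e20.
have e21 : e2 <= e1 by rewrite ge_min lexx.
have cf := he1 p (fun z zr => le_trans (gp z zr) e21).
have hT := poly_taylor_bound d r0 (pM _ _ (le_trans e21 e11) gp) rW.
have hS : normc (\sum_(i < d) p`_i * w ^+ i) <= e / 3.
  apply: (le_trans (normc_sum _ _ _)).
  apply: (@le_trans _ _ (\sum_(i < d) e / (3 * B) * W ^+ i)).
    apply: ler_sum => i _; rewrite normcM normcX ler_wpM2r ?exprn_ge0//.
    exact: cf.
  rewrite -mulr_sumr; apply: (@le_trans _ _ (e / (3 * B) * B)).
    by rewrite ler_wpM2l ?(ltW eB)// /B lerDl.
  by rewrite le_eqVlt; apply/orP; left; apply/eqP; field; rewrite gt_eqF.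
have hw : normc (g w - p.[w]) <= e / 3.
  by rewrite (le_trans (gp _ _)) ?ge_min ?lexx ?orbT// -/W; lra.
have hx : 2 * M * (normc w / r) ^+ d <= e / 3.
  apply: le_trans hd; rewrite ler_wpM2l ?mulr_ge0 ?(ltW M0)//.
  rewrite lerXn2r// ?nnegrE ?divr_ge0 ?(ltW r0)// ler_pdivrMr// -/W; lra.
set S := \sum_(i < d) _ in hS hT.
rewrite (_ : g w = (g w - p.[w]) + (p.[w] - S) + S); last by ring.
apply: (le_trans (le_normcD _ _)).
have := le_normcD (g w - p.[w]) (p.[w] - S); lra.
Qed.

End EntireFunctions.

(** * Sums over the integers and over pairs of integers, with explicit rates *)

Section IntegerSums.
Context {R : realType}.
Implicit Types (k l n : int) (N M : nat).

(** The integers from [- N] to [N - 1]. Each step adds one integer on either side, [N] and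
    [- N - 1], and the range is stable under [k -> - 1 - k]. *)
Definition zs N : seq int := map Posz (iota 0 N) ++ map Negz (iota 0 N).

Lemma mem_zs N k : (k \in zs N) = (- N%:Z <= k < N%:Z).
Proof.
rewrite mem_cat; case: k => m.
  rewrite mem_map ?mem_iota; last by move=> ? ? [].
  rewrite [X in _ || X](_ : _ = false) ?orbF; last by apply/negbTE/mapP => -[].
  by rewrite /=; lia.
rewrite orbC mem_map ?mem_iota; last by move=> ? ? [].
rewrite [X in _ || X](_ : _ = false) ?orbF; last by apply/negbTE/mapP => -[].
by rewrite /= NegzE; lia.
Qed.

Lemma uniq_zs N : uniq (zs N).
Proof.
rewrite cat_uniq !map_inj_uniq ?iota_uniq /=; try by move=> ? ? [].
by rewrite andbT; apply/hasPn => _ /mapP[m _ ->]; apply/negP => /mapP[].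
Qed.

Lemma sub_zs N M : (N <= M)%N -> {subset zs N <= zs M}.
Proof. by move=> NM k; rewrite !mem_zs; lia. Qed.

Lemma zs_recr (V : nmodType) N (F : int -> V) :
  \sum_(k <- zs N.+1) F k = \sum_(k <- zs N) F k + (F (Posz N) + F (Negz N)).
Proof.
have E : iota 0 N.+1 = iota 0 N ++ [:: N] by rewrite -[N.+1]addn1 iotaD.
by rewrite /zs E !map_cat !big_cat /= !big_seq1 addrACA.
Qed.

Lemma normr_intr k : `|k%:~R : R| = `|k|%N%:R.
Proof. by rewrite -intr_norm -abszE. Qed.

(** The reference weight for summability: its sums over finite sets of integers are bounded by 3,
    and translation by [k0] changes it by a factor of at most [e^|k0|]. *)
Definition wt k : R := expR (- `|k%:~R|).

Lemma wt_ge0 k : 0 <= wt k. Proof. exact: expR_ge0. Qed.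

Lemma wt_le1 k : wt k <= 1.
Proof. by rewrite -[leRHS]expR0 ler_expR oppr_le0. Qed.

Lemma big_uniq_split (V : nmodType) (I : eqType) (s t : seq I) (F : I -> V) :
  uniq s -> uniq t -> {subset s <= t} ->
  \sum_(i <- t) F i = \sum_(i <- s) F i + \sum_(i <- t | i \notin s) F i.
Proof.
move=> us ut st; rewrite [LHS](bigID (mem s)) /=; congr (_ + _).
rewrite -big_filter; apply: perm_big; apply: uniq_perm; rewrite ?filter_uniq// => i.
by rewrite mem_filter /=; apply/idP/idP => [/andP[]//|is_]; rewrite is_ st.
Qed.

Lemma ler_sum_uniq (I : eqType) (s t : seq I) (F : I -> R) :
  uniq s -> uniq t -> {subset s <= t} -> (forall i, 0 <= F i) ->
  \sum_(i <- s) F i <= \sum_(i <- t) F i.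
Proof.
move=> us ut st F0; rewrite (big_uniq_split _ us ut st) lerDl.
exact: sumr_ge0.
Qed.

Lemma expRN1_le : expR (- 1) <= 2^-1 :> R.
Proof.
rewrite expRN lef_pV2 ?posrE ?expR_gt0//.
by have := expR_ge1Dx (1 : R); lra.
Qed.

Lemma sum_expRN N : \sum_(i < N) expR (- i%:R) <= 2 :> R.
Proof.
suff : \sum_(i < N) expR (- i%:R) <= 2 - 2^-1 ^+ N * 2 :> R.
  by move/le_trans; apply; rewrite gerBl mulr_ge0// exprn_ge0// invr_ge0.
elim: N => [|N IH]; first by rewrite big_ord0 expr0; lra.
rewrite big_ord_recr /= exprS.
have : expR (- N%:R) <= 2^-1 ^+ N :> R.
  rewrite -[- _]mulN1r expRM_natr lerXn2r// ?nnegrE ?expR_ge0 ?invr_ge0//.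
  exact: expRN1_le.
lra.
Qed.

(** The non-negative half contributes at most 2; the negative half is the same sum times
    [e^(-1) <= 1/2]. *)
Lemma sum_wt_zs N : \sum_(k <- zs N) wt k <= 3.
Proof.
rewrite /zs big_cat /= !big_map -[N in iota 0 N]subn0 -/(index_iota 0 N).
rewrite !big_mkord.
have -> : \sum_(i < N) wt (Posz i) = \sum_(i < N) expR (- i%:R).
  by apply: eq_bigr => i _; rewrite /wt normr_intr.
have -> : \sum_(i < N) wt (Negz i) = (\sum_(i < N) expR (- i%:R)) * expR (- 1).
  rewrite mulr_suml; apply: eq_bigr => i _.
  by rewrite /wt normr_intr /= -natr1 opprD expRD.
have := sum_expRN N; have := expRN1_le.
have := expR_gt0 (- 1 : R); nra.
Qed.

Lemma sub_zs_ex (s : seq int) : exists N, {subset s <= zs N}.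
Proof.
elim: s => [|k s [N sN]]; first by exists 0%N.
exists (maxn N `|k|.+1) => l; rewrite inE => /predU1P[->|/sN].
  by rewrite mem_zs; lia.
by apply: sub_zs; exact: leq_maxl.
Qed.

Lemma sum_wt (s : seq int) : uniq s -> \sum_(k <- s) wt k <= 3.
Proof.
move=> us; have [N sN] := sub_zs_ex s.
apply: le_trans (sum_wt_zs N).
by apply: ler_sum_uniq; rewrite ?uniq_zs// => i; exact: wt_ge0.
Qed.

Lemma sum_wt_shift (s : seq int) k0 : uniq s -> \sum_(k <- s) wt (k - k0) <= 3.
Proof.
move=> us; rewrite -(big_map (fun k => k - k0) xpredT wt); apply: sum_wt.
by rewrite map_inj_uniq// => k l /addIr.
Qed.

Lemma notin_zs N k : k \notin zs N -> N%:R <= `|k%:~R : R|.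
Proof. by rewrite mem_zs normr_intr ler_nat; lia. Qed.

Lemma wt_notin_zs N k : k \notin zs N -> wt k <= expR (- N%:R).
Proof. by move/notin_zs => h; rewrite ler_expR lerN2. Qed.

Definition zs2 N : seq (int * int) := [seq (k, l) | k <- zs N, l <- zs N].

Definition wt2 (p : int * int) : R := wt p.1 * wt p.2.

Lemma wt2_ge0 p : 0 <= wt2 p. Proof. by rewrite mulr_ge0 ?wt_ge0. Qed.

Lemma uniq_zs2 N : uniq (zs2 N).
Proof. by rewrite allpairs_uniq ?uniq_zs// => -[? ?] [? ?]. Qed.

Lemma mem_zs2 N p : (p \in zs2 N) = (p.1 \in zs N) && (p.2 \in zs N).
Proof.
apply/allpairsP/andP => [[[k l]] /= [kN lN ->]//|[kN lN]].
by exists p; case: p kN lN => k l.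
Qed.

Lemma sub_zs2 N M : (N <= M)%N -> {subset zs2 N <= zs2 M}.
Proof. by move=> NM p; rewrite !mem_zs2 => /andP[h1 h2]; rewrite !(sub_zs NM). Qed.

Lemma sum_wt2 N : \sum_(p <- zs2 N) wt2 p <= 9.
Proof.
rewrite big_allpairs /wt2 /=.
under eq_bigr do rewrite -mulr_sumr.
rewrite -mulr_suml.
have := sum_wt_zs N.
have : 0 <= \sum_(k <- zs N) wt k by apply: sumr_ge0 => i _; exact: wt_ge0.
nra.
Qed.

Lemma wt2_notin N p : p \notin zs2 N -> wt2 p ^+ 2 <= expR (- N%:R) * wt2 p.
Proof.
rewrite expr2 mem_zs2 => h; rewrite ler_wpM2r ?wt2_ge0//.
have [w1 w2] := (wt_ge0 p.1, wt_ge0 p.2).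
have [v1 v2] := (wt_le1 p.1, wt_le1 p.2).
move: h; rewrite negb_and => /orP[] /wt_notin_zs; rewrite /wt2; nra.
Qed.

Lemma cvg_expRN (c : R) : (fun N => c * expR (- N%:R)) @ \oo --> (0 : R).
Proof.
rewrite -[X in _ --> X](mulr0 c); apply: cvgM; first exact: cvg_cst.
exact: cvgn_expR.
Qed.

(* The exponent [2] leaves room for one factor [wt2] of geometric decay. *)
Definition dominated2 (A : R) (F : int * int -> R[i]) :=
  forall p, normc (F p) <= A * wt2 p ^+ 2.

Lemma dominated2_ge0 A F : dominated2 A F -> 0 <= A.
Proof.
move=> /(_ (0, 0)); rewrite /wt2 /wt /= normr0 oppr0 expR0 mulr1 expr1n mulr1.
by apply: le_trans; exact: normc_ge0.
Qed.

(** Outside the square one of the two weights is at most [e^(- N)]; that pays for one factor [wt2],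
    and the other factor sums to at most 9. *)
Lemma dominated2_tail A F N M : dominated2 A F -> (N <= M)%N ->
  normc (\sum_(p <- zs2 M) F p - \sum_(p <- zs2 N) F p) <=
  9 * A * expR (- N%:R).
Proof.
move=> dF NM; have A0 := dominated2_ge0 dF.
rewrite (big_uniq_split _ (uniq_zs2 N) (uniq_zs2 M) (sub_zs2 NM)) addrAC subrr add0r.
apply: (le_trans (normc_sum _ _ _)).
apply: (@le_trans _ _ (\sum_(p <- zs2 M | p \notin zs2 N) A * expR (- N%:R) * wt2 p)).
  apply: ler_sum => p pN; apply: (le_trans (dF p)).
  by rewrite -mulrA ler_wpM2l// wt2_notin.
rewrite -mulr_sumr.
have Ae : 0 <= A * expR (- N%:R) by rewrite mulr_ge0 ?expR_ge0.
have -> : 9 * A * expR (- N%:R) = A * expR (- N%:R) * 9 by ring.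
rewrite ler_wpM2l//; apply: le_trans (sum_wt2 M).
rewrite big_mkcond; apply: ler_sum => p _.
by case: ifP => // _; exact: wt2_ge0.
Qed.

(** Completeness with the rate kept: the later estimates need the error and not only convergence. *)
Lemma cauchy_limit (s : nat -> R) (b : nat -> R) : b @ \oo --> 0 ->
  (forall N M, (N <= M)%N -> `|s M - s N| <= b N) ->
  exists L, forall N, `|s N - L| <= b N.
Proof.
move=> b0 sb.
have cs : cvg (s @ \oo).
  apply/cauchy_cvgP/cauchy_exP => e e0.
  move/cvgr_lt : b0 => /(_ _ e0)[N _ /(_ N (leqnn N)) bN].
  exists (s N); exists N => // M /= NM.
  rewrite /ball /= distrC.
  by apply: le_lt_trans (sb _ _ NM) _.
exists (limn s) => N.
have h : (fun M => `|s M - s N|) @ \oo --> `|limn s - s N|.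
  by apply: cvg_norm; apply: cvgB => //; exact: cvg_cst.
rewrite distrC -(cvg_lim (@Rhausdorff R) h); apply: limr_le.
  by apply/cvg_ex; exists `|limn s - s N|.
by exists N => // M /= NM; exact: sb.
Qed.

Lemma cauchy_limitC (s : nat -> R[i]) (b : nat -> R) : b @ \oo --> 0 ->
  (forall N M, (N <= M)%N -> normc (s M - s N) <= b N) ->
  exists L, forall N, normc (s N - L) <= 2 * b N.
Proof.
move=> b0 sb.
have [x hx] : exists L, forall N, `|complex.Re (s N) - L| <= b N.
  apply: cauchy_limit b0 _ => N M NM; apply: le_trans (sb _ _ NM).
  by apply: le_trans (ler_Re_normc _); case: (s M) => ? ?; case: (s N).
have [y hy] : exists L, forall N, `|complex.Im (s N) - L| <= b N.
  apply: cauchy_limit b0 _ => N M NM; apply: le_trans (sb _ _ NM).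
  by apply: le_trans (ler_Im_normc _); case: (s M) => ? ?; case: (s N).
exists (x +i* y) => N; apply: (le_trans (ler_normc_ReIm _)).
rewrite mulr_natl mulr2n; apply: lerD.
  by have := hx N; case: (s N).
by have := hy N; case: (s N).
Qed.

Lemma dominated2_limit A F : dominated2 A F ->
  exists L, forall N, normc (\sum_(p <- zs2 N) F p - L) <= 18 * A * expR (- N%:R).
Proof.
move=> dF.
have [|N M NM|L hL] := @cauchy_limitC (fun N => \sum_(p <- zs2 N) F p)
    (fun N => 9 * A * expR (- N%:R)).
- exact: cvg_expRN.
- exact: dominated2_tail.
- exists L => N; apply: le_trans (hL N) _.
  by rewrite !mulrA -natrM.
Qed.

(** The Cesàro weight. On [zs N.+1] it lies between 0 and 1 and vanishes at the unpaired endpoint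
    [- (N + 1)], so the asymmetric range does no harm. *)
Definition fejerw N l : R := 1 - `|l%:~R| / N.+1%:R.

(** The weight differs from 1 by [|l| / (N + 1)], and [|l| e^(- |l|) <= 1] absorbs the numerator
    into one spare factor of domination. This gives [9 A]; the truncation error adds [18 A], since
    [e^(- (N + 1)) <= 1 / (N + 1)]. *)
Lemma dominated2_fejer A F L N : dominated2 A F ->
  (forall N, normc (\sum_(p <- zs2 N) F p - L) <= 18 * A * expR (- N%:R)) ->
  normc (\sum_(p <- zs2 N.+1) (fejerw N p.2)%:C * F p - L) <= 27 * A / N.+1%:R.
Proof.
move=> dF hL; have A0 := dominated2_ge0 dF.
have N0 : 0 < N.+1%:R :> R by rewrite ltr0n.
rewrite (_ : _ - L = (\sum_(p <- zs2 N.+1) (fejerw N p.2)%:C * F p -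
  \sum_(p <- zs2 N.+1) F p) + (\sum_(p <- zs2 N.+1) F p - L)); last by ring.
apply: (le_trans (le_normcD _ _)).
rewrite (_ : 27 * A / N.+1%:R = 9 * A / N.+1%:R + 18 * A / N.+1%:R); last by ring.
apply: lerD; last first.
  apply: (le_trans (hL _)); rewrite ler_wpM2l ?mulr_ge0//.
  rewrite expRN lef_pV2 ?posrE ?expR_gt0//.
  by rewrite (le_trans _ (expR_ge1Dx _))// lerDr.
rewrite -sumrB; apply: (le_trans (normc_sum _ _ _)).
apply: (@le_trans _ _ (\sum_(p <- zs2 N.+1) A / N.+1%:R * wt2 p)).
  apply: ler_sum => p _.
  rewrite (_ : _ - _ = ((fejerw N p.2) - 1)%:C * F p); last first.
    have -> : (fejerw N p.2 - 1)%:C = (fejerw N p.2)%:C - 1 :> R[i].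
      by rewrite rmorphB rmorph1.
    by ring.
  rewrite normcM normc_real /fejerw addrC addKr normrN normrM normr_id.
  rewrite normfV (gtr0_norm N0) mulrAC [leRHS]mulrAC ler_wpM2r ?invr_ge0 ?(ltW N0)//.
  apply: (@le_trans _ _ (`|p.2%:~R| * (A * wt2 p ^+ 2))).
    by rewrite ler_wpM2l.
  rewrite mulrCA ler_wpM2l// expr2 mulrA ler_piMl ?wt2_ge0//.
  apply: (@le_trans _ _ (`|p.2%:~R| * wt p.2)).
    by rewrite ler_wpM2l// /wt2 ler_piMl ?wt_ge0 ?wt_le1.
  rewrite /wt expRN ler_pdivrMr ?expR_gt0// mul1r.
  by rewrite (le_trans _ (expR_ge1Dx _))// lerDr.
have -> : 9 * A / N.+1%:R = A / N.+1%:R * 9 by ring.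
rewrite -mulr_sumr ler_wpM2l//.
  by rewrite mulr_ge0// invr_ge0 ltW.
exact: sum_wt2.
Qed.

Lemma cvgr_sum (I : Type) (s : seq I) (x : nat -> I -> R) (y : I -> R) :
  (forall i, x ^~ i @ \oo --> y i) ->
  \sum_(i <- s) x N i @[N --> \oo] --> \sum_(i <- s) y i.
Proof.
move=> xy; elim: s => [|i s IH].
  rewrite big_nil (_ : (fun N => _) = (fun=> 0)); first exact: cvg_cst.
  by apply/funext => N; rewrite big_nil.
rewrite big_cons (_ : (fun N => _) = (fun N => x N i + \sum_(j <- s) x N j)).
  exact: cvgD.
by apply/funext => N; rewrite big_cons.
Qed.

(** Beyond a fixed [K] the two families together contribute at most [2 A e^(- K) * 3], whatever [N];
    below [K] there are finitely many limits. The range of summation may grow with [N] at the same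
    time. *)
Lemma tannery (x : nat -> int -> R) (y : int -> R) (A : R) :
  (forall N k, `|x N k| <= A * wt k ^+ 2) ->
  (forall k, x ^~ k @ \oo --> y k) ->
  (fun N => \sum_(k <- zs N) (x N k - y k)) @ \oo --> 0.
Proof.
move=> xA xy.
have A0 : 0 <= A.
  have := xA 0%N 0; rewrite /wt /= normr0 oppr0 expR0 expr1n mulr1.
  by apply: le_trans.
have yA k : `|y k| <= A * wt k ^+ 2.
  have h : (fun N => `|x N k|) @ \oo --> `|y k| by apply: cvg_norm; exact: xy.
  rewrite -(cvg_lim (@Rhausdorff R) h); apply: limr_le; last exact: nearW.
  by apply/cvg_ex; eexists; exact: h.
apply/cvgr0Pnorm_le => e e0.
have [K _ hK] : \forall K \near \oo, 6 * A * expR (- K%:R) <= e / 2.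
  have := cvg_expRN (6 * A).
  by move/cvgr_le => /(_ (e / 2)); apply; rewrite divr_gt0.
have {}hK := hK K (leqnn K).
have fin : (fun N => \sum_(k <- zs K) `|x N k - y k|) @ \oo --> 0.
  have E : \sum_(k <- zs K) (0 : R) = 0 by rewrite big1.
  rewrite -[X in _ --> X]E; apply: cvgr_sum => k.
  rewrite -[X in _ --> X](@normr0 R R) -[X in `|X|](subrr (y k)); apply: cvg_norm.
  by apply: cvgB; [exact: xy|exact: cvg_cst].
have e2 : 0 < e / 2 by rewrite divr_gt0.
move/cvgr_le : fin => /(_ _ e2)[N0 _ hN0].
exists (maxn K N0) => // N /=; rewrite geq_max => /andP[KN N0N].
rewrite (big_uniq_split _ (uniq_zs K) (uniq_zs N) (sub_zs KN)).
apply: (le_trans (ler_normD _ _)); rewrite (splitr e); apply: lerD.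
  by apply: (le_trans (ler_norm_sum _ _ _)); exact: hN0.
apply: (le_trans (ler_norm_sum _ _ _)); apply: le_trans hK.
apply: (@le_trans _ _ (\sum_(k <- zs N | k \notin zs K) 2 * A * expR (- K%:R) * wt k)).
  apply: ler_sum => k kK; apply: (le_trans (ler_normB _ _)).
  apply: (le_trans (lerD (xA N k) (yA k))).
  rewrite -mulrA -mulrDl (_ : A + A = 2 * A); last by ring.
  rewrite -!mulrA ler_wpM2l// ler_wpM2l// expr2 ler_wpM2r ?wt_ge0//.
  exact: wt_notin_zs.
rewrite -mulr_sumr.
have -> : 6 * A * expR (- K%:R) = 2 * A * expR (- K%:R) * 3 by ring.
rewrite ler_wpM2l ?mulr_ge0 ?expR_ge0//.
apply: le_trans (sum_wt_zs N).
rewrite big_mkcond; apply: ler_sum => k _.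
by case: ifP => // _; exact: wt_ge0.
Qed.

End IntegerSums.

(** * The coefficients [psi] obtained from a theta function *)

Section DualWindow.
Context {R : realType}.
Implicit Types (k l n j : int) (N M m : nat).

Lemma quadratic_bound (c b : R) : 0 < c ->
  exists A, forall x : R, - c * x ^+ 2 + b * `|x| <= A.
Proof.
move=> c0; exists (b ^+ 2 / (4 * c)) => x.
rewrite -(@real_normK _ x) ?num_real//.
have := sqr_ge0 (2 * c * `|x| - b); move: `|x| => y h.
rewrite ler_pdivlMr ?mulr_gt0//; nra.
Qed.

Definition dominated (A : R) (u : int -> R) := forall k, `|u k| <= A * wt k ^+ 2.

Lemma wt2E k : wt k ^+ 2 = expR (- 2 * `|k%:~R|) :> R.
Proof. by rewrite /wt -expRM_natl mulrN mulNr. Qed.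

Lemma dominated_shift A u j : dominated A u ->
  dominated (A * expR (2 * `|j%:~R|)) (fun k => u (k + j)).
Proof.
move=> uA k; apply: (le_trans (uA _)).
have A0 : 0 <= A.
  have := uA 0; rewrite /wt /= normr0 oppr0 expR0 expr1n mulr1.
  exact: le_trans.
rewrite -mulrA ler_wpM2l// !wt2E -expRD ler_expR intrD.
have := ler_normB (k%:~R + j%:~R) (j%:~R : R); rewrite addrK; lra.
Qed.

Lemma dominated_cvg A u : dominated A u ->
  u (Posz N) @[N --> \oo] --> 0 /\ u (Negz N) @[N --> \oo] --> 0.
Proof.
move=> uA.
have A0 : 0 <= A.
  have := uA 0; rewrite /wt /= normr0 oppr0 expR0 expr1n mulr1.
  exact: le_trans.
have lim := cvg_expRN A.
have bnd k N : N%:R <= `|k%:~R : R| -> `|u k| <= A * expR (- N%:R).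
  move=> h; apply: (le_trans (uA k)); rewrite ler_wpM2l// wt2E ler_expR.
  by have := ler0n R N; lra.
split; apply/norm_cvg0P; apply: (squeeze_cvgr _ (cvg_cst 0) lim); apply: nearW => N.
  by rewrite normr_ge0 bnd// normr_intr.
by rewrite normr_ge0 bnd// normr_intr ler_nat.
Qed.

Definition zlim (u : int -> R) (L : R) := \sum_(k <- zs N) u k @[N --> \oo] --> L.

Lemma zlim_unique u L L' : zlim u L -> zlim u L' -> L = L'.
Proof. exact: (@cvg_unique _ (@Rhausdorff R)). Qed.

Lemma zlimB u v L L' : zlim u L -> zlim v L' -> zlim (fun k => u k - v k) (L - L').
Proof.
move=> uL vL; rewrite /zlim.
rewrite (_ : (fun N => _) = (fun N => \sum_(k <- zs N) u k - \sum_(k <- zs N) v k)).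
  exact: cvgB.
by apply/funext => N; rewrite sumrB.
Qed.

Lemma zlimZ u L (c : R) : zlim u L -> zlim (fun k => c * u k) (c * L).
Proof.
move=> uL; rewrite /zlim.
rewrite (_ : (fun N => _) = (fun N => c * \sum_(k <- zs N) u k)).
  by apply: cvgM => //; exact: cvg_cst.
by apply/funext => N; rewrite mulr_sumr.
Qed.

Lemma eq_zlim u v L : u =1 v -> zlim u L -> zlim v L.
Proof. by move=> /funext ->. Qed.

Lemma zlim_rev u L : zlim u L -> zlim (fun k => u (- 1 - k)) L.
Proof.
rewrite /zlim; set f := (X in X @ _ --> _ -> _); set g := (X in _ -> X @ _ --> _).
suff -> : g = f by [].
apply/funext => N; rewrite /f /g /zs !big_cat /= !big_map addrC.
congr (_ + _); apply: eq_bigr => i _; congr u.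
  by rewrite NegzE; lia.
by rewrite NegzE; lia.
Qed.

(** The shifted range gains [u N] and loses [u (- N)], and domination sends both to 0. *)
Lemma zlim_shift1 A u L : dominated A u -> zlim u L -> zlim (fun k => u (k + 1)) L.
Proof.
move=> uA uL; have [u1 u2] := dominated_cvg uA.
have E N : \sum_(k <- zs N) u (k + 1) = \sum_(k <- zs N) u k + (u N - u (- N%:Z)).
  elim: N => [|N IH]; first by rewrite !big_nil subrr addr0.
  rewrite !zs_recr IH (_ : Negz N + 1 = - N%:Z); last by rewrite NegzE; lia.
  rewrite (_ : Posz N + 1 = N.+1); last by lia.
  by rewrite (_ : - N.+1%:Z = Negz N); [ring|rewrite NegzE].
suff h : \sum_(k <- zs N) u k + (u (Posz N) - u (- N%:Z)) @[N --> \oo] --> L + (0 - 0).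
  rewrite subrr addr0 in h; rewrite /zlim.
  by rewrite (_ : (fun N => _) = (fun N => \sum_(k <- zs N) u k + (u (Posz N) - u (- N%:Z))))//;
    apply/funext => N; rewrite E.
apply: cvgD => //; apply: cvgB => //.
rewrite -(cvg_shiftS (fun N => u (- N%:Z))).
by rewrite (_ : (fun N => _) = (fun N => u (Negz N))).
Qed.

Lemma zlim_shift A u L j : dominated A u -> zlim u L -> zlim (fun k => u (k + j)) L.
Proof.
have nat_shift (B : R) v L' m : dominated B v -> zlim v L' -> zlim (fun k => v (k + m%:Z)) L'.
  elim: m B v => [|m IH] B v vB vL.
    by apply: eq_zlim vL => k; rewrite addr0.
  have := zlim_shift1 (dominated_shift m vB) (IH _ _ vB vL).
  by apply: eq_zlim => k; congr v; lia.
case: j => m uA uL; first exact: nat_shift uA uL.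
(* The reflection [k -> - 1 - k] preserves [zs N] and turns a negative shift into a positive one. *)
have rA : dominated (A * expR (2 * `|(- 1)%:~R|)) (fun k => u (- 1 - k)).
  move=> k; have := dominated_shift (- 1) uA (- k).
  rewrite [- k - 1]addrC; rewrite (_ : wt (- k) = wt k)//.
  by rewrite /wt mulrNz normrN.
have h := zlim_rev (nat_shift _ _ _ m.+1 rA (zlim_rev uL)).
by apply: eq_zlim h => k /=; congr u; rewrite NegzE; lia.
Qed.

Definition dual_coef m : R := (- 1) ^+ m * expR (- pi * (m%:R * m.+1%:R)).

Lemma dual_coef_le m N : (m <= N)%N ->
  `|dual_coef N| <= expR (- pi * (m%:R * m.+1%:R)) * expR (- (N - m)%:R).
Proof.
move=> mN; rewrite normrM normrX normrN1 expr1n mul1r ger0_norm ?expR_ge0//.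
rewrite -expRD ler_expR -[in X in X <= _](subnKC mN); move: (N - m)%N => i.
rewrite -!natr1 natrD.
have := pi_ge2 R; have := ler0n R m; have := ler0n R i.
move: (i%:R : R) (m%:R : R) (pi : R) => I M p I0 M0 p2.
have : 0 <= p * (I * M) by rewrite !mulr_ge0//; lra.
have : 0 <= p * (I * I) by rewrite !mulr_ge0//; lra.
have : I <= p * I by rewrite ler_peMl//; lra.
nra.
Qed.

Lemma dual_window_ex : exists psi : nat -> R,
  (forall m, psi m - psi m.+1 = dual_coef m) /\
  (forall m, `|psi m| <= 2 * expR (- pi * (m%:R * m.+1%:R))).
Proof.
have tail m N : (m <= N)%N ->
    `|\sum_(m <= i < N) dual_coef i| <= 2 * expR (- pi * (m%:R * m.+1%:R)).
  move=> mN; apply: (le_trans (ler_norm_sum _ _ _)).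
  apply: (@le_trans _ _ (\sum_(m <= i < N)
     expR (- pi * (m%:R * m.+1%:R)) * expR (- (i - m)%:R))).
    by rewrite !big_nat; apply: ler_sum => i /andP[mi _]; exact: dual_coef_le.
  rewrite -mulr_sumr mulrC ler_wpM2r ?expR_ge0//.
  rewrite -{1}[m]add0n big_addn big_mkord.
  under eq_bigr do rewrite addnK.
  exact: sum_expRN.
have [|N M NM|L hL] := @cauchy_limit R (fun N => \sum_(0 <= i < N) dual_coef i)
   (fun N => 2 * expR (- pi * (N%:R * N.+1%:R))).
- have lim := @cvg_expRN R 2.
  apply: (squeeze_cvgr _ (cvg_cst 0) lim); apply: nearW => N.
  rewrite mulr_ge0 ?expR_ge0//= ler_wpM2l// ler_expR mulNr lerN2.
  rewrite -natr1; have := pi_ge2 R; have := ler0n R N.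
  move: (N%:R : R) (pi : R) => M p M0 p2.
  have : M <= p * M by rewrite ler_peMl//; lra.
  have : 0 <= p * (M * M) by rewrite !mulr_ge0//; lra.
  nra.
- by rewrite /= (big_cat_nat (leq0n N) NM)/= addrAC subrr add0r; exact: tail.
(* The limit minus a partial sum is a tail of the series, and the rate kept by [cauchy_limit] is
   exactly the bound wanted for it. *)
exists (fun N => L - \sum_(0 <= i < N) dual_coef i); split => m.
  by rewrite big_nat_recr//=; ring.
by rewrite distrC.
Qed.

Definition psin : nat -> R := sval (cid dual_window_ex).

(* [psi k = \sum_(i >= `|k|) (-1)^i e^(- pi i (i + 1))]: the coefficients of
   [theta w / (1 - w)], where [theta w = \sum_k (-1)^k e^(- pi k (k - 1)) w^k]
   is the theta function vanishing at all the [e^(2 pi n)]. *)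
Definition psi (k : int) : R := psin `|k|%N.

Lemma psi_bound k : `|psi k| <= 2 * expR (- pi * (`|k%:~R| * (`|k%:~R| + 1))).
Proof.
have [_ /(_ `|k|%N)] := svalP (cid dual_window_ex).
by rewrite normr_intr natr1.
Qed.

Definition theta_coef k : R := (- 1) ^+ `|k|%N * expR (- pi * (k%:~R * (k%:~R - 1))).

(** The relation [(1 - w) Psi w = theta w] on coefficients. The values [k = m + 1] and [k = - m]
    share [k (k - 1) = m (m + 1)] and carry opposite signs, which is consistent with [psi] being
    even. *)
Lemma psiB1 k : psi k - psi (k - 1) = theta_coef k.
Proof.
have [h _] := svalP (cid dual_window_ex).
case: k => [[|n]|n].
- have := h 0%N; rewrite /psi /theta_coef /dual_coef /= !mul0r => ->.
  by rewrite !mulr0.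
- rewrite (_ : Posz n.+1 - 1 = n); last by lia.
  have := h n; rewrite /psi /theta_coef /dual_coef /= -/psin => e.
  rewrite -opprB e exprS mulN1r mulNr; congr (- (_ * expR (_ * _))).
  by rewrite -pmulrn mulrC -natr1 addrK.
- rewrite (_ : Negz n - 1 = Negz n.+1); last by rewrite !NegzE; lia.
  have := h n.+1; rewrite /psi /theta_coef /dual_coef /= -/psin => ->.
  congr (_ * expR (_ * _)).
  by rewrite NegzE mulrNz -pmulrn -[n.+2%:R]natr1; ring.
Qed.

Lemma dominated_gauss (c b A : R) (u : int -> R) : 0 < c -> 0 <= A ->
  (forall k, `|u k| <= A * expR (- c * k%:~R ^+ 2 + b * `|k%:~R|)) ->
  exists B, dominated B u.
Proof.
move=> c0 A0 uA; have [D hD] := @quadratic_bound c (b + 2) c0.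
exists (A * expR D) => k; apply: (le_trans (uA k)).
rewrite -mulrA ler_wpM2l// wt2E -expRD ler_expR.
have := hD k%:~R; lra.
Qed.

Lemma dominated_psi (x : R) : exists B, dominated B (fun k => psi k * expR (x * k%:~R)).
Proof.
apply: (@dominated_gauss pi `|x| 2) => [||k]; rewrite ?pi_gt0//.
rewrite normrM (ger0_norm (expR_ge0 _)).
apply: (le_trans (ler_wpM2r (expR_ge0 _) (psi_bound k))).
rewrite -mulrA ler_wpM2l// -expRD ler_expR.
rewrite -(@real_normK _ k%:~R) ?num_real//.
have := ler_norm (x * k%:~R); rewrite normrM.
have : 0 <= pi * `|k%:~R : R| by rewrite mulr_ge0 ?pi_ge0.
nra.
Qed.

Lemma zlim_ex A u : dominated A u -> exists L, zlim u L.
Proof.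
move=> uA.
have A0 : 0 <= A.
  have := uA 0; rewrite /wt /= normr0 oppr0 expR0 expr1n mulr1.
  exact: le_trans.
have lim := cvg_expRN (3 * A).
have [|L hL] := cauchy_limit (s := fun N => \sum_(k <- zs N) u k) lim.
  move=> N M NM.
  rewrite (big_uniq_split _ (uniq_zs N) (uniq_zs M) (sub_zs NM)) addrAC subrr add0r.
  apply: (le_trans (ler_norm_sum _ _ _)).
  apply: (@le_trans _ _ (\sum_(k <- zs M | k \notin zs N) A * expR (- N%:R) * wt k)).
    apply: ler_sum => k kN; apply: (le_trans (uA k)).
    by rewrite -mulrA ler_wpM2l// expr2 ler_wpM2r ?wt_ge0// wt_notin_zs.
  rewrite -mulr_sumr.
  have -> : 3 * A * expR (- N%:R) = A * expR (- N%:R) * 3 by ring.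
  rewrite ler_wpM2l ?mulr_ge0 ?expR_ge0//.
  apply: le_trans (sum_wt_zs M).
  rewrite big_mkcond; apply: ler_sum => k _.
  by case: ifP => // _; exact: wt_ge0.
exists L; apply: cvg_sub0 (cvg_cst L).
apply/norm_cvg0P; apply: (squeeze_cvgr _ (cvg_cst 0) lim); apply: nearW => N.
by rewrite normr_ge0 /=; exact: hL.
Qed.

Lemma dominated_theta (x : R) :
  exists B, dominated B (fun k => theta_coef k * expR (x * k%:~R)).
Proof.
apply: (@dominated_gauss pi (pi + `|x|) 1) => [||k]; rewrite ?pi_gt0//.
rewrite /theta_coef !normrM !(ger0_norm (expR_ge0 _)) normrX normrN1 expr1n.
rewrite !mul1r -expRD ler_expR.
have := ler_norm (x * k%:~R : R); rewrite normrM.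
have := ler_norm (k%:~R : R); have := pi_ge0 R.
move: (k%:~R : R) (pi : R) => K p p0 K1 YX.
have : p * K <= p * `|K| by rewrite ler_wpM2l.
nra.
Qed.

(** The exponent [- pi k (k - 1) + 2 pi n k] is symmetric about [k = n + 1/2]. The reflection
    [k -> 2 n + 1 - k] preserves it and changes the parity of [k], so the sum equals its own
    opposite. *)
Lemma theta_zero n : zlim (fun k => theta_coef k * expR (2 * pi * n%:~R * k%:~R)) 0.
Proof.
set U := (fun k => _).
have [B UB] := dominated_theta (2 * pi * n%:~R).
have [L UL] := zlim_ex UB.
have h := zlim_rev (zlim_shift (2 * n + 2) UB UL).
have {}h : zlim (fun k => - 1 * U k) L.
  apply: eq_zlim h => k; rewrite /U /theta_coef.
  have -> : (- 1 - k + (2 * n + 2))%:~R = 1 + 2 * n%:~R - k%:~R :> R.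
    by rewrite !(rmorphB, rmorphD, rmorphN, rmorphM) /=; ring.
  have -> : (- 1) ^+ `|(- 1 - k + (2 * n + 2))%R|%N = - 1 * (- 1) ^+ `|k|%N :> R.
    rewrite mulN1r -[in RHS]signr_odd -signr_odd.
    rewrite (_ : odd `|(- 1 - k + (2 * n + 2))%R|%N = ~~ odd `|k|%N); last by lia.
    by case: odd; rewrite /= ?expr0 ?expr1 ?opprK.
  rewrite -!mulrA; congr (_ * (_ * _)); rewrite -!expRD; congr expR.
  by move: (n%:~R : R) (k%:~R : R) => x y; ring.
have e := zlim_unique h (zlimZ (c := - 1) UL).
have -> : 0 = L by lra.
exact: UL.
Qed.

(** At [w = e^(2 pi n)], which differs from 1, [(1 - w) Psi w = theta w = 0] forces [Psi w = 0].
    Shifting the index by [j] multiplies the sum by [w^j]. *)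
Lemma psi_zero n j : n != 0 ->
  zlim (fun k => psi (k - j) * expR (2 * pi * n%:~R * k%:~R)) 0.
Proof.
move=> n0; pose w : R := expR (2 * pi * n%:~R).
have w1 : w != 1.
  by rewrite -expR0 (inj_eq (@expR_inj R)) !mulf_neq0 ?intr_eq0// gt_eqF// pi_gt0.
pose X k : R := psi k * expR (2 * pi * n%:~R * k%:~R).
have [B XB] := dominated_psi (2 * pi * n%:~R).
have [L XL] := zlim_ex XB.
have X0 : L = 0.
  have h := zlimB XL (zlimZ (c := w) (zlim_shift (- 1) XB XL)).
  have : L - w * L = 0.
    apply: zlim_unique h _; apply: eq_zlim (theta_zero n) => k.
    rewrite -psiB1 mulrBl; congr (_ - _).
    rewrite mulrCA; congr (_ * _); rewrite -expRD; congr expR.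
    by rewrite intrD mulrDr; rewrite [(- 1)%:~R]mulrN1z; ring.
  move/eqP; rewrite -{1}[L]mul1r -mulrBl mulf_eq0 subr_eq0 eq_sym (negPf w1) /=.
  by move/eqP.
have := zlimZ (c := expR (2 * pi * n%:~R * j%:~R)) (zlim_shift (- j) XB XL).
rewrite X0 mulr0; apply: eq_zlim => k.
rewrite mulrCA; congr (_ * _); rewrite -expRD; congr expR.
by rewrite intrD mulrNz; ring.
Qed.

(** The central term dominates. From [psi 1 - psi 0 = - 1] and [|psi 1| <= 1/8] comes
    [psi 0 >= 7/8]; the other terms are at most [wt k / 4], hence at most [1/2] in all, and the sum
    is at least [3/8]. *)
Lemma psi_sum : exists2 C0 : R, 0 < C0 & forall j, zlim (fun k => psi (k - j)) C0.
Proof.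
have [B XB0] := dominated_psi 0.
have XB : dominated B psi.
  by move=> k; have := XB0 k; rewrite mul0r expR0 mulr1.
have [L XL] := zlim_ex XB.
exists L; last by move=> j; apply: zlim_shift XB XL.
have [h1 _] := svalP (cid dual_window_ex).
have e4 : expR (- 4) <= 16^-1 :> R.
  have := expRN1_le (R := R); have := expR_gt0 (- 1 : R).
  rewrite (_ : - 4 = 4 * - 1 :> R); last by ring.
  rewrite expRM_natl => e0 e1.
  have : expR (- 1) ^+ 4 <= 2^-1 ^+ 4 :> R by rewrite lerXn2r// nnegrE ltW.
  by move/le_trans; apply; rewrite !exprS expr0; lra.
have p0 : 7 / 8 <= psi 0.
  have := psi_bound 1; rewrite normr1 (_ : 1 * (1 + 1) = 2 :> R); last by ring.
  have := psiB1 1; rewrite subrr /theta_coef /= subrr !mulr0 expR0 mulr1 expr1.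
  have : expR (- pi * 2) <= expR (- 4) :> R.
    by rewrite ler_expR; have := pi_ge2 R; lra.
  rewrite ler_norml => ? ? /andP[? ?]; lra.
have : 3 / 8 <= L; last by apply: lt_le_trans; lra.
rewrite -(cvg_lim (@Rhausdorff R) XL); apply: limr_ge.
  by apply/cvg_ex; exists L.
exists 1%N => // N /= N1.
have z0 : 0 \in zs N by rewrite mem_zs; lia.
rewrite (bigD1_seq 0 z0 (uniq_zs N)) /=.
have hw := sum_wt_zs (R := R) N.
rewrite (bigD1_seq 0 z0 (uniq_zs N)) /= in hw.
have w0 : wt 0 = 1 :> R by rewrite /wt normr0 oppr0 expR0.
have : `|\sum_(i <- zs N | i != 0) psi i| <= 1 / 4 * \sum_(i <- zs N | i != 0) wt i.
  apply: (le_trans (ler_norm_sum _ _ _)); rewrite mulr_sumr; apply: ler_sum => k k0.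
  apply: (le_trans (psi_bound k)).
  have K1 : 1 <= `|k%:~R : R| by rewrite normr_intr ler1n; lia.
  have : expR (- pi * (`|k%:~R| * (`|k%:~R| + 1))) <= expR (- 3) * wt k :> R.
    rewrite -expRD ler_expR; have := pi_ge2 R.
    move: `|_| K1 (pi : R) => K K1 p p2.
    have : 2 * K <= p * K by rewrite ler_wpM2r//; lra.
    have : p * K * 1 <= p * K * K by rewrite ler_wpM2l// mulr_ge0; lra.
    nra.
  have : expR (- 3) <= 8^-1 :> R.
    have := expRN1_le (R := R); have := expR_gt0 (- 1 : R).
    rewrite (_ : - 3 = 3 * - 1 :> R); last by ring.
    rewrite expRM_natl => e0 e1.
    have : expR (- 1) ^+ 3 <= 2^-1 ^+ 3 :> R by rewrite lerXn2r// nnegrE ltW.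
    by move/le_trans; apply; rewrite !exprS expr0; lra.
  by have := wt_ge0 (R := R) k; nra.
rewrite ler_norml => /andP[h _]; lra.
Qed.

End DualWindow.

(** * Complex-valued integrals by real and imaginary parts *)

Section ComplexIntegral.
Context {R : realType}.
Local Notation mu := (@lebesgue_measure R).
Implicit Types (D : set (measurableTypeR R)) (f g : R -> R[i]) (c : R[i]).

(** [cintegral] with a domain; over [setT] the two unfold to the same term. *)
Definition cint D (f : R -> R[i]) : R[i] :=
  Rintegral mu D (fun t => complex.Re (f t)) +i*
  Rintegral mu D (fun t => complex.Im (f t)).

Definition cintegrable D (f : R -> R[i]) : Prop :=
  mu.-integrable D (EFin \o (fun t => complex.Re (f t))) /\
  mu.-integrable D (EFin \o (fun t => complex.Im (f t))).

Lemma integrableRZl D (h : R -> R) (r : R) : measurable D ->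
  mu.-integrable D (EFin \o h) -> mu.-integrable D (EFin \o (fun t => r * h t)).
Proof. by move=> mD ih; exact: (integrableZl mD r ih). Qed.

Lemma integrableRD D (h k : R -> R) : measurable D ->
  mu.-integrable D (EFin \o h) -> mu.-integrable D (EFin \o k) ->
  mu.-integrable D (EFin \o (fun t => h t + k t)).
Proof. by move=> mD ih ik; exact: (integrableD mD ih ik). Qed.

Lemma integrableRB D (h k : R -> R) : measurable D ->
  mu.-integrable D (EFin \o h) -> mu.-integrable D (EFin \o k) ->
  mu.-integrable D (EFin \o (fun t => h t - k t)).
Proof. by move=> mD ih ik; exact: (integrableB mD ih ik). Qed.

Lemma cReM (z w : R[i]) :
  complex.Re (z * w) = complex.Re z * complex.Re w - complex.Im z * complex.Im w.
Proof. by case: z w => ? ? [? ?]. Qed.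

Lemma cImM (z w : R[i]) :
  complex.Im (z * w) = complex.Re z * complex.Im w + complex.Im z * complex.Re w.
Proof. by case: z w => ? ? [? ?]. Qed.

Lemma cReD (z w : R[i]) : complex.Re (z + w) = complex.Re z + complex.Re w.
Proof. by case: z w => ? ? [? ?]. Qed.

Lemma cImD (z w : R[i]) : complex.Im (z + w) = complex.Im z + complex.Im w.
Proof. by case: z w => ? ? [? ?]. Qed.

Lemma cintegrableD D f g : measurable D -> cintegrable D f -> cintegrable D g ->
  cintegrable D (fun t => f t + g t).
Proof.
move=> mD [f1 f2] [g1 g2]; split.
  by rewrite (_ : (fun t => _) = (fun t => complex.Re (f t) + complex.Re (g t)));
    [exact: integrableRD|apply/funext => t; rewrite cReD].
by rewrite (_ : (fun t => _) = (fun t => complex.Im (f t) + complex.Im (g t)));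
  [exact: integrableRD|apply/funext => t; rewrite cImD].
Qed.

Lemma cintD D f g : measurable D -> cintegrable D f -> cintegrable D g ->
  cint D (fun t => f t + g t) = cint D f + cint D g.
Proof.
move=> mD [f1 f2] [g1 g2]; rewrite /cint.
under eq_Rintegral do rewrite cReD.
under [X in _ +i* X = _]eq_Rintegral do rewrite cImD.
by rewrite !RintegralD.
Qed.

Lemma cintegrableZ D f c : measurable D -> cintegrable D f ->
  cintegrable D (fun t => c * f t).
Proof.
move=> mD [f1 f2]; split.
  rewrite (_ : (fun t => _) = (fun t => complex.Re c * complex.Re (f t) -
    complex.Im c * complex.Im (f t))); last by apply/funext => t; rewrite cReM.
  by apply: integrableRB => //; exact: integrableRZl.
rewrite (_ : (fun t => _) = (fun t => complex.Re c * complex.Im (f t) +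
  complex.Im c * complex.Re (f t))); last by apply/funext => t; rewrite cImM.
by apply: integrableRD => //; exact: integrableRZl.
Qed.

Lemma cintZ D f c : measurable D -> cintegrable D f ->
  cint D (fun t => c * f t) = c * cint D f.
Proof.
move=> mD [f1 f2]; rewrite /cint.
under eq_Rintegral do rewrite cReM.
under [X in _ +i* X = _]eq_Rintegral do rewrite cImM.
rewrite RintegralB ?RintegralD//; try exact: integrableRZl.
by rewrite !RintegralZl//; apply/eqP; rewrite eq_complex cReM cImM /= !eqxx.
Qed.

Lemma cintegrable0 D : measurable D -> cintegrable D (fun=> 0).
Proof. by move=> mD; split; exact: integrable0. Qed.

Lemma cintegrable_sum D (I : Type) (s : seq I) (F : I -> R -> R[i]) :
  measurable D -> (forall i, cintegrable D (F i)) ->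
  cintegrable D (fun t => \sum_(i <- s) F i t).
Proof.
move=> mD iF; elim: s => [|i s IH].
  rewrite (_ : (fun t => _) = (fun=> 0)); first exact: cintegrable0.
  by apply/funext => t; rewrite big_nil.
rewrite (_ : (fun t => _) = (fun t => F i t + \sum_(j <- s) F j t)).
  exact: cintegrableD.
by apply/funext => t; rewrite big_cons.
Qed.

Lemma cint_sum D (I : Type) (s : seq I) (F : I -> R -> R[i]) :
  measurable D -> (forall i, cintegrable D (F i)) ->
  cint D (fun t => \sum_(i <- s) F i t) = \sum_(i <- s) cint D (F i).
Proof.
move=> mD iF; elim: s => [|i s IH].
  rewrite big_nil (_ : (fun t => _) = (fun=> 0)); last first.
    by apply/funext => t; rewrite big_nil.
  by rewrite /cint /= /Rintegral !integral0.
rewrite big_cons -IH -cintD//; last exact: cintegrable_sum.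
by congr (cint D _); apply/funext => t; rewrite big_cons.
Qed.

Lemma eq_cint D f g : (forall t, D t -> f t = g t) -> cint D f = cint D g.
Proof.
move=> fg; rewrite /cint; congr (_ +i* _); apply: eq_Rintegral => t.
  by rewrite inE => /fg ->.
by rewrite inE => /fg ->.
Qed.

Lemma integrable_itv_continuous (h : R -> R) u v : continuous h ->
  mu.-integrable `[u, v] (EFin \o h).
Proof.
move=> ch; apply: continuous_compact_integrable; first exact: segment_compact.
exact: continuous_subspaceT.
Qed.

Lemma integrable_itv_bounded (h : R -> R) u v (M : R) : measurable_fun setT h ->
  (forall x, `[u, v]%classic x -> `|h x| <= M) ->
  mu.-integrable `[u, v] (EFin \o h).
Proof.
move=> mh hM; apply: measurable_bounded_integrable => //.
- by apply: compact_finite_measure; exact: segment_compact.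
- exact: measurable_funTS.
- exists M; split; first exact: num_real.
  by move=> x Mx y /= hy; apply: le_trans (hM _ hy) _; exact: ltW.
Qed.

Lemma Rintegral_cst_itv (u v e : R) : u <= v ->
  Rintegral mu `[u, v] (fun=> e) = e * (v - u).
Proof.
move=> uv; rewrite Rintegral_cst//= lebesgue_measure_itv /= lte_fin.
case: ltP => [_|vu]; first by rewrite -EFinD.
by rewrite (_ : v = u) ?subrr ?mulr0//; apply/eqP; rewrite eq_le vu uv.
Qed.

(** The factor 2 comes from estimating real and imaginary parts separately. *)
Lemma normc_cint_le u v f (e : R) : u <= v -> 0 <= e -> cintegrable `[u, v] f ->
  (forall x, `[u, v]%classic x -> normc (f x) <= e) ->
  normc (cint `[u, v] f) <= 2 * e * (v - u).
Proof.
move=> uv e0 [f1 f2] fe; apply: (le_trans (ler_normc_ReIm _)) => /=.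
have mI : measurable (`[u, v]%classic : set (measurableTypeR R)) by exact: measurable_itv.
have bnd (h : R -> R) : mu.-integrable `[u, v] (EFin \o h) ->
    (forall x, `[u, v]%classic x -> `|h x| <= e) ->
    `|Rintegral mu `[u, v] h| <= e * (v - u).
  move=> ih he; apply: (le_trans (le_normr_Rintegral mI ih)).
  rewrite -Rintegral_cst_itv//.
  apply: le_Rintegral => //.
    exact: (integrable_norm ih).
  by apply: integrable_itv_continuous => x; exact: cvg_cst.
rewrite -mulrA mulr_natl mulr2n; apply: lerD; apply: bnd => // x ux.
  exact: le_trans (ler_Re_normc _) (fe _ ux).
exact: le_trans (ler_Im_normc _) (fe _ ux).
Qed.

Lemma measurable_expR_sqr (b : R) : measurable_fun setT (fun x : R => expR (b * x ^+ 2)).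
Proof.
apply: continuous_measurable_fun => x.
apply: continuous_comp; last exact: continuous_expR.
by apply: cvgM; [exact: cvg_cst|exact: sqr_continuous].
Qed.

Lemma continuous_Re_cexp (p q : R) :
  continuous (fun x : R => complex.Re (cexp ((p * x) +i* (q * x)))).
Proof.
move=> x; rewrite /cexp /=.
under eq_fun do rewrite mul0r subr0.
apply: cvgM.
  by apply: continuous_comp; [exact: mulrl_continuous|exact: continuous_expR].
by apply: continuous_comp; [exact: mulrl_continuous|exact: continuous_cos].
Qed.

Lemma continuous_Im_cexp (p q : R) :
  continuous (fun x : R => complex.Im (cexp ((p * x) +i* (q * x)))).
Proof.
move=> x; rewrite /cexp /=.
under eq_fun do rewrite mul0r addr0.
apply: cvgM.
  by apply: continuous_comp; [exact: mulrl_continuous|exact: continuous_expR].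
by apply: continuous_comp; [exact: mulrl_continuous|exact: continuous_sin].
Qed.

Lemma cintegrable_cexp (p q u v : R) :
  cintegrable `[u, v] (fun x => cexp ((p * x) +i* (q * x))).
Proof.
split; apply: integrable_itv_continuous.
  exact: continuous_Re_cexp.
exact: continuous_Im_cexp.
Qed.

End ComplexIntegral.

(** * The Fejér kernel as an approximate identity *)

Section FejerKernel.
Context {R : realType}.
Local Notation mu := (@lebesgue_measure R).
Implicit Types (N : nat) (l : int) (theta x : R).

(** Defined as a squared modulus so that positivity is immediate; [fejerE] gives the Cesàro-weighted
    trigonometric sum. *)
Definition fejer N theta : R :=
  normc (\sum_(m < N.+1) expi (theta *+ m)) ^+ 2 / N.+1%:R.

Lemma expiN theta : expi (- theta) = (expi theta)^*%C :> R[i].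
Proof. by rewrite /expi cosN sinN. Qed.

Lemma mulr_conjc (z : R[i]) : z * z^*%C = (normc z ^+ 2)%:C.
Proof.
rewrite sqr_normcE; case: z => x y.
by apply/eqP; rewrite eq_complex /=; apply/andP; split; apply/eqP; ring.
Qed.

(** The weight [N - |l|] counts the pairs of indices below [N] with difference [l]. In the
    induction, the new pairs, those with [N] as an entry, produce every frequency from [- N] to [N]
    once. *)
Lemma dirichlet_sqr N theta :
  (\sum_(m < N) expi (theta *+ m)) * (\sum_(m < N) expi (- (theta *+ m))) =
  \sum_(l <- zs N) (N%:R - `|l%:~R|)%:C * expi (theta * l%:~R) :> R[i].
Proof.
elim: N => [|N IH]; first by rewrite big_ord0 mul0r big_nil.
rewrite zs_recr !normr_intr /= subrr mul0r addr0 -natr1 addrAC subrr add0r mul1r.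
have -> : \sum_(l <- zs N) (N%:R + 1 - `|l%:~R|)%:C * expi (theta * l%:~R) =
    \sum_(l <- zs N) (N%:R - `|l%:~R|)%:C * expi (theta * l%:~R) +
    \sum_(l <- zs N) expi (theta * l%:~R) :> R[i].
  rewrite -big_split /=; apply: eq_bigr => l _.
  by rewrite addrAC rmorphD rmorph1 mulrDl mul1r.
rewrite -IH !big_ord_recr /= mulrDl !mulrDr -!addrA; congr (_ + _).
rewrite -expiD subrr expi0.
have -> : (\sum_(i < N) expi (theta *+ i)) * expi (- (theta *+ N)) =
    \sum_(i < N) expi (theta * (Negz i)%:~R) :> R[i].
  rewrite mulr_suml (reindex_inj rev_ord_inj) /=; apply: eq_bigr => i _.
  rewrite -expiD; congr expi.
  rewrite -(mulr_natr theta N) -(mulr_natr theta (_ - _)) natrB//.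
  by rewrite NegzE mulrNz -pmulrn; ring.
have -> : expi (theta *+ N) * (\sum_(i < N) expi (- (theta *+ i))) =
    \sum_(i < N) expi (theta * i.+1%:R) :> R[i].
  rewrite mulr_sumr (reindex_inj rev_ord_inj) /=; apply: eq_bigr => i _.
  rewrite -expiD; congr expi.
  rewrite -(mulr_natr theta N) -(mulr_natr theta (_ - _)) natrB//.
  by ring.
rewrite /zs big_cat /= !big_map -[N in iota 0 N]subn0 -/(index_iota 0 N).
rewrite !big_mkord [RHS]addrAC [RHS]addrC; congr (_ + _).
have -> : \sum_(i < N) expi (theta * (Posz i)%:~R) + expi (theta * (Posz N)%:~R) =
    \sum_(i < N.+1) expi (theta * i%:R) :> R[i] by rewrite big_ord_recr.
by rewrite big_ord_recl /= mulr0 expi0 addrC.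
Qed.

Lemma fejerE N theta : (fejer N theta)%:C =
  \sum_(l <- zs N.+1) (fejerw N l)%:C * expi (theta * l%:~R) :> R[i].
Proof.
have N0 : N.+1%:R != 0 :> R by rewrite pnatr_eq0.
have -> : (fejer N theta)%:C = (\sum_(m < N.+1) expi (theta *+ m)) *
    (\sum_(m < N.+1) expi (theta *+ m))^*%C * (N.+1%:R^-1)%:C :> R[i].
  by rewrite mulr_conjc -rmorphM.
have -> : (\sum_(m < N.+1) expi (theta *+ m))^*%C =
    \sum_(m < N.+1) expi (- (theta *+ m)) :> R[i].
  by rewrite rmorph_sum /=; apply: eq_bigr => i _; rewrite expiN.
rewrite dirichlet_sqr mulr_suml; apply: eq_bigr => l _.
rewrite mulrAC -rmorphM /fejerw mulrBl divff//.
Qed.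

Lemma fejer_ge0 N theta : 0 <= fejer N theta.
Proof. by rewrite divr_ge0 ?exprn_ge0 ?normc_ge0. Qed.

Lemma fejer_periodic N theta (n : int) :
  fejer N (theta + 2 * pi * n%:~R) = fejer N theta.
Proof.
have per (m : nat) : expi (2 * pi * m%:R) = 1 :> R[i].
  have -> : 2 * pi * m%:R = 0 + pi *+ 2 *+ m :> R.
    by rewrite add0r mulr_natl mulr_natr.
  by rewrite /expi (periodicn (@cosD2pi R)) (periodicn (@sinD2pi R)) cos0 sin0.
have perz (l : int) : expi (2 * pi * l%:~R) = 1 :> R[i].
  case: l => m; first exact: per.
  rewrite NegzE mulrNz mulrN expiN.
  by have := per m.+1; rewrite -pmulrn => ->; rewrite rmorph1.
rewrite /fejer; congr (normc _ ^+ 2 / _); apply: eq_bigr => m _.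
rewrite mulrnDl expiD.
have -> : 2 * pi * n%:~R *+ m = 2 * pi * (n * m%:Z)%:~R :> R.
  by rewrite intrM mulrA -pmulrn mulr_natr.
by rewrite perz mulr1.
Qed.

Lemma normc_expi_sub1 theta :
  normc (expi theta - 1) ^+ 2 = 4 * sin (theta / 2) ^+ 2.
Proof.
rewrite sqr_normcE /expi /=.
have tE : theta = (theta / 2) *+ 2 by rewrite -mulr_natr divfK.
rewrite {1 2}tE cos_mulr2n sin_mulr2n.
have := cos2Dsin2 (theta / 2); move: (cos _) (sin _) => c s h.
have c2 : c ^+ 2 = 1 - s ^+ 2 by lra.
rewrite subr0 c2.
have -> : ((1 - s ^+ 2) *+ 2 - 1 - 1) ^+ 2 + (c * s *+ 2) ^+ 2 =
  4 * (s ^+ 2) * (s ^+ 2 + c ^+ 2) by ring.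
by rewrite (addrC (s ^+ 2)) h mulr1.
Qed.

(** Multiplying the exponential sum by [e^(i theta) - 1], of modulus [2 |sin (theta / 2)|],
    telescopes it to [e^(i (N + 1) theta) - 1], of modulus at most 2. Stated as a product, the bound
    also covers the zeros of the sine. *)
Lemma fejer_sin_le N theta :
  fejer N theta * sin (theta / 2) ^+ 2 <= N.+1%:R^-1.
Proof.
rewrite /fejer mulrAC ler_piMl ?invr_ge0//.
have -> : sin (theta / 2) ^+ 2 = normc (expi theta - 1) ^+ 2 / 4.
  by rewrite normc_expi_sub1; field.
rewrite mulrA ler_pdivrMr// mul1r -exprMn -normcM.
under eq_bigr do rewrite expiMn.
rewrite mulrC -subrX1.
have : normc (expi theta ^+ N.+1 - 1) <= 2.
  apply: (le_trans (le_normcD _ _)); rewrite normcN normc1 normcX normc_expi expr1n.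
  by lra.
move=> h; have -> : 4 = 2 ^+ 2 :> R by ring.
by rewrite lerXn2r// nnegrE// normc_ge0.
Qed.

Lemma continuous_cos_affine (b c : R) : continuous (fun x => cos (b * x + c)).
Proof.
move=> x; apply: continuous_comp; last exact: continuous_cos.
by apply: cvgD; [exact: mulrl_continuous|exact: cvg_cst].
Qed.

Lemma fejer_cosE N theta :
  fejer N theta = \sum_(l <- zs N.+1) fejerw N l * cos (theta * l%:~R).
Proof.
have := congr1 (@complex.Re R) (fejerE N theta); rewrite /= => ->.
elim: (zs _) => [|l s IH]; first by rewrite !big_nil.
by rewrite !big_cons cReD IH cReM /= mul0r subr0.
Qed.

Lemma continuous_fejer N (b c : R) : continuous (fun x => fejer N (b * x + c)).
Proof.
rewrite (_ : (fun x => _) = (fun x => \sum_(l <- zs N.+1)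
   fejerw N l * cos (b * l%:~R * x + c * l%:~R))); last first.
  apply/funext => x; rewrite fejer_cosE; apply: eq_bigr => l _.
  by congr (_ * cos _); ring.
elim: (zs _) => [|l s IH] x.
  rewrite (_ : (fun x => _) = (fun=> 0)); first exact: cvg_cst.
  by apply/funext => y; rewrite big_nil.
rewrite (_ : (fun x => _) = (fun x => fejerw N l * cos (b * l%:~R * x + c * l%:~R) +
   \sum_(j <- s) fejerw N j * cos (b * j%:~R * x + c * j%:~R))); last first.
  by apply/funext => y; rewrite big_cons.
apply: cvgD; last exact: IH.
by apply: cvgM; [exact: cvg_cst|exact: continuous_cos_affine].
Qed.

Lemma integral_cos_period (a c u : R) l : 0 < a -> l != 0 ->
  Rintegral mu `[u, u + a^-1] (fun x => cos (2 * pi * a * l%:~R * x + c)) = 0.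
Proof.
move=> a0 l0; set b := 2 * pi * a * l%:~R.
have b0 : b != 0 by rewrite !mulf_neq0 ?intr_eq0// gt_eqF// pi_gt0.
have ua : u < u + a^-1 by rewrite ltrDl invr_gt0.
pose F x := b^-1 * sin (b * x + c).
have dF x : is_derive x 1 F (cos (b * x + c)).
  have h : is_derive x 1 (fun x => b * x + c) b.
    by apply: is_derive_eq; rewrite addr0 scaler1.
  have h2 : is_derive x 1 (fun x => sin (b * x + c)) (cos (b * x + c) * b).
    apply: is_derive_eq (is_derive1_comp (f := sin) _ h) _.
    by [].
  apply: is_derive_eq (is_deriveZ b^-1 h2) _.
  by rewrite /GRing.scale /=; field.
rewrite /Rintegral (@continuous_FTC2 _ _ F) //; last 3 first.
- by apply: continuous_subspaceT; exact: continuous_cos_affine.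
- have cF : continuous F.
    by move=> x; apply: differentiable_continuous; apply/derivable1_diffP.
  split => [x _| |]; first by [].
    by apply: cvg_at_right_filter; exact: cF.
  by apply: cvg_at_left_filter; exact: cF.
- by move=> x _; rewrite derive1E derive_val.
rewrite -EFinB /= /F.
have -> : b * (u + a^-1) + c = b * u + c + 2 * pi * l%:~R.
  by rewrite /b; field; rewrite gt_eqF.
suff -> : sin (b * u + c + 2 * pi * l%:~R) = sin (b * u + c) by rewrite subrr.
have per (y : R) (m : nat) : sin (y + 2 * pi * m%:R) = sin y.
  by rewrite mulr_natr -(periodicn (@sinD2pi R) m y) mulr_natl.
move: (b * u + c) => y; clear b b0 F dF l0.
case: l => m; first exact: per.
rewrite NegzE mulrNz mulrN -[in RHS](subrK (2 * pi * m.+1%:R) y).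
by rewrite per.
Qed.

Lemma integral_fejer (a c u : R) N : 0 < a ->
  Rintegral mu `[u, u + a^-1] (fun x => fejer N (2 * pi * a * x + c)) = a^-1.
Proof.
move=> a0.
have ua : u < u + a^-1 by rewrite ltrDl invr_gt0.
have cst1 : Rintegral mu `[u, u + a^-1] (fun=> 1 : R) = a^-1.
  by rewrite Rintegral_cst_itv ?(ltW ua)// addrAC subrr add0r mul1r.
(* The real sum is read as a complex one so that [cint_sum] exchanges it with the integral. *)
have -> : (fun x => fejer N (2 * pi * a * x + c)) = (fun x => complex.Re
   (\sum_(l <- zs N.+1) (fejerw N l * cos (2 * pi * a * l%:~R * x + c * l%:~R))%:C)).
  apply/funext => x; rewrite fejer_cosE.
  elim: (zs _) => [|l s IH]; first by rewrite !big_nil.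
  rewrite !big_cons cReD -IH; congr (_ * cos _ + _); ring.
have iF l : cintegrable `[u, u + a^-1]
    (fun x => (fejerw N l * cos (2 * pi * a * l%:~R * x + c * l%:~R))%:C).
  split => /=; last exact: integrable0.
  apply: integrable_itv_continuous => x.
  by apply: cvgM; [exact: cvg_cst|exact: continuous_cos_affine].
have := cint_sum (zs N.+1) (measurable_itv _) iF.
move/(congr1 (@complex.Re R)) => /= ->.
have -> : \sum_(l <- zs N.+1) cint `[u, u + a^-1]
    (fun x => (fejerw N l * cos (2 * pi * a * l%:~R * x + c * l%:~R))%:C) =
    \sum_(l <- zs N.+1) (if l == 0 then a^-1 else 0)%:C.
  apply: eq_bigr => l _; rewrite /cint /=.
  rewrite [X in _ +i* X](_ : _ = 0); last by rewrite /Rintegral integral0.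
  rewrite RintegralZl//; last first.
    by apply: integrable_itv_continuous; exact: continuous_cos_affine.
  case: eqVneq => [->|l0].
    rewrite /fejerw normr0 mul0r subr0 mul1r.
    under eq_Rintegral do rewrite !mulr0 mul0r addr0 cos0.
    by rewrite cst1.
  by rewrite integral_cos_period// mulr0.
have z0 : 0 \in zs N.+1 by rewrite mem_zs.
rewrite (bigD1_seq 0 z0 (uniq_zs _)) /= big1 ?addr0// => l /negPf ->.
by [].
Qed.

Lemma sin_ge_endpoints (eta y : R) : 0 < eta -> eta <= y <= pi - eta ->
  sin eta <= sin y.
Proof.
move=> eta0 /andP[ey ye].
have p0 := pi_gt0 R.
have mono (s t : R) : 0 <= s -> s <= t -> t <= pi / 2 -> sin s <= sin t.
  move=> s0 st tp; move: st; rewrite le_eqVlt => /predU1P[->//|st].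
  by rewrite ltW// ltr_sin// in_itv /=; apply/andP; split; lra.
have [yp|yp] := lerP y (pi / 2); first by apply: mono => //; lra.
have -> : sin y = sin (pi - y) by rewrite sinB sinpi cospi; ring.
by apply: mono; lra.
Qed.

(* Away from [x0] modulo the period, [sin^2] is bounded below: the error
   [|H x - H x0|] is absorbed by the factor that tames the Fejér kernel. *)
Lemma fejer_approx (a : R) (H : R -> R) (M u x0 : R) : 0 < a ->
  measurable_fun setT H -> (forall x, `|H x| <= M) ->
  u < x0 < u + a^-1 -> {for x0, continuous H} ->
  Rintegral mu `[u, u + a^-1] (fun x => H x * fejer N (2 * pi * a * (x - x0)))
    @[N --> \oo] --> a^-1 * H x0.
Proof.
move=> a0 mH HM /andP[ux0 x0u] cH.
have ua : u < u + a^-1 by rewrite ltrDl invr_gt0.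
have M0 : 0 <= M by apply: le_trans (HM 0).
have ai0 : 0 < a^-1 by rewrite invr_gt0.
have p0 := pi_gt0 R.
pose I := `[u, u + a^-1]%classic : set (measurableTypeR R).
have mI : measurable I by exact: measurable_itv.
pose s x := sin (pi * a * (x - x0)) ^+ 2.
have key (e : R) : 0 < e -> exists C : R, 0 <= C /\
    forall x, I x -> `|H x - H x0| <= e + C * s x.
  move=> e0.
  have [d [d0 hd]] : exists d : R, 0 < d /\ forall x, `|x - x0| < d -> `|H x - H x0| <= e.
    have /cvgrPdist_le /(_ _ e0) := cH.
    move=> [d /= d0 hd]; exists d; split => // x xd.
    by rewrite distrC; apply: hd => /=; rewrite distrC.
  (* A point of the interval at distance at least [d'] from [x0] is also at distance at most
     [1/a - d']. So [pi a |x - x0|] lies between [eta] and [pi - eta], where the sine is at least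
     [sin eta]. *)
  pose d' := Num.min d (Num.min (x0 - u) (u + a^-1 - x0)).
  have d'0 : 0 < d' by rewrite !lt_min d0 !subr_gt0 ux0.
  have d'd : d' <= d by rewrite ge_min lexx.
  have d'1 : d' <= x0 - u by rewrite !ge_min lexx orbT.
  have d'2 : d' <= u + a^-1 - x0 by rewrite !ge_min lexx !orbT.
  pose eta := pi * a * d'.
  have eta0 : 0 < eta by rewrite !mulr_gt0.
  have eta1 : eta < pi.
    rewrite /eta -mulrA gtr_pMr// -ltr_pdivlMl// mulr1; lra.
  pose m := sin eta ^+ 2.
  have m0 : 0 < m by rewrite exprn_gt0// sin_gt0_pi// eta0 eta1.
  have Cge : 0 <= 2 * M / m by rewrite divr_ge0 ?(ltW m0)// mulr_ge0.
  exists (2 * M / m); split => //.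
  move=> x; rewrite /I /= in_itv /= => /andP[ux xu].
  have s0 : 0 <= s x by rewrite sqr_ge0.
  have [xd|xd] := ltP `|x - x0| d'.
    apply: (@le_trans _ _ e); first by apply: hd; exact: lt_le_trans xd d'd.
    by rewrite lerDl mulr_ge0.
  apply: (@le_trans _ _ (2 * M)).
    by apply: (le_trans (ler_normB _ _)); rewrite mulr_natl mulr2n lerD.
  apply: (@le_trans _ _ (2 * M / m * s x)); last by rewrite lerDr ltW.
  rewrite mulrAC ler_pdivlMr// ler_wpM2l ?mulr_ge0//.
  rewrite /m /s.
  have -> : sin (pi * a * (x - x0)) ^+ 2 = sin (pi * a * `|x - x0|) ^+ 2.
    have [h|h] := lerP 0 (x - x0); first by rewrite ger0_norm.
    by rewrite ltr0_norm// mulrN sinN sqrrN.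
  have xT : `|x - x0| <= a^-1 - d' by rewrite ler_norml; apply/andP; split; lra.
  have h1 : sin eta <= sin (pi * a * `|x - x0|).
    apply: sin_ge_endpoints => //; apply/andP; split.
      by rewrite ler_wpM2l// mulr_ge0// ltW.
    have : pi * a * `|x - x0| <= pi * a * (a^-1 - d').
      by rewrite ler_wpM2l// mulr_ge0// ltW.
    by rewrite mulrBr -[pi * a * a^-1]mulrA divff ?mulr1// gt_eqF.
  have h0 : 0 <= sin eta by rewrite ltW// sin_gt0_pi// eta0 eta1.
  by rewrite lerXn2r// nnegrE// (le_trans h0).
pose F N x := fejer N (2 * pi * a * (x - x0)).
have FE N : F N = (fun x => fejer N (2 * pi * a * x + (- 2 * pi * a * x0))).
  by apply/funext => x; congr fejer; ring.
have cF N : continuous (F N) by rewrite FE; exact: continuous_fejer.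
have iF N : Rintegral mu I (F N) = a^-1 by rewrite FE; exact: integral_fejer.
have mF N : measurable_fun setT (F N) by exact: continuous_measurable_fun.
have bF N : exists B, forall x, I x -> `|F N x| <= B.
  have : compact (F N @` I).
    apply: continuous_compact; last exact: segment_compact.
    by apply: continuous_subspaceT; exact: cF.
  move/compact_bounded => [B [_ hB]]; exists (`|B| + 1) => x Ix.
  by apply: (hB (`|B| + 1)); [rewrite ltr_pwDr// ler_norm|exists x].
have iHF N (h : R -> R) B : measurable_fun setT h -> (forall x, `|h x| <= B) ->
    mu.-integrable I (EFin \o (fun x => h x * F N x)).
  move=> mh hB; have [B' hB'] := bF N.
  apply: (@integrable_itv_bounded _ _ _ _ (B * B')); first exact: measurable_funM.
  by move=> x Ix; rewrite normrM ler_pM// hB'.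
have ms : measurable_fun setT s.
  apply: continuous_measurable_fun => x; apply: cvgM;
    (apply: continuous_comp; last exact: continuous_sin);
    (apply: cvgM; first exact: cvg_cst); apply: cvgB => //; exact: cvg_cst.
have sF N x : s x * F N x <= N.+1%:R^-1.
  rewrite mulrC /s /F; have := fejer_sin_le N (2 * pi * a * (x - x0)).
  by rewrite (_ : 2 * pi * a * (x - x0) / 2 = pi * a * (x - x0))//; field.
apply/cvgrPdist_le => e e0.
(* The kernel has integral [1/a] over a period, so a deviation of [e a / 2] costs [e / 2]. The part
   proportional to [s] costs at most [C / (a (N + 1))]. *)
have e2 : 0 < e * a / 2 by rewrite divr_gt0// mulr_gt0.
have [C [C0 hC]] := key _ e2.
have [N0 _ hN0] : \forall N \near \oo, C * a^-1 * N.+1%:R^-1 <= e / 2.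
  have : C * a^-1 * N.+1%:R^-1 @[N --> \oo] --> 0.
    rewrite -[X in _ --> X](mulr0 (C * a^-1)); apply: cvgM; first exact: cvg_cst.
    exact: cvg_harmonic.
  by move/cvgr_le; apply; rewrite divr_gt0.
exists N0 => // N /= N0N.
rewrite distrC.
have -> : a^-1 * H x0 = Rintegral mu I (fun x => H x0 * F N x).
  rewrite RintegralZl ?iF 1?mulrC//.
  by apply: integrable_itv_continuous; exact: cF.
rewrite -RintegralB//; last 2 first.
- exact: iHF HM.
- by apply: (iHF _ (fun=> H x0) M).
have iB : mu.-integrable I (EFin \o (fun x => (H x - H x0) * F N x)).
  apply: (iHF _ _ (M + M)); first exact: measurable_funB.
  by move=> x; apply: (le_trans (ler_normB _ _)); rewrite lerD.
under eq_Rintegral do rewrite -mulrBl.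
apply: (le_trans (le_normr_Rintegral mI iB)).
apply: (@le_trans _ _ (Rintegral mu I (fun x => (e * a / 2) * F N x + C * N.+1%:R^-1))).
  apply: le_Rintegral => //.
  - exact: (integrable_norm iB).
  - apply: integrable_itv_continuous => x; apply: cvgD; last exact: cvg_cst.
    by apply: cvgM; [exact: cvg_cst|exact: cF].
  move=> x Ix; rewrite normrM (ger0_norm (fejer_ge0 _ _)) -/(F N x).
  apply: (@le_trans _ _ ((e * a / 2 + C * s x) * F N x)).
    by rewrite ler_wpM2r ?fejer_ge0// hC.
  by rewrite mulrDl lerD2l -mulrA ler_wpM2l.
rewrite RintegralD//; last 2 first.
- by apply: integrable_itv_continuous => x; apply: cvgM; [exact: cvg_cst|exact: cF].
- by apply: integrable_itv_continuous => x; exact: cvg_cst.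
rewrite (RintegralZl (e * a / 2))//; last by apply: integrable_itv_continuous; exact: cF.
rewrite iF Rintegral_cst_itv ?(ltW ua)// addrAC subrr add0r.
have -> : e * a / 2 * a^-1 = e / 2 by field; rewrite gt_eqF.
rewrite [leRHS]splitr lerD2l.
by have := hN0 N N0N; rewrite /= mulrAC.
Qed.

End FejerKernel.

(** * Gaussian integrals, functions with vanishing integrals, dominated convergence *)

Section GaussianWeight.
Context {R : realType}.
Local Notation mu := (@lebesgue_measure R).

Lemma gaussian_normal (c : R) : 0 < c -> exists s : R, s != 0 /\
  (s ^+ 2 *+ 2)^-1 = c.
Proof.
move=> c0; exists (Num.sqrt (2 * c)^-1).
have h : 0 < (2 * c)^-1 by rewrite invr_gt0 mulr_gt0.
split; first by rewrite gt_eqF// sqrtr_gt0.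
by rewrite sqr_sqrtr ?(ltW h)//; field; rewrite gt_eqF.
Qed.

Lemma gaussian_pdfE (s c t : R) : s != 0 -> (s ^+ 2 *+ 2)^-1 = c ->
  expR (- c * t ^+ 2) = (normal_peak s)^-1 * normal_pdf 0 s t.
Proof.
move=> s0 sc; rewrite normal_pdfE// /normal_fun subr0 sc.
rewrite mulrA mulVf ?mul1r; first by congr expR; ring.
by rewrite gt_eqF// normal_peak_gt0.
Qed.

Lemma integrable_gaussian (c : R) : 0 < c ->
  mu.-integrable setT (EFin \o (fun t => expR (- c * t ^+ 2))).
Proof.
move=> c0; have [s [s0 sc]] := gaussian_normal c0.
have -> : (fun t => expR (- c * t ^+ 2)) =
    (fun t => (normal_peak s)^-1 * normal_pdf 0 s t).
  by apply/funext => t; exact: gaussian_pdfE.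
by apply: integrableRZl => //; exact: integrable_normal_pdf.
Qed.

Lemma Rintegral_gaussian (c : R) : 0 < c ->
  Rintegral mu setT (fun t => expR (- c * t ^+ 2)) = Num.sqrt (pi / c).
Proof.
move=> c0; have [s [s0 sc]] := gaussian_normal c0.
have -> : (fun t => expR (- c * t ^+ 2)) =
    (fun t => (normal_peak s)^-1 * normal_pdf 0 s t).
  by apply/funext => t; exact: gaussian_pdfE.
rewrite RintegralZl//; last exact: integrable_normal_pdf.
rewrite /Rintegral integral_normal_pdf mulr1 /normal_peak invrK.
congr Num.sqrt; rewrite -sc invrK; ring.
Qed.

(** At a Lebesgue point [x], [h x] is the derivative of the primitive based at [x - d / 4]. For
    upper limits within [d / 8] of [x] the intervals are shorter than [d], so this primitive
    vanishes near [x]. *)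
Lemma ae_eq0_short_itv (h : R -> R) (d : R) : 0 < d ->
  measurable_fun setT h ->
  (forall u v, mu.-integrable `[u, v] (EFin \o h)) ->
  (forall u v, u < v < u + d -> Rintegral mu `[u, v] h = 0) ->
  {ae mu, forall t, h t = 0}.
Proof.
move=> d0 mh ih h0.
have loc : locally_integrable setT h.
  split => //; first exact: openT.
  move=> K _ cK; have [M [_ hM]] := compact_bounded cK.
  pose B := `|M| + 1.
  pose K' : set (measurableTypeR R) := K.
  have KB : K' `<=` `[- B, B]%classic.
    move=> x Kx; rewrite /= in_itv /= -ler_norml.
    by apply: hM => //; rewrite /B ltr_pwDr// ler_norm.
  have mK : measurable K' by exact: compact_measurable.
  have iK : mu.-integrable K' (EFin \o h).
    by apply: (integrableS _ mK KB (ih _ _)); exact: measurable_itv.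
  by case/integrableP : iK.
have := lebesgue_differentiation loc.
apply: filterS; first exact: (ae_filter_ringOfSetsType mu).
move=> x hx.
have d4 : 0 < d / 4 by rewrite divr_gt0.
have xv : x < x + d / 4 by lra.
have [|_ <-] := FTC1_lebesgue_pt xv (ih (x - d / 4) (x + d / 4)) _ hx.
  by rewrite (@lte_fin R); lra.
rewrite derive1E.
rewrite (near_eq_derive (g := fun=> 0)) ?derive_cst//.
near=> y; rewrite h0//.
have : `|x - y| < d / 8.
  near: y; apply: (@nbhsx_ballx _ _ x (PosNum (divr_gt0 d0 (ltr0n _ 8)))%:num) => //.
by rewrite ltr_norml => /andP[? ?]; apply/andP; split; lra.
Unshelve. all: by end_near. Qed.

Lemma dominated_gaussian_kernel (g kap0 : R -> R) (kap : nat -> R -> R) (b A : R) :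
  measurable_fun setT g ->
  mu.-integrable setT (EFin \o (fun t => g t * expR (pi * b * t ^+ 2))) ->
  (forall N, measurable_fun setT (kap N)) ->
  (forall N t, `|kap N t| <= A * expR (pi * b * t ^+ 2)) ->
  measurable_fun setT kap0 ->
  {ae mu, forall t, kap N t @[N --> \oo] --> kap0 t} ->
  Rintegral mu setT (fun t => g t * kap N t) @[N --> \oo] -->
  Rintegral mu setT (fun t => g t * kap0 t).
Proof.
move=> mg ig mk kA mk0 kk0.
have iA : mu.-integrable setT (EFin \o (fun t => A * `|g t * expR (pi * b * t ^+ 2)|)).
  by apply: integrableRZl => //; exact: (integrable_norm ig).
have mgk N : measurable_fun (setT : set R) (fun t => g t * kap N t).
  exact: measurable_funM.
have mgk0 : measurable_fun (setT : set R) (fun t => g t * kap0 t).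
  exact: measurable_funM.
have [|||||ik0 _ h] := @dominated_convergence _ _ _ mu setT measurableT
    (fun N => EFin \o (fun t => g t * kap N t)) (EFin \o (fun t => g t * kap0 t))
    (EFin \o (fun t => A * `|g t * expR (pi * b * t ^+ 2)|)).
- by move=> N; apply/measurable_EFinP; exact: mgk.
- by apply/measurable_EFinP; exact: mgk0.
- move: kk0; apply: filterS; first exact: (ae_filter_ringOfSetsType mu).
  move=> t ht _; apply: cvg_EFin; first exact: nearW.
  by apply: cvgM; [exact: cvg_cst|exact: ht].
- exact: iA.
- apply: aeW => t N _; rewrite /= lee_fin !normrM mulrCA ler_wpM2l//.
  by rewrite (ger0_norm (expR_ge0 _)).
rewrite /Rintegral; apply: fine_cvg.
rewrite fineK; first exact: h.
exact: integrable_fin_num.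
Qed.

End GaussianWeight.

(** * Fejér means of exponentials cut off to a short interval *)

Section FejerWindow.
Context {R : realType}.
Local Notation mu := (@lebesgue_measure R).
Variables (a u v : R).
Hypotheses (a_gt0 : 0 < a) (uv : u < v) (vu : v < u + a^-1).

(* [lam p x] is the exponential [e^(- 2 pi a (k - i l) x)] for [p = (k, l)]. *)
Definition lam (p : int * int) (x : R) : R[i] :=
  cexp ((- 2 * pi * a * p.1%:~R * x) +i* (2 * pi * a * p.2%:~R * x)).

(** Up to the factor [a], this is a Fejér mean at [t] of the [1/a]-periodization of
    [e^(- 2 pi a k x)] restricted to [[u, v]]: the summation in [l], transposed from [G] to the test
    function. *)
Definition window N (k : int) (t : R) : R := Rintegral mu `[u, v]
  (fun x => expR (- 2 * pi * a * k%:~R * x) * fejer N (2 * pi * a * (x - t))).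

Lemma window_lam N k t : (window N k t)%:C =
  \sum_(l <- zs N.+1) (fejerw N l)%:C *
    (cint `[u, v] (lam (k, l)) * expi (- (2 * pi * a * l%:~R * t))).
Proof.
transitivity (cint `[u, v] (fun x => \sum_(l <- zs N.+1)
   ((fejerw N l)%:C * expi (- (2 * pi * a * l%:~R * t))) * lam (k, l) x)).
  have E x : \sum_(l <- zs N.+1) ((fejerw N l)%:C *
      expi (- (2 * pi * a * l%:~R * t))) * lam (k, l) x =
      (expR (- 2 * pi * a * k%:~R * x) * fejer N (2 * pi * a * (x - t)))%:C.
    rewrite (rmorphM (real_complex R)) /= fejerE mulr_sumr; apply: eq_bigr => l _.
    rewrite /lam /cexp /= mulrCA -mulrA; congr (_ * _).
    rewrite -(mulrA (fejerw N l)%:C) -expiD; congr (_ * expi _); ring.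
  rewrite (eq_cint (g := fun x => (expR (- 2 * pi * a * k%:~R * x) *
      fejer N (2 * pi * a * (x - t)))%:C)); last by move=> x _; exact: E.
  rewrite /cint /= /window [X in _ = _ +i* X](_ : _ = 0)//.
  by rewrite /Rintegral integral0.
rewrite cint_sum; last 2 first.
- exact: measurable_itv.
- move=> l; apply: cintegrableZ; [exact: measurable_itv|exact: cintegrable_cexp].
apply: eq_bigr => l _.
by rewrite cintZ; [ring|exact: measurable_itv|exact: cintegrable_cexp].
Qed.

Let c0 := Num.max `|u| `|v|.

Lemma window_exp_le k x : u <= x <= v ->
  expR (- 2 * pi * a * k%:~R * x) <= expR (2 * pi * a * `|k%:~R| * c0).
Proof.
move=> /andP[ux xv].
have xc : `|x| <= c0.
  rewrite /c0 ler_norml le_max; apply/andP; split; last first.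
    by apply/orP; right; rewrite (le_trans xv)// ler_norm.
  rewrite lerNl le_max; apply/orP; left.
  by have := ler_norm (- u); rewrite normrN; lra.
rewrite ler_expR; apply: (le_trans (ler_norm _)).
rewrite !normrM normrN normr_nat (ger0_norm (pi_ge0 R)) (gtr0_norm a_gt0).
by rewrite ler_wpM2l// !mulr_ge0// ?pi_ge0// ltW.
Qed.

Lemma continuous_expR_linear (b : R) : continuous (fun x : R => expR (b * x)).
Proof.
by move=> x; apply: continuous_comp; [exact: mulrl_continuous|exact: continuous_expR].
Qed.

Lemma continuous_window_integrand N k t : continuous (fun x =>
  expR (- 2 * pi * a * k%:~R * x) * fejer N (2 * pi * a * (x - t))).
Proof.
have -> : (fun x => expR (- 2 * pi * a * k%:~R * x) * fejer N (2 * pi * a * (x - t))) =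
    (fun x => expR (- 2 * pi * a * k%:~R * x) *
       fejer N (2 * pi * a * x + - (2 * pi * a * t))).
  by apply/funext => x; congr (_ * fejer _ _); ring.
by move=> x; apply: cvgM; [exact: continuous_expR_linear|exact: continuous_fejer].
Qed.

(** The kernel is non-negative with integral [1/a] over the period [[u, u + 1/a]], which contains
    [[u, v]]; hence a bound free of [N] and [t]. *)
Lemma window_bound N k t :
  `|window N k t| <= a^-1 * expR (2 * pi * a * `|k%:~R| * c0).
Proof.
have i1 := @integrable_itv_continuous R _ u v (@continuous_window_integrand N k t).
have mI : measurable (`[u, v]%classic : set (measurableTypeR R)) by exact: measurable_itv.
rewrite ger0_norm; last first.
  by apply: Rintegral_ge0 => x _; rewrite mulr_ge0 ?expR_ge0 ?fejer_ge0.
pose F x := fejer N (2 * pi * a * x + - (2 * pi * a * t)).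
have cF : continuous F by exact: continuous_fejer.
have FE x : fejer N (2 * pi * a * (x - t)) = F x by congr fejer; ring.
apply: (@le_trans _ _ (Rintegral mu `[u, v]
   (fun x => expR (2 * pi * a * `|k%:~R| * c0) * F x))).
  apply: le_Rintegral => //.
    apply: integrable_itv_continuous => x.
    by apply: cvgM; [exact: cvg_cst|exact: cF].
  move=> x; rewrite /= in_itv /= => xuv.
  by rewrite FE ler_wpM2r ?fejer_ge0// window_exp_le.
rewrite RintegralZl//; last exact: integrable_itv_continuous.
rewrite mulrC ler_wpM2r ?expR_ge0// -(integral_fejer (- (2 * pi * a * t)) u N a_gt0).
have iT := @integrable_itv_continuous R _ u (u + a^-1) cF.
have sub : (`[u, v]%classic : set (measurableTypeR R)) `<=` `[u, u + a^-1]%classic.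
  by apply: subset_itvl; rewrite bnd_simp ltW.
rewrite /Rintegral fine_le//.
- by apply: integrable_fin_num => //; exact: integrable_itv_continuous.
- by apply: integrable_fin_num => //; exact: measurable_itv.
- have mIT : measurable (`[u, u + a^-1]%classic : set (measurableTypeR R)).
    exact: measurable_itv.
  apply: (@ge0_subset_integral _ _ _ mu _ _ mI mIT (EFin \o F)) => //.
    by case/integrableP : iT.
  by move=> x _; rewrite lee_fin fejer_ge0.
Qed.

(** By periodicity [t] may be replaced by its translate [x0] inside the period. Off the endpoints
    the cut-off exponential is continuous at [x0], so [fejer_approx] applies after extending the
    integral by zero. *)
Lemma window_cvg k t (n : int) :
  let x0 := t - n%:~R / a in u < x0 < u + a^-1 -> x0 != v ->
  window N k t @[N --> \oo] -->
    a^-1 * (expR (- 2 * pi * a * k%:~R * x0) * \1_`[u, v] x0).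
Proof.
move=> x0 ux0 x0v.
pose H x : R := expR (- 2 * pi * a * k%:~R * x) * \1_`[u, v] x.
have mH : measurable_fun setT H.
  apply: measurable_funM; last exact: measurable_indic.
  by apply: continuous_measurable_fun; exact: continuous_expR_linear.
have HM x : `|H x| <= expR (2 * pi * a * `|k%:~R| * c0).
  rewrite /H indicE; case: (boolP (x \in _)) => [|_].
    rewrite inE /= in_itv /= mulr1 => xuv.
    by rewrite ger0_norm ?expR_ge0// window_exp_le.
  by rewrite mulr0 normr0 expR_ge0.
have cH : {for x0, continuous H}.
  apply: cvgM; first exact: continuous_expR_linear.
  move/andP : ux0 => [h1 h2].
  have [x0v'|x0v'] := ltP x0 v.
    rewrite indicE mem_set; last by rewrite /= in_itv /= !ltW.
    apply: cvg_near_cst; exists (Num.min (x0 - u) (v - x0)).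
      by rewrite /= lt_min !subr_gt0 h1.
    move=> y /=; rewrite lt_min !ltr_norml => /andP[/andP[_ y1] /andP[y2 _]].
    by rewrite indicE mem_set//= in_itv /=; apply/andP; split; lra.
  have vx0 : v < x0 by rewrite lt_neqAle eq_sym x0v.
  rewrite indicE memNset; last by rewrite /= in_itv /= (leNgt x0) vx0 andbF.
  apply: cvg_near_cst; exists (x0 - v); first by rewrite /= subr_gt0.
  move=> y /=; rewrite ltr_norml => /andP[_ y1].
  rewrite indicE memNset//= in_itv /=; apply/negP; rewrite negb_and -!ltNge.
  by apply/orP; right; lra.
have := fejer_approx a_gt0 mH HM ux0 cH.
apply: cvg_trans; apply: near_eq_cvg; apply: nearW => N.
rewrite /window.
have E : (fun x => H x * fejer N (2 * pi * a * (x - x0))) =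
    ((fun x => expR (- 2 * pi * a * k%:~R * x) * fejer N (2 * pi * a * (x - t)))
      \_ `[u, v]).
  apply/funext => x; rewrite patchE /H indicE; case: ifP => _; last by rewrite mulr0 mul0r.
  rewrite mulr1; congr (_ * _).
  rewrite -(fejer_periodic N (2 * pi * a * (x - t)) n); congr fejer.
  by rewrite /x0; field; rewrite gt_eqF.
rewrite E -Rintegral_mkcondr setIidr//.
by apply: subset_itvl; rewrite bnd_simp ltW.
Qed.

End FejerWindow.

(** * The test functions and their limit, the indicator of an interval *)

Section DualKernel.
Context {R : realType}.
Local Notation mu := (@lebesgue_measure R).
Variables (a u v : R) (j : int).
Hypotheses (a_gt0 : 0 < a) (a_lt1 : a < 1) (uv : u < v) (vu : v < u + a^-1).

(** A finite combination of exponentials whose integrals against [G] are the samples; it tends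
    almost everywhere to a multiple of the indicator of [[u, v]]. *)
Definition kernel N (t : R) : R := \sum_(k <- zs N.+1)
  psi (k - j) * expR (2 * pi * a * k%:~R * t) * window a u v N k t.

(** Strictly above [a], to absorb the terms linear in [|t|]; strictly below 1, where
    [G t * e^(pi b t^2)] is integrable. *)
Let b := (1 + a) / 2.

(** The cross term [2 pi a |k| (|t| + c0)] is at most [pi a k^2 + pi a (|t| + c0)^2]. Against the
    [- pi k^2] of [psi] this leaves [- pi (1 - a) k^2], enough to absorb the linear terms and the
    weight; in [t] the gap [b - a = (1 - a) / 2] absorbs [2 pi a c0 |t|]. *)
Lemma kernel_term_bound : exists A : R, forall N t k,
  `|psi (k - j) * expR (2 * pi * a * k%:~R * t) * window a u v N k t| <=
  A * expR (pi * b * t ^+ 2) * wt k ^+ 2.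
Proof.
pose c0 := Num.max `|u| `|v|.
have c00 : 0 <= c0 by rewrite le_max normr_ge0.
have p0 := pi_gt0 R.
have pa : 0 < pi * (1 - a) by rewrite mulr_gt0// subr_gt0.
have a2 : 0 < (1 - a) / 2 by rewrite divr_gt0// subr_gt0.
have [A1 hA1] := quadratic_bound (2 * pi * `|j%:~R| + 2) pa.
have [A2 hA2] := quadratic_bound (2 * a * c0) a2.
exists (2 * a^-1 * expR (A1 + pi * (A2 + a * c0 ^+ 2))) => N t k.
rewrite !normrM (ger0_norm (expR_ge0 _)).
apply: (@le_trans _ _ (2 * expR (- pi * (`|(k - j)%:~R| * (`|(k - j)%:~R| + 1))) *
  expR (2 * pi * a * `|k%:~R| * `|t|) * (a^-1 * expR (2 * pi * a * `|k%:~R| * c0)))).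
  apply: ler_pM; rewrite ?mulr_ge0 ?expR_ge0//; last exact: window_bound.
  apply: ler_pM; [by []|exact: expR_ge0|exact: psi_bound|].
  rewrite ler_expR; apply: (le_trans (ler_norm _)).
  by rewrite !normrM normr_nat (ger0_norm (pi_ge0 R)) (gtr0_norm a_gt0).
rewrite wt2E.
set m := (k - j)%:~R; set K := `|k%:~R : R|.
have -> : 2 * expR (- pi * (`|m| * (`|m| + 1))) * expR (2 * pi * a * K * `|t|) *
    (a^-1 * expR (2 * pi * a * K * c0)) = 2 * a^-1 *
    expR (- pi * (`|m| * (`|m| + 1)) + 2 * pi * a * K * `|t| + 2 * pi * a * K * c0).
  by rewrite !expRD; ring.
rewrite -!mulrA ler_wpM2l// ler_wpM2l ?invr_ge0 ?(ltW a_gt0)// -!expRD ler_expR.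
have {hA1} := hA1 k%:~R; have {hA2} := hA2 t.
rewrite -(@real_normK _ t) ?num_real// -(@real_normK _ k%:~R) ?num_real// -/K.
have hm : K ^+ 2 - 2 * K * `|j%:~R| <= `|m| * (`|m| + 1).
  have : (K - `|j%:~R|) ^+ 2 <= `|m| ^+ 2.
    rewrite real_normK ?num_real// /m intrD mulrNz.
    rewrite sqrrB sqrrB -(@real_normK _ k%:~R) ?num_real// -(@real_normK _ j%:~R) ?num_real//.
    rewrite lerD2r lerD2l lerN2 -/K ler_pMn2r//.
    by apply: (le_trans (ler_norm _)); rewrite normrM.
  by have := normr_ge0 m; have := sqr_ge0 `|j%:~R : R|; nra.
move: hm; move: (normr_ge0 m) (normr_ge0 t) (normr_ge0 (j%:~R : R)).
have : 0 <= K by exact: normr_ge0.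
move: `|m| `|t| `|j%:~R : R| => m' T J K0 m0 T0 J0 hm h2 h1.
have e1 := ler_wpM2l (ltW p0) hm.
have e2 := ler_wpM2l (ltW p0) h2.
have e3 : 0 <= pi * a * (K - (T + c0)) ^+ 2.
  exact: mulr_ge0 (mulr_ge0 (ltW p0) (ltW a_gt0)) (sqr_ge0 _).
rewrite /b; nra.
Qed.

Lemma kernel_bound : exists A : R, forall N t,
  `|kernel N t| <= A * expR (pi * b * t ^+ 2).
Proof.
have [A hA] := kernel_term_bound; exists (A * 3) => N t.
apply: (le_trans (ler_norm_sum _ _ _)).
have Ae : 0 <= A * expR (pi * b * t ^+ 2).
  have := hA 0%N t 0; rewrite /wt normr0 oppr0 expR0 expr1n mulr1.
  by apply: le_trans.
apply: (@le_trans _ _ (\sum_(k <- zs N.+1) A * expR (pi * b * t ^+ 2) * wt k)).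
  apply: ler_sum => k _; apply: (le_trans (hA N t k)).
  by rewrite ler_wpM2l// expr2 ler_piMl ?wt_ge0 ?wt_le1.
rewrite -mulr_sumr (mulrAC A 3) ler_wpM2l//; exact: sum_wt_zs.
Qed.

Lemma continuous_window N k : continuous (window a u v N k).
Proof.
have -> : window a u v N k = (fun t => \sum_(l <- zs N.+1) fejerw N l *
    (complex.Re (cint `[u, v] (lam a (k, l))) * cos (2 * pi * a * l%:~R * t) +
     complex.Im (cint `[u, v] (lam a (k, l))) * sin (2 * pi * a * l%:~R * t))).
  apply/funext => t; have := congr1 (@complex.Re R) (window_lam a u v N k t).
  move: (window a u v N k t) (fun l => cint `[u, v] (lam a (k, l))) => w z.
  rewrite [in LHS]/= => ->; elim: (zs _) => [|l s IH]; first by rewrite !big_nil.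
  rewrite !big_cons cReD IH !cReM cImM /= cosN sinN; congr (_ + _).
  by ring.
elim: (zs _) => [|l s IH] t.
  rewrite (_ : (fun x => _) = (fun=> 0)); first exact: cvg_cst.
  by apply/funext => x; rewrite big_nil.
under eq_fun do rewrite big_cons.
apply: cvgD; last exact: IH.
apply: cvgM; first exact: cvg_cst.
apply: cvgD; apply: cvgM; try exact: cvg_cst.
  by apply: continuous_comp; [exact: mulrl_continuous|exact: continuous_cos].
by apply: continuous_comp; [exact: mulrl_continuous|exact: continuous_sin].
Qed.

Lemma continuous_kernel N : continuous (kernel N).
Proof.
rewrite /kernel; elim: (zs _) => [|k s IH] t.
  rewrite (_ : (fun x => _) = (fun=> 0)); first exact: cvg_cst.
  by apply/funext => x; rewrite big_nil.
under eq_fun do rewrite big_cons.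
apply: cvgD; last exact: IH.
apply: cvgM; last exact: continuous_window.
by apply: cvgM; [exact: cvg_cst|exact: continuous_expR_linear].
Qed.

(** The points with a translate at an endpoint of the interval, where the cut-off exponential may
    jump. *)
Let exceptional : set R := [set t | exists n : int,
  t = u + n%:~R / a \/ t = v + n%:~R / a].

Lemma exceptional_null : {ae mu, forall t, ~ exceptional t}.
Proof.
have cE : countable exceptional.
  have -> : exceptional = \bigcup_n [set u + n%:~R / a; v + n%:~R / a].
    apply/seteqP; split => [t [n tn]|t [n _ tn]]; first by exists n.
    by exists n.
  apply: bigcup_countable => // n _; apply: finite_set_countable.
  by rewrite finite_setU; split; exact: finite_set1.
exists exceptional; split.
- exact: countable_measurable.
- exact: countable_lebesgue_measure0.
- by move=> t /= /contrapT.
Qed.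

(** Write [t = x0 + n / a] with [x0] in the period. The exponentials at [t] and [x0] combine to
    [e^(2 pi n k)], and summation against [psi (k - j)] kills every [n] except 0, that is, every
    translate except [t] itself. *)
Lemma kernel_cvg (C0 : R) : zlim (fun k => psi (k - j)) C0 ->
  {ae mu, forall t, kernel N t @[N --> \oo] --> a^-1 * C0 * \1_`[u, v] t}.
Proof.
move=> hC0; have := exceptional_null.
apply: filterS; first exact: (ae_filter_ringOfSetsType mu).
move=> t tE.
pose n := Num.floor ((t - u) * a).
pose x0 := t - n%:~R / a.
have [n1 n2] : n%:~R <= (t - u) * a /\ (t - u) * a < n%:~R + 1.
  by split; [exact: floor_le_tmp|rewrite -[1]/(1%:~R) -intrD; exact: floorD1_gt].
have x0u : x0 != u.
  by apply/eqP => e; apply: tE; exists n; left; rewrite -e /x0 subrK.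
have x0v : x0 != v.
  by apply/eqP => e; apply: tE; exists n; right; rewrite -e /x0 subrK.
have x0I : u < x0 < u + a^-1.
  rewrite lt_neqAle eq_sym x0u /=; apply/andP; split.
    by rewrite lerBrDl -lerBrDr ler_pdivrMr.
  have : t - u < (n%:~R + 1) / a by rewrite ltr_pdivlMr.
  by rewrite /x0 mulrDl mul1r; lra.
have [A hA] := kernel_term_bound.
pose x N k := psi (k - j) * expR (2 * pi * a * k%:~R * t) * window a u v N k t.
pose y k := psi (k - j) * expR (2 * pi * a * k%:~R * t) *
  (a^-1 * (expR (- 2 * pi * a * k%:~R * x0) * \1_`[u, v] x0)).
have xy k : x N k @[N --> \oo] --> y k.
  apply: cvgM; first exact: cvg_cst.
  exact: (window_cvg a_gt0 vu (k := k) (n := n) x0I x0v).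
(* [kernel N] sums over [zs N.+1] while [tannery] sums over [zs N]; the predecessor aligns the two,
   and the shift is undone next. *)
have h1 : \sum_(k <- zs N) (x N.-1 k - y k) @[N --> \oo] --> 0.
  apply: (tannery (A := A * expR (pi * b * t ^+ 2))) => [N k|k]; first exact: hA.
  by rewrite -cvg_shiftS; exact: xy.
have {}h1 : \sum_(k <- zs N.+1) (x N k - y k) @[N --> \oo] --> 0.
  by rewrite -cvg_shiftS in h1.
have yE k : y k = a^-1 * \1_`[u, v] x0 * (psi (k - j) * expR (2 * pi * n%:~R * k%:~R)).
  rewrite /y; have -> : expR (2 * pi * n%:~R * k%:~R) =
      expR (2 * pi * a * k%:~R * t) * expR (- 2 * pi * a * k%:~R * x0).
    by rewrite -expRD; congr expR; rewrite /x0; field; rewrite gt_eqF.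
  ring.
have h2 : zlim y (a^-1 * C0 * \1_`[u, v] t).
  have [n0|n0] := eqVneq n 0.
    have -> : t = x0 by rewrite /x0 n0 mul0r subr0.
    have -> : a^-1 * C0 * \1_`[u, v] x0 = a^-1 * \1_`[u, v] x0 * C0 by ring.
    apply: eq_zlim (zlimZ (c := a^-1 * \1_`[u, v] x0) hC0) => k.
    by rewrite yE n0 mulr0 mul0r expR0 mulr1.
  (* For [n != 0] the point [t] lies outside [[u, v]]: otherwise [0 <= (t - u) a < 1], because
     [v - u < 1/a], and the floor would be 0. *)
  have -> : a^-1 * C0 * \1_`[u, v] t = a^-1 * \1_`[u, v] x0 * 0.
    rewrite indicE memNset ?mulr0// => /=; rewrite in_itv /= => /andP[ut tv].
    move/eqP : n0; apply; apply/eqP; rewrite eq_le.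
    have h0 : 0 <= (t - u) * a by rewrite mulr_ge0 ?subr_ge0// ltW.
    have h3 : (t - u) * a < 1.
      rewrite -ltr_pdivlMr// mul1r ltrBlDl; exact: le_lt_trans tv vu.
    have : (n%:~R : R) < 1%:~R by exact: le_lt_trans h3.
    rewrite ltr_int => h4; apply/andP; split; first by rewrite -ltzD1 add0r.
    by rewrite /n floor_ge0.
  by apply: eq_zlim (zlimZ (c := a^-1 * \1_`[u, v] x0) (psi_zero j n0)) => k; rewrite yE.
rewrite /zlim -cvg_shiftS in h2.
rewrite (_ : kernel ^~ t = (fun N => \sum_(k <- zs N.+1) (x N k - y k) + \sum_(k <- zs N.+1) y k)).
  by rewrite -[X in _ --> X]add0r; apply: cvgD.
by apply/funext => N; rewrite -big_split /=; apply: eq_bigr => k _; rewrite subrK.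
Qed.

End DualKernel.

(** * Recovering the integrals of [G] over short intervals from the samples *)

Section Reconstruction.
Context {R : realType}.
Local Notation mu := (@lebesgue_measure R).
Variables (a : R) (G : R -> R[i]).
Hypotheses (a_gt0 : 0 < a) (a_lt1 : a < 1).
Hypotheses (mRe : measurable_fun setT (fun t => complex.Re (G t)))
  (mIm : measurable_fun setT (fun t => complex.Im (G t))).
Hypothesis iG : forall b : R, b < 1 ->
  mu.-integrable setT (EFin \o (fun t => normc (G t) * expR (pi * b * t ^+ 2))).

Lemma integrable_le_gauss (h : R -> R) (b A : R) : b < 1 -> measurable_fun setT h ->
  (forall t, `|h t| <= A * (normc (G t) * expR (pi * b * t ^+ 2))) ->
  mu.-integrable setT (EFin \o h).
Proof.
move=> b1 mh hA.
have iA := integrableRZl A measurableT (iG b1).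
apply: (le_integrable measurableT _ _ iA).
  by apply/measurable_EFinP.
move=> t _; rewrite /= lee_fin; apply: (le_trans (hA t)); exact: ler_norm.
Qed.

Lemma integrable_Re_gauss (b : R) : b < 1 ->
  mu.-integrable setT (EFin \o (fun t => complex.Re (G t) * expR (pi * b * t ^+ 2))).
Proof.
move=> b1; apply: (@integrable_le_gauss _ b 1) => // [|t].
  apply: measurable_funM => //; exact: measurable_expR_sqr.
by rewrite mul1r normrM (ger0_norm (expR_ge0 _)) ler_wpM2r ?expR_ge0// ler_Re_normc.
Qed.

Lemma integrable_Im_gauss (b : R) : b < 1 ->
  mu.-integrable setT (EFin \o (fun t => complex.Im (G t) * expR (pi * b * t ^+ 2))).
Proof.
move=> b1; apply: (@integrable_le_gauss _ b 1) => // [|t].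
  apply: measurable_funM => //; exact: measurable_expR_sqr.
by rewrite mul1r normrM (ger0_norm (expR_ge0 _)) ler_wpM2r ?expR_ge0// ler_Im_normc.
Qed.

Lemma cintegrable_weighted (p q : R) :
  cintegrable setT (fun t => G t * cexp ((p * t) +i* (q * t))).
Proof.
have p2 : 0 < pi / 2 :> R by rewrite divr_gt0 ?pi_gt0.
have [A hA] := quadratic_bound `|p| p2.
have bnd t : normc (G t * cexp ((p * t) +i* (q * t))) <=
    expR A * (normc (G t) * expR (pi * (1 / 2) * t ^+ 2)).
  rewrite normcM normc_cexp /= mulrCA ler_wpM2l ?normc_ge0// -expRD ler_expR.
  have := hA t; have := ler_norm (p * t); rewrite normrM; lra.
have b1 : 1 / 2 < 1 :> R by lra.
have mcr : measurable_fun setT _ := continuous_measurable_fun (@continuous_Re_cexp R p q).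
have mci : measurable_fun setT _ := continuous_measurable_fun (@continuous_Im_cexp R p q).
split; apply: (integrable_le_gauss b1) => /=.
- under eq_fun do rewrite cReM.
  by apply: measurable_funB; exact: measurable_funM.
- by move=> t; apply: le_trans (bnd t); exact: ler_Re_normc.
- under eq_fun do rewrite cImM.
  by apply: measurable_funD; exact: measurable_funM.
- by move=> t; apply: le_trans (bnd t); exact: ler_Im_normc.
Qed.

Lemma cintegrable_itv (u v : R) : cintegrable `[u, v] G.
Proof.
have mI : measurable (`[u, v]%classic : set (measurableTypeR R)) by exact: measurable_itv.
have := cintegrable_weighted 0 0; rewrite (_ : (fun t => _) = G); last first.
  by apply/funext => t; rewrite !mul0r (_ : 0 +i* 0 = 0)// cexp0 mulr1.
move=> [i1 i2]; split.
  exact: (integrableS measurableT mI _ i1).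
exact: (integrableS measurableT mI _ i2).
Qed.

(* For [p = (k, l)], up to the factor [2^(1/4) e^(- pi a^2 k^2)] this is the value
   at [(a k, a l)] of the Gabor transform of [G t * e^(pi t^2)]. *)
Definition sample (p : int * int) : R[i] := cint setT (fun t => G t *
  cexp ((2 * pi * a * p.1%:~R * t) +i* (- (2 * pi * a * p.2%:~R) * t))).

Definition recon_term (j : int) (x : R) (p : int * int) : R[i] :=
  (psi (p.1 - j))%:C * sample p * lam a p x.

(** Both sides equal one finite combination of samples, whose coefficients contain the integrals of
    [lam]. Only finite sums are exchanged with integrals, so Fubini's theorem is avoided. *)
Lemma cint_kernel (u v : R) (j : int) N :
  cint setT (fun t => G t * (kernel a u v j N t)%:C) =
  cint `[u, v] (fun x =>
    \sum_(p <- zs2 N.+1) (fejerw N p.2)%:C * recon_term j x p).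
Proof.
pose c (p : int * int) := (fejerw N p.2)%:C * (psi (p.1 - j))%:C * cint `[u, v] (lam a p).
pose E (p : int * int) t := G t *
  cexp ((2 * pi * a * p.1%:~R * t) +i* (- (2 * pi * a * p.2%:~R) * t)).
have iE p : cintegrable setT (E p) by exact: cintegrable_weighted.
have iL p : cintegrable `[u, v] (lam a p) by exact: cintegrable_cexp.
have mI : measurable (`[u, v]%classic : set (measurableTypeR R)) by exact: measurable_itv.
transitivity (\sum_(p <- zs2 N.+1) c p * sample p).
  rewrite -[RHS]/(\sum_(p <- zs2 N.+1) c p * cint setT (E p)).
  under [RHS]eq_bigr => p _ do rewrite -(cintZ _ measurableT (iE p)).
  rewrite -cint_sum//; last by move=> p; exact: cintegrableZ.
  apply: eq_cint => t _; rewrite big_allpairs /kernel (rmorph_sum (real_complex R)) /= mulr_sumr.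
  apply: eq_bigr => k _; rewrite !(rmorphM (real_complex R)) /= window_lam !mulr_sumr.
  apply: eq_bigr => l _; rewrite /c /E /cexp /= mulNr.
  by ring.
rewrite cint_sum//; last first.
  by move=> p; apply: cintegrableZ => //; apply: cintegrableZ.
apply: eq_bigr => p _; rewrite cintZ//; last exact: cintegrableZ.
by rewrite /recon_term cintZ// /c; ring.
Qed.

(** Two limits of one sequence. As integrals against [kernel] it converges by dominated convergence
    to a multiple of the integral of [G]; as integrals over [[u, v]] of Fejér sums it converges,
    uniformly under the integral, to that of [Rj]. *)
Lemma reconstruction (C0 A u v : R) (j : int) (Rj : R -> R[i]) :
  zlim (fun k => psi (k - j)) C0 -> u < v -> v < u + a^-1 ->
  cintegrable `[u, v] Rj ->
  (forall N x, u <= x <= v ->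
    normc (\sum_(p <- zs2 N.+1) (fejerw N p.2)%:C * recon_term j x p - Rj x)
      <= A / N.+1%:R) ->
  (a^-1 * C0)%:C * cint `[u, v] G = cint `[u, v] Rj.
Proof.
move=> hC0 uv vu iR hR.
have mI : measurable (`[u, v]%classic : set (measurableTypeR R)) by exact: measurable_itv.
pose S N x := \sum_(p <- zs2 N.+1) (fejerw N p.2)%:C * recon_term j x p.
have iS N : cintegrable `[u, v] (S N).
  apply: cintegrable_sum => // p; apply: cintegrableZ => //; apply: cintegrableZ => //.
  exact: cintegrable_cexp.
have A0 : 0 <= A.
  have := hR 0%N u; rewrite lexx (ltW uv) => /(_ isT).
  by rewrite divr1; apply: le_trans; exact: normc_ge0.
have lim0 : (fun N => 2 * A * (v - u) / N.+1%:R : R) @ \oo --> 0.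
  rewrite -[X in _ --> X](mulr0 (2 * A * (v - u))); apply: cvgM; first exact: cvg_cst.
  exact: cvg_harmonic.
have dist N : normc (cint `[u, v] (S N) - cint `[u, v] Rj) <= 2 * A * (v - u) / N.+1%:R.
  have iN : cintegrable `[u, v] (fun x => - 1 * Rj x) by exact: cintegrableZ.
  have -> : cint `[u, v] (S N) - cint `[u, v] Rj =
      cint `[u, v] (fun x => S N x + - 1 * Rj x).
    by rewrite cintD// cintZ// mulN1r.
  have -> : 2 * A * (v - u) / N.+1%:R = 2 * (A / N.+1%:R) * (v - u) by ring.
  apply: normc_cint_le; rewrite ?(ltW uv) ?divr_ge0//; first exact: cintegrableD.
  by move=> x; rewrite /= in_itv /= mulN1r; exact: hR.
have b1 : (1 + a) / 2 < 1 by move: a_lt1; lra.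
have [B hB] := kernel_bound j a_gt0 a_lt1 vu.
have mk N : measurable_fun setT (kernel a u v j N).
  by apply: continuous_measurable_fun; exact: continuous_kernel.
have mk0 : measurable_fun setT (fun t : R => a^-1 * C0 * \1_`[u, v] t).
  by apply: measurable_funM => //; exact: measurable_indic.
have kk := kernel_cvg a_gt0 a_lt1 vu hC0.
have hRe := dominated_gaussian_kernel mRe (integrable_Re_gauss b1) mk hB mk0 kk.
have hIm := dominated_gaussian_kernel mIm (integrable_Im_gauss b1) mk hB mk0 kk.
have indE (h : R -> R) : mu.-integrable `[u, v] (EFin \o h) ->
    Rintegral mu setT (fun t => h t * (a^-1 * C0 * \1_`[u, v] t)) =
    a^-1 * C0 * Rintegral mu `[u, v] h.
  move=> ih; rewrite -RintegralZl// [RHS]Rintegral_mkcond; apply: eq_Rintegral => t _.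
  rewrite patchE indicE; case: ifP => _; rewrite ?mulr0//.
  by rewrite mulr1 mulrC.
have [iG1 iG2] := cintegrable_itv u v.
rewrite indE// in hRe; rewrite indE// in hIm.
have SE N := cint_kernel u v j N.
have E1 : (fun N => Rintegral mu setT (fun t => complex.Re (G t) * kernel a u v j N t)) =
    (fun N => complex.Re (cint `[u, v] (S N))).
  apply/funext => N; rewrite -SE /cint /=; apply: eq_Rintegral => t _.
  by rewrite cReM /= mulr0 subr0.
have E2 : (fun N => Rintegral mu setT (fun t => complex.Im (G t) * kernel a u v j N t)) =
    (fun N => complex.Im (cint `[u, v] (S N))).
  apply/funext => N; rewrite -SE /cint /=; apply: eq_Rintegral => t _.
  by rewrite cImM /= mulr0 add0r.
rewrite E1 in hRe; rewrite E2 in hIm.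
have cRe : complex.Re (cint `[u, v] (S N)) @[N --> \oo] --> complex.Re (cint `[u, v] Rj).
  apply: cvg_sub0 (cvg_cst _); apply/norm_cvg0P.
  apply: (squeeze_cvgr _ (cvg_cst 0) lim0); apply: nearW => N; rewrite normr_ge0 /=.
  apply: le_trans (dist N); apply: le_trans (ler_Re_normc _).
  exact: lexx.
have cIm : complex.Im (cint `[u, v] (S N)) @[N --> \oo] --> complex.Im (cint `[u, v] Rj).
  apply: cvg_sub0 (cvg_cst _); apply/norm_cvg0P.
  apply: (squeeze_cvgr _ (cvg_cst 0) lim0); apply: nearW => N; rewrite normr_ge0 /=.
  apply: le_trans (dist N); apply: le_trans (ler_Im_normc _).
  exact: lexx.
have e1 := cvg_unique (@Rhausdorff R) hRe cRe.
have e2 := cvg_unique (@Rhausdorff R) hIm cIm.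
apply/eqP; rewrite eq_complex cReM cImM -e1 -e2 /=.
by rewrite !mul0r subr0 addr0 !eqxx.
Qed.

End Reconstruction.

(** * The reconstruction series as an entire function, with uniform bounds *)

Section DualSeries.
Context {R : realType}.
Local Notation mu := (@lebesgue_measure R).
Implicit Types (j : int) (z w : R[i]) (p : int * int) (A : R).

Lemma expN_vanish (x K : R) : 0 <= x -> (forall N, x <= K * expR (- N%:R)) -> x = 0.
Proof.
move=> x0 hx; apply/eqP; rewrite eq_le x0 andbT.
have lim := cvg_expRN K.
by apply: (ler_cvg_to (cvg_cst x) lim); apply: nearW.
Qed.

(** The sum is fixed before the constant, so that the estimate holds for every admissible [A];
    limits obtained from different constants coincide since their distance is below every
    [K e^(- N)]. *)
Lemma dominated2_sum (F : int * int -> R[i]) : (exists A, dominated2 A F) ->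
  exists L, forall A, dominated2 A F -> forall N,
    normc (\sum_(p <- zs2 N) F p - L) <= 18 * A * expR (- N%:R).
Proof.
move=> [A0 h0]; have [L hL] := dominated2_limit h0; exists L => A hA N.
have [L' hL'] := dominated2_limit hA.
suff -> : L = L' by [].
apply/eqP; rewrite -subr_eq0; apply/eqP/eq0_normc.
apply: (@expN_vanish _ (18 * A0 + 18 * A)) => [|n]; first exact: normc_ge0.
have := hL n; have := hL' n; set S := \sum_(p <- _) _ => h1 h2.
rewrite (_ : L - L' = (S - L') - (S - L)); last by ring.
apply: (le_trans (le_normcD _ _)); rewrite normcN mulrDl addrC.
exact: lerD.
Qed.

(** The domination constant depends on the disc, the sum does not: choosing it pointwise yields a
    single function for all radii. *)
Lemma entire_series (F : int * int -> R[i] -> R[i]) : (forall p, entire (F p)) ->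
  (forall r : R, exists A, forall z, normc z <= r -> dominated2 A (F^~ z)) ->
  exists E, entire E /\ forall z A, dominated2 A (F^~ z) -> forall N,
    normc (\sum_(p <- zs2 N) F p z - E z) <= 18 * A * expR (- N%:R).
Proof.
move=> eF hF.
have hs z : exists L, forall A, dominated2 A (F^~ z) -> forall N,
    normc (\sum_(p <- zs2 N) F p z - L) <= 18 * A * expR (- N%:R).
  by apply: dominated2_sum; have [A hA] := hF (normc z); exists A; exact: hA.
have [E hE] := choice hs; exists E; split => //.
apply: entire_unif_limit => r e e0; have [A hA] := hF r.
have lim := cvg_expRN (18 * A).
have [N _ hN] : \forall N \near \oo, 18 * A * expR (- N%:R) < e by exact: (cvgr_lt _ lim).
exists (fun z => \sum_(p <- zs2 N) F p z); split; first exact: entire_sum.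
move=> z zr; rewrite -normcN opprB.
by apply: (le_trans (hE z _ (hA z zr) N)); apply/ltW/hN => /=.
Qed.

(** On the real line [g] is a pointwise limit of polynomials, the [n]-th one within [1 / (n + 1)] on
    the disc of radius [n]. *)
Lemma measurable_entire (g : R[i] -> R[i]) : entire g ->
  measurable_fun setT (fun x : R => complex.Re (g x%:C)) /\
  measurable_fun setT (fun x : R => complex.Im (g x%:C)).
Proof.
move=> eg.
have hs (n : nat) : exists q : {poly R[i]}, forall z, normc z <= n%:R ->
    normc (g z - q.[z]) <= n.+1%:R^-1.
  by apply: eg; rewrite invr_gt0.
have [q hq] := choice hs.
have conv (x : R) : (fun n => normc (g x%:C - (q n).[x%:C])) @ \oo --> (0 : R).
  apply: (@squeeze_cvgr _ _ _ _ (fun=> 0) (fun n => n.+1%:R^-1)).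
  - exists (Num.trunc `|x|).+1 => // n /= hn; rewrite normc_ge0 /=; apply: hq.
    rewrite normc_real; apply: (le_trans (ltW (truncnS_gt _))).
    by rewrite ler_nat.
  - exact: cvg_cst.
  - exact: cvg_harmonic.
have mono (q0 : {poly R[i]}) :
    measurable_fun setT (fun x : R => complex.Re q0.[x%:C]) /\
    measurable_fun setT (fun x : R => complex.Im q0.[x%:C]).
  elim/poly_ind: q0 => [|q0 c [h1 h2]].
    by split; under eq_fun do rewrite horner0; exact: measurable_cst.
  split; under eq_fun do rewrite hornerMXaddC.
    under eq_fun do rewrite cReD cReM /= mulr0 subr0.
    apply: measurable_funD; last exact: measurable_cst.
    by apply: measurable_funM.
  under eq_fun do rewrite cImD cImM /= mulr0 add0r.
  apply: measurable_funD; last exact: measurable_cst.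
  by apply: measurable_funM.
have limC (phi : R[i] -> R) : (forall z w, phi (z - w) = phi z - phi w) ->
    (forall z, `|phi z| <= normc z) ->
    (forall n, measurable_fun setT (fun x : R => phi (q n).[x%:C])) ->
    measurable_fun setT (fun x : R => phi (g x%:C)).
  move=> phiB phi_le mphi.
  apply: (@measurable_fun_cvg _ (measurableTypeR R) R setT
    (fun n x => phi (q n).[x%:C]) _ mphi) => x _.
  apply: cvg_sub0 (cvg_cst _); apply/norm_cvg0P.
  apply: (squeeze_cvgr _ (cvg_cst 0) (conv x)); apply: nearW => n; rewrite normr_ge0 /=.
  by rewrite distrC -phiB.
split; apply: limC.
- by move=> [? ?] [? ?].
- exact: ler_Re_normc.
- by move=> n; have [] := mono (q n).
- by move=> [? ?] [? ?].
- exact: ler_Im_normc.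
- by move=> n; have [] := mono (q n).
Qed.

Section Terms.
Variables (a c : R) (L : int * int -> R[i]).
Hypotheses (a_gt0 : 0 < a) (a_lt1 : a < 1).
Hypothesis normL : forall p, normc (L p) =
  c * expR (pi * a ^+ 2 * (p.1%:~R ^+ 2 - p.2%:~R ^+ 2) / 2).

(* [e^(2 pi z^2)] times the terms of the reconstruction series, at complex [z]. *)
Definition dual_term j p z : R[i] := (psi (p.1 - j))%:C * L p *
  cexp ((2 * pi)%:C * z ^+ 2 +
        ((- (2 * pi * a * p.1%:~R)) +i* (2 * pi * a * p.2%:~R)) * z).

Lemma entire_dual_term j p : entire (dual_term j p).
Proof. by apply: entireZ; exact: entire_cexp_quadratic. Qed.

Let c_ge0 : 0 <= c.
Proof.
have := normL (0, 0); rewrite /= !expr0n /= subrr mulr0 mul0r expR0 mulr1 => <-.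
exact: normc_ge0.
Qed.

(* Completing the squares, the exponent is
   [- pi |m| (|m| + 1) + (pi / 2) (a k - 2 Re z)^2 - (pi / 2) (a l + 2 Im z)^2]
   with [m = k - j]. *)
Lemma normc_dual_term j p z : normc (dual_term j p z) <=
  2 * c * expR (- pi * (`|(p.1 - j)%:~R| * (`|(p.1 - j)%:~R| + 1)) +
    pi / 2 * (a * p.1%:~R - 2 * complex.Re z) ^+ 2 -
    pi / 2 * (a * p.2%:~R + 2 * complex.Im z) ^+ 2).
Proof.
rewrite /dual_term normcM normc_cexp [normc (_ * L p)]normcM normc_real normL.
have := @psi_bound R (p.1 - j).
move: (`|_%:~R|) (psi _) => m y hy.
case: z => s t.
have -> : complex.Re ((2 * pi)%:C * (s +i* t) ^+ 2 +
    - (2 * pi * a * p.1%:~R) +i* (2 * pi * a * p.2%:~R) * (s +i* t)) =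
    2 * pi * (s * s - t * t) - 2 * pi * a * (p.1%:~R * s + p.2%:~R * t).
  by rewrite cReD expr2 /=; ring.
rewrite /=.
apply: (@le_trans _ _ (2 * expR (- pi * (m * (m + 1))) *
   (c * expR (pi * a ^+ 2 * (p.1%:~R ^+ 2 - p.2%:~R ^+ 2) / 2)) *
   expR (2 * pi * (s * s - t * t) - 2 * pi * a * (p.1%:~R * s + p.2%:~R * t)))).
  apply: ler_wpM2r; first exact: expR_ge0.
  by apply: ler_wpM2r => //; rewrite mulr_ge0// expR_ge0.
rewrite le_eqVlt; apply/orP; left; apply/eqP.
have E x1 x2 x3 : 2 * expR x1 * (c * expR x2) * expR x3 = 2 * c * expR (x1 + x2 + x3).
  by rewrite !expRD; ring.
rewrite E; congr (_ * expR _).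
by field.
Qed.

(** In [k], the growth is at most [(pi/2) (|m| + D)^2] because [a < 1], and the [- pi m^2] of [psi]
    still leaves [- (pi/2) m^2]. In [l], the square itself gives decay [- (pi/2) a^2 n^2] around the
    centre [l0]. The constant depends on [D] only, not on where the centres are. *)
Lemma dual_term_bound (D : R) : exists A, forall j (l0 : int) p z,
  `|a * j%:~R - 2 * complex.Re z| <= D -> `|a * l0%:~R + 2 * complex.Im z| <= D ->
  normc (dual_term j p z) <= A * (wt (p.1 - j) ^+ 2 * wt (p.2 - l0) ^+ 2).
Proof.
have p0 := pi_gt0 R.
have c1 : 0 < pi / 2 :> R by rewrite divr_gt0.
have c2 : 0 < pi / 2 * a ^+ 2 :> R by rewrite mulr_gt0// exprn_gt0.
have [A1 h1] := quadratic_bound (pi * D + 2) c1.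
have [A2 h2] := quadratic_bound (pi * a * D + 2) c2.
exists (2 * c * expR (A1 + A2 + pi / 2 * D ^+ 2)) => j l0 p z hs ht.
apply: (le_trans (normc_dual_term _ _ _)).
rewrite !wt2E -expRD -[X in _ <= X]mulrA -expRD ler_wpM2l ?mulr_ge0// ler_expR.
have := h1 (p.1 - j)%:~R; have := h2 (p.2 - l0)%:~R.
rewrite !intrD !mulrNz.
move: (p.1%:~R : R) (p.2%:~R : R) (j%:~R : R) (l0%:~R : R) (complex.Re z) (complex.Im z) hs ht.
move=> k l y y0 s t hs ht H2 H1.
have [m [d [mE dE kE]]] : exists m d, [/\ m = k - y, d = a * y - 2 * s & a * k - 2 * s = a * m + d].
  by exists (k - y), (a * y - 2 * s); split => //; ring.
have [n [e [nE eE lE]]] : exists n e,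
    [/\ n = l - y0, e = a * y0 + 2 * t & a * l + 2 * t = a * n + e].
  by exists (l - y0), (a * y0 + 2 * t); split => //; ring.
rewrite kE lE -mE -nE in H1 H2 *; rewrite -dE in hs; rewrite -eE in ht.
have D0 : 0 <= D by apply: le_trans hs.
have q1 : (a * m + d) ^+ 2 <= (`|m| + D) ^+ 2.
  rewrite -[X in X <= _]real_normK ?num_real// lerXn2r ?nnegrE ?addr_ge0//.
  apply: (le_trans (ler_normD _ _)); apply: lerD => //.
  by rewrite normrM (gtr0_norm a_gt0) ler_piMl// ltW.
have q2 : a ^+ 2 * n ^+ 2 - 2 * a * D * `|n| <= (a * n + e) ^+ 2.
  have : `|n * e| <= `|n| * D by rewrite normrM ler_wpM2l.
  rewrite ler_norml => /andP[q _].
  have := ler_wpM2l (ltW a_gt0) q; have := sqr_ge0 e; nra.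
have q1' := ler_wpM2l (ltW c1) q1.
have q2' := ler_wpM2l (ltW c1) q2.
have mm : `|m| ^+ 2 = m ^+ 2 by rewrite real_normK ?num_real.
have pm : 0 <= pi * `|m| by rewrite mulr_ge0// ltW.
move: (`|m|) mm pm q1' H1 => M <- pm q1' H1.
move: (`|n|) q2' H2 => M' q2' H2.
lra.
Qed.

Lemma dominated_dual_term (j : int) (r : R) :
  exists A, forall z, normc z <= r -> dominated2 A (dual_term j ^~ z).
Proof.
have [A hA] := dual_term_bound (a * `|j%:~R| + 2 * r).
(* The factor [e^(2 |j|)] pays for moving the weight in [k] from centre [j] to centre 0; in [l] the
   centre is 0 already. *)
exists (A * expR (2 * `|j%:~R|)) => z zr p.
have r0 : 0 <= r by apply: le_trans zr; exact: normc_ge0.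
have hz1 : `|a * j%:~R - 2 * complex.Re z| <= a * `|j%:~R| + 2 * r.
  apply: (le_trans (ler_normB _ _)); rewrite !normrM (gtr0_norm a_gt0) (ger0_norm (ler0n R 2)).
  by rewrite lerD2l ler_wpM2l// (le_trans (ler_Re_normc _)).
have hz2 : `|a * 0%:~R + 2 * complex.Im z| <= a * `|j%:~R| + 2 * r.
  rewrite mulr0 add0r normrM (ger0_norm (ler0n R 2)).
  rewrite -[X in X <= _]add0r lerD ?mulr_ge0// ?(ltW a_gt0)//.
  by rewrite ler_wpM2l// (le_trans (ler_Im_normc _)).
have := hA j 0 p z hz1 hz2; rewrite subr0; move/le_trans; apply.
have A0 : 0 <= A.
  have := hA j 0 (j, 0) z hz1 hz2; rewrite /= !subrr /wt normr0 oppr0 expR0 !expr1n !mulr1.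
  by apply: le_trans; exact: normc_ge0.
rewrite -mulrA ler_wpM2l// /wt2 exprMn [X in _ <= X]mulrA ler_wpM2r ?sqr_ge0//.
rewrite !wt2E -expRD ler_expR.
have := ler_normD ((p.1 - j)%:~R : R) j%:~R; rewrite -intrD subrK; lra.
Qed.

(** For any [z] the sum over [l] can be recentred at an [l0] with [a l0] within [a] of [- 2 Im z].
    Sums of shifted weights do not see the centre and give [3 * 3], whence a bound independent of
    [j], [z] and [N]. *)
Lemma sum_dual_term_bound : exists C, forall j z N,
  `|a * j%:~R - 2 * complex.Re z| <= a ->
  normc (\sum_(p <- zs2 N) dual_term j p z) <= C.
Proof.
have [A hA] := dual_term_bound a; exists (A * 9) => j z N hj.
pose l0 := - Num.floor (2 * complex.Im z / a).
have hl : `|a * l0%:~R + 2 * complex.Im z| <= a.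
  rewrite /l0 mulrNz.
  have := floor_le_tmp (2 * complex.Im z / a); have := floorD1_gt (2 * complex.Im z / a).
  rewrite intrD; move: ((Num.floor _)%:~R : R) => n.
  rewrite ltr_pdivrMr// ler_pdivlMr// => h1 h2.
  by rewrite ler_norml; apply/andP; split; nra.
have A0 : 0 <= A.
  have := hA j l0 (j, l0) z hj hl; rewrite /= !subrr /wt normr0 oppr0 expR0 !expr1n !mulr1.
  by apply: le_trans; exact: normc_ge0.
apply: (le_trans (normc_sum _ _ _)).
apply: (@le_trans _ _ (\sum_(p <- zs2 N) A * (wt (p.1 - j) * wt (p.2 - l0)))).
  apply: ler_sum => p _; apply: (le_trans (hA j l0 p z hj hl)).
  have w k : 0 <= (wt k : R) ^+ 2 <= wt k.
    by rewrite sqr_ge0 expr2 ler_piMl// ?wt_ge0 ?wt_le1.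
  have /andP[u1 u2] := w (p.1 - j); have /andP[v1 v2] := w (p.2 - l0).
  by rewrite ler_wpM2l// ler_pM.
rewrite -mulr_sumr ler_wpM2l// big_allpairs /=.
under eq_bigr do rewrite -mulr_sumr.
rewrite -mulr_suml.
apply: (@le_trans _ _ (3 * 3)); last by rewrite -natrM.
apply: ler_pM; try by apply: sumr_ge0 => *; exact: wt_ge0.
  by apply: sum_wt_shift; exact: uniq_zs.
by apply: sum_wt_shift; exact: uniq_zs.
Qed.

End Terms.
End DualSeries.

(** * Sample moduli force a multiple of the Gaussian *)

Section GaussianRigidity.
Context {R : realType}.
Local Notation mu := (@lebesgue_measure R).
Variables (a c : R) (G : R -> R[i]).
Hypotheses (a_gt0 : 0 < a) (a_lt1 : a < 1).
Hypotheses (mRe : measurable_fun setT (fun t => complex.Re (G t)))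
  (mIm : measurable_fun setT (fun t => complex.Im (G t))).
Hypothesis iG : forall b : R, b < 1 ->
  mu.-integrable setT (EFin \o (fun t => normc (G t) * expR (pi * b * t ^+ 2))).
Hypothesis norm_sample : forall p, normc (sample a G p) =
  c * expR (pi * a ^+ 2 * (p.1%:~R ^+ 2 - p.2%:~R ^+ 2) / 2).

Lemma ae_exists_small (P : R -> Prop) : {ae mu, forall t, P t} ->
  forall d : R, 0 < d -> exists x, 0 < x <= d /\ P x.
Proof.
move=> aeP d d0; apply: contrapT => nP.
have [N [mN N0 sN]] := aeP.
have mI : measurable (`]0, d]%classic : set (measurableTypeR R)) by exact: measurable_itv.
have sI : `]0, d]%classic `<=` N.
  move=> x; rewrite /= in_itv /= => xd; apply: sN => /= Px; apply: nP.
  by exists x.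
have := le_measure mu (mem_set mI) (mem_set mN) sI.
by rewrite /= N0 lebesgue_measure_itv /= lte_fin d0 oppr0 adde0 lee_fin leNgt d0.
Qed.

Let term j p z := dual_term a (sample a G) j p z.

Lemma recon_dual_term j x p :
  recon_term a G j x p = (expR (- 2 * pi * x ^+ 2))%:C * term j p x%:C.
Proof.
rewrite /term /dual_term /recon_term /lam [RHS]mulrCA; congr (_ * _).
rewrite -cexp_real -cexpD; congr cexp; rewrite expr2.
by apply/eqP; rewrite eq_complex /=; apply/andP; split; apply/eqP; ring.
Qed.

(** Multiplying the Fejér sums by [e^(- 2 pi x^2) <= 1] preserves their uniform rate. Equality of
    the integrals over all intervals shorter than [1/a] then gives equality almost everywhere, for
    real and imaginary parts separately. *)
Lemma ae_reconstruction j : exists E : R[i] -> R[i], [/\ entire E,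
  forall z A, dominated2 A (term j ^~ z) -> forall N,
    normc (\sum_(p <- zs2 N) term j p z - E z) <= 18 * A * expR (- N%:R) &
  forall C0, zlim (fun k => psi (k - j)) C0 ->
    {ae mu, forall t, (a^-1 * C0)%:C * G t = (expR (- 2 * pi * t ^+ 2))%:C * E t%:C}].
Proof.
have domE r := dominated_dual_term a_gt0 a_lt1 norm_sample j r.
have [E [eE hE]] := entire_series (fun p => entire_dual_term a (sample a G) j p) domE.
exists E; split => // C0 hC0.
pose Rj (x : R) := (expR (- 2 * pi * x ^+ 2))%:C * E x%:C.
have [mE1 mE2] := measurable_entire eE.
have mexp : measurable_fun setT (fun x : R => expR (- 2 * pi * x ^+ 2)).
  exact: measurable_expR_sqr.
have mR1 : measurable_fun setT (fun x : R => complex.Re (Rj x)).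
  under eq_fun do rewrite cReM /= mul0r subr0.
  exact: measurable_funM.
have mR2 : measurable_fun setT (fun x : R => complex.Im (Rj x)).
  under eq_fun do rewrite cImM /= mul0r addr0.
  exact: measurable_funM.
have exp1 (x : R) : normc (expR (- 2 * pi * x ^+ 2))%:C <= 1.
  rewrite normc_real ger0_norm ?expR_ge0// -[X in _ <= X]expR0 ler_expR.
  by have := sqr_ge0 x; have := pi_gt0 R; nra.
have bnd u v : exists A, forall x, `[u, v]%classic x ->
    normc (Rj x) <= 18 * A /\ dominated2 A (term j ^~ x%:C).
  have [A hA] := domE (Num.max `|u| `|v|).
  exists A => x; rewrite /= in_itv /= => /andP[ux xv].
  have hx : dominated2 A (term j ^~ x%:C).
    apply: hA; rewrite normc_real le_max; case: (leP 0 x) => x0.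
      by rewrite (ger0_norm x0) (le_trans xv (ler_norm _)) orbT.
    by rewrite (ltr0_norm x0) -[`|u|]normrN (le_trans _ (ler_norm _))// lerN2.
  split => //; rewrite /Rj normcM -[18 * A]mul1r; apply: ler_pM; rewrite ?normc_ge0//.
  (* At [N = 0] the partial sum is empty, so the error estimate bounds [E] itself by [18 A]. *)
  have := hE _ _ hx 0%N; rewrite /zs2 /= big_nil sub0r normcN.
  by rewrite oppr0 expR0 mulr1.
have iR u v : cintegrable `[u, v] Rj.
  have [A hA] := bnd u v.
  split; apply: (@integrable_itv_bounded _ _ u v (18 * A)) => // x hx.
    by apply: (le_trans (ler_Re_normc _)); have [] := hA x hx.
  by apply: (le_trans (ler_Im_normc _)); have [] := hA x hx.
have rec u v : u < v < u + a^-1 -> (a^-1 * C0)%:C * cint `[u, v] G = cint `[u, v] Rj.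
  move=> /andP[uv vu]; have [A hA] := bnd u v.
  apply: (@reconstruction _ _ _ a_gt0 a_lt1 mRe mIm iG _ (27 * A)) => //; first exact: hC0.
  move=> N x ux; have [|_ hx] := hA x; first by rewrite /= in_itv.
  have -> : \sum_(p <- zs2 N.+1) (fejerw N p.2)%:C * recon_term a G j x p - Rj x =
      (expR (- 2 * pi * x ^+ 2))%:C *
      (\sum_(p <- zs2 N.+1) (fejerw N p.2)%:C * term j p x%:C - E x%:C).
    rewrite mulrBr mulr_sumr; congr (_ - _); apply: eq_bigr => p _.
    by rewrite recon_dual_term mulrCA.
  rewrite normcM; apply: (le_trans _ (dominated2_fejer N hx (hE _ _ hx))).
  by rewrite ler_piMl ?normc_ge0.
have ai : 0 < a^-1 by rewrite invr_gt0.
have mI u v : measurable (`[u, v]%classic : set (measurableTypeR R)) by exact: measurable_itv.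
have part (phi : R[i] -> R) : measurable_fun setT (fun t => phi (G t)) ->
    measurable_fun setT (fun t => phi (Rj t)) ->
    (forall u v, mu.-integrable `[u, v] (EFin \o (fun t => phi (G t)))) ->
    (forall u v, mu.-integrable `[u, v] (EFin \o (fun t => phi (Rj t)))) ->
    (forall u v, u < v < u + a^-1 -> a^-1 * C0 * Rintegral mu `[u, v] (fun t => phi (G t)) =
      Rintegral mu `[u, v] (fun t => phi (Rj t))) ->
    {ae mu, forall t, a^-1 * C0 * phi (G t) - phi (Rj t) = 0}.
  move=> m1 m2 i1 i2 eqI.
  have iZ u v := integrableRZl (a^-1 * C0) (mI u v) (i1 u v).
  apply: (ae_eq0_short_itv ai).
  - by apply: measurable_funB => //; apply: measurable_funM.
  - by move=> u v; apply: integrableRB.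
  - move=> u v uv; rewrite RintegralB//.
    by rewrite RintegralZl// eqI// subrr.
have aeRe : {ae mu, forall t, a^-1 * C0 * complex.Re (G t) - complex.Re (Rj t) = 0}.
  apply: part => //.
  - by move=> u v; have [] := cintegrable_itv mRe mIm iG u v.
  - by move=> u v; have [] := iR u v.
  - move=> u v /rec/(congr1 (@complex.Re R)); rewrite cReM /= mul0r subr0.
    by [].
have aeIm : {ae mu, forall t, a^-1 * C0 * complex.Im (G t) - complex.Im (Rj t) = 0}.
  apply: part => //.
  - by move=> u v; have [] := cintegrable_itv mRe mIm iG u v.
  - by move=> u v; have [] := iR u v.
  - move=> u v /rec/(congr1 (@complex.Im R)); rewrite cImM /= mul0r addr0.
    by [].
apply: (filterS2 _ _ aeRe aeIm); first exact: (ae_filter_ringOfSetsType mu).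
move=> t /eqP; rewrite subr_eq0 => /eqP h1 /eqP; rewrite subr_eq0 => /eqP h2.
apply/eqP; rewrite eq_complex [X in _ == X]cReM [X in _ && (_ == X)]cImM.
rewrite cReM cImM /= !mul0r !subr0 !addr0 h1 h2 /Rj cReM cImM /=.
by rewrite !mul0r !subr0 !addr0 !eqxx.
Qed.

Lemma ae_eq_gaussian : exists gamma : R[i],
  {ae mu, forall t, G t = gamma * (expR (- 2 * pi * t ^+ 2))%:C}.
Proof.
have [C0 C0_gt0 hC0] := @psi_sum R.
have [E hE] := choice ae_reconstruction.
have K0 : (a^-1 * C0)%:C != 0 :> R[i].
  by rewrite (fmorph_eq0 (real_complex R)) mulf_neq0 ?invr_eq0// gt_eqF.
(* Both functions reproduce the same multiple of [G] almost everywhere on the real line, so their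
   difference vanishes at positive points arbitrarily near 0. *)
have E0 j w : E j w = E 0 w.
  apply/eqP; rewrite -subr_eq0; apply/eqP.
  apply: (@entire_identity _ (fun w => E j w - E 0 w)).
    by apply: entireB; [have [] := hE j|have [] := hE 0].
  move=> d d0; have [_ _ /(_ C0 (hC0 j)) h1] := hE j.
  have [_ _ /(_ C0 (hC0 0)) h2] := hE 0.
  apply: ae_exists_small => //.
  apply: (filterS2 _ _ h1 h2); first exact: (ae_filter_ringOfSetsType mu).
  move=> t -> /mulfI e; apply/eqP; rewrite subr_eq0; apply/eqP/e.
  by rewrite (fmorph_eq0 (real_complex R)) gt_eqF ?expR_gt0.
have [C hC] := sum_dual_term_bound a_gt0 a_lt1 norm_sample.
(* The index [j] follows [w], the constant [C] does not; since all the [E j] coincide, the bound for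
   [E j] at [w] is one for [E 0]. *)
have bE w : normc (E 0 w) <= C.
  pose j : int := Num.floor (2 * complex.Re w / a).
  have hj : `|a * j%:~R - 2 * complex.Re w| <= a.
    rewrite /j.
    have := floor_le_tmp (2 * complex.Re w / a); have := floorD1_gt (2 * complex.Re w / a).
    rewrite intrD; move: ((Num.floor _)%:~R : R) => n.
    rewrite ltr_pdivrMr// ler_pdivlMr// => h1 h2.
    by rewrite ler_norml; apply/andP; split; nra.
  rewrite -(E0 j); have [_ hlim _] := hE j.
  have [A hA] := dominated_dual_term a_gt0 a_lt1 norm_sample j (normc w).
  have lim : (fun N => C + 18 * A * expR (- N%:R) : R) @ \oo --> C + 0.
    apply: cvgD; first exact: cvg_cst.
    exact: cvg_expRN.
  rewrite -[C]addr0; apply: (ler_cvg_to (cvg_cst _) lim); apply: nearW => N.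
  have := hlim _ _ (hA w (lexx _)) N; have := hC j w N hj.
  move: (\sum_(p <- zs2 N) _) => S h1 h2.
  rewrite (_ : E j w = S + - (S - E j w)); last by ring.
  by apply: (le_trans (le_normcD _ _)); rewrite normcN lerD.
have [eE0 _ /(_ C0 (hC0 0)) h0] := hE 0.
have cE := liouville eE0 bE.
exists ((a^-1 * C0)%:C^-1 * E 0 0); apply: filterS h0; first exact: (ae_filter_ringOfSetsType mu).
move=> t ht; apply: (mulfI K0); rewrite ht cE.
by rewrite !mulrA mulfV// mul1r mulrC.
Qed.

End GaussianRigidity.

(** * From the Gabor transform to the samples *)

Section Samples.
Context {R : realType}.
Local Notation mu := (@lebesgue_measure R).

Lemma expi_polar (z : R[i]) : normc z = 1 -> exists alpha, z = expi alpha.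
Proof.
case: z => x y nz; have := sqr_normcE (x +i* y); rewrite nz expr1n /= => xy.
have x1 : -1 <= x <= 1 by rewrite -ler_norml; have := ler_Re_normc (x +i* y); rewrite nz.
have sE : sin (acos x) = `|y|.
  rewrite sin_acos//; have -> : 1 - x ^+ 2 = y ^+ 2 by rewrite xy; ring.
  exact: sqrtr_sqr.
have [y0|y0] := leP 0 y.
  by exists (acos x); rewrite /expi acosK ?in_itv//= sE ger0_norm.
by exists (- acos x); rewrite /expi cosN sinN acosK ?in_itv//= sE ltr0_norm// opprK.
Qed.

(** The inequality [x y <= x^2 + y^2] stands in for Cauchy-Schwarz: the square of the Gaussian
    factor is again an integrable Gaussian. *)
Lemma integrable_L2_gaussian (f : R -> R[i]) (k : R) : square_integrable f -> 0 < k ->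
  mu.-integrable setT (EFin \o (fun t => normc (f t) * expR (- k * t ^+ 2))).
Proof.
move=> [m1 m2 f2] k0.
have msq : measurable_fun setT (fun t => normc (f t) ^+ 2).
  under eq_fun do rewrite sqr_normcE.
  by apply: measurable_funD; exact: measurable_funX.
have mexp : measurable_fun setT (fun x : R => expR (- k * x ^+ 2)).
  exact: measurable_expR_sqr.
have mn : measurable_fun setT (fun t => normc (f t)).
  have -> : (fun t => normc (f t)) = (fun t => Num.sqrt (normc (f t) ^+ 2)).
    by apply/funext => t; rewrite sqrtr_sqr ger0_norm ?normc_ge0.
  apply: (@measurableT_comp _ _ _ _ _ _ (@Num.sqrt R)) => //.
  exact: (continuous_measurable_fun (@sqrt_continuous R)).
have i2 : mu.-integrable setT (EFin \o (fun t => normc (f t) ^+ 2)).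
  apply/integrableP; split; first exact/measurable_EFinP.
  apply: le_lt_trans f2; rewrite le_eqVlt; apply/orP; left; apply/eqP.
  by apply: eq_integral => t _; rewrite /= ger0_norm ?sqr_ge0.
have k2 : 0 < 2 * k by rewrite mulr_gt0.
have iS := integrableRD measurableT i2 (integrable_gaussian k2).
apply: (le_integrable measurableT _ _ iS).
  by apply/measurable_EFinP; exact: measurable_funM.
move=> t _; rewrite /= lee_fin !ger0_norm ?addr_ge0 ?mulr_ge0 ?expR_ge0 ?normc_ge0 ?sqr_ge0//.
have -> : expR (- (2 * k) * t ^+ 2) = expR (- k * t ^+ 2) ^+ 2.
  by rewrite [RHS]expr2 -expRD; congr expR; ring.
move: (normc _) (normc_ge0 (f t)) (expR _) (expR_ge0 (- k * t ^+ 2)) => x x0 y y0.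
have := sqr_ge0 (x - y); nra.
Qed.

Section Weighted.
Variable f : R -> R[i].
Hypothesis f_L2 : square_integrable f.
Definition weighted (t : R) : R[i] := f t * (expR (- pi * t ^+ 2))%:C.

Lemma measurable_weighted :
  measurable_fun setT (fun t => complex.Re (weighted t)) /\
  measurable_fun setT (fun t => complex.Im (weighted t)).
Proof.
have [m1 m2 _] := f_L2.
have mexp : measurable_fun setT (fun x : R => expR (- pi * x ^+ 2)).
  exact: measurable_expR_sqr.
split.
  under eq_fun do rewrite cReM /= mulr0 subr0.
  exact: measurable_funM.
under eq_fun do rewrite cImM /= mulr0 add0r.
exact: measurable_funM.
Qed.

Lemma integrable_weighted (b : R) : b < 1 ->
  mu.-integrable setT (EFin \o (fun t => normc (weighted t) * expR (pi * b * t ^+ 2))).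
Proof.
move=> b1; have k0 : 0 < pi * (1 - b) by rewrite mulr_gt0 ?pi_gt0// subr_gt0.
have := integrable_L2_gaussian f_L2 k0; congr (mu.-integrable setT (EFin \o _)).
apply/funext => t; rewrite /weighted normcM normc_real ger0_norm ?expR_ge0//.
by rewrite -mulrA -expRD; congr (_ * expR _); ring.
Qed.

Lemma gabor_sample (a : R) (p : int * int) :
  gabor f (a * p.1%:~R) (a * p.2%:~R) =
  (2 `^ 4^-1 * expR (- pi * (a * p.1%:~R) ^+ 2))%:C * sample a weighted p.
Proof.
have [m1 m2] := measurable_weighted.
rewrite /gabor (rmorphM (real_complex R)) -[RHS]mulrA; congr (_ * _).
rewrite /sample -cintZ//; last first.
  exact: (cintegrable_weighted m1 m2 integrable_weighted).
apply: eq_cint => t _; rewrite /weighted /cexp /=.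
have -> : expR (- pi * (t - a * p.1%:~R) ^+ 2) =
    expR (- pi * (a * p.1%:~R) ^+ 2) * (expR (- pi * t ^+ 2) * expR (2 * pi * a * p.1%:~R * t)).
  by rewrite -!expRD; congr expR; ring.
have -> : - 2 * pi * t * (a * p.2%:~R) = - (2 * pi * a * p.2%:~R) * t by ring.
by rewrite !(rmorphM (real_complex R)) /=; ring.
Qed.

Lemma cint_ae_gaussian (gamma : R[i]) :
  {ae mu, forall t, weighted t = gamma * (expR (- 2 * pi * t ^+ 2))%:C} ->
  cint setT weighted = gamma * (Num.sqrt 2^-1)%:C.
Proof.
move=> ae; have [m1 m2] := measurable_weighted.
have p2 : 0 < 2 * pi :> R by rewrite mulr_gt0 ?pi_gt0.
have mexp : measurable_fun setT (fun x : R => expR (- (2 * pi) * x ^+ 2)).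
  exact: measurable_expR_sqr.
have gI := Rintegral_gaussian p2.
have half : pi / (2 * pi) = 2^-1 :> R by rewrite invfM mulrCA mulfV ?mulr1// gt_eqF ?pi_gt0.
rewrite half in gI.
have part (phi : R -> R) (r : R) : measurable_fun setT phi ->
    {ae mu, forall t, phi t = r * expR (- (2 * pi) * t ^+ 2)} ->
    Rintegral mu setT phi = r * Num.sqrt 2^-1.
  move=> mphi h; rewrite -gI -RintegralZl//; last exact: integrable_gaussian.
  rewrite /Rintegral; congr fine; apply: ae_eq_integral => //.
  - exact/measurable_EFinP.
  - by apply/measurable_EFinP; exact: measurable_funM.
  - apply: filterS h; first exact: (ae_filter_ringOfSetsType mu).
    by move=> t /= -> _.
apply/eqP; rewrite eq_complex cReM cImM /= !mulr0 subr0 add0r.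
apply/andP; split; apply/eqP; apply: part => //.
  apply: filterS ae; first exact: (ae_filter_ringOfSetsType mu).
  by move=> t ->; rewrite cReM /= mulr0 subr0 mulNr.
apply: filterS ae; first exact: (ae_filter_ringOfSetsType mu).
by move=> t ->; rewrite cImM /= mulr0 add0r mulNr.
Qed.

End Weighted.
End Samples.

(** * From the lattice data to the Gaussian and its phase *)

Unset Implicit Arguments.
Set Strict Implicit.
Set Printing Implicit Defensive.

Theorem theorem6 (R : realType) (a : R) (a_gt0 : 0 < a) (a_lt1 : a < 1)
    (f : R -> R[i]) (f_L2 : square_integrable f)
    (f_lattice : forall x omega : R, square_lattice a (x, omega) ->
       normc (gabor f x omega) ^+ 2 = expR (- pi * (x ^+ 2 + omega ^+ 2))) :
  exists alpha : R,
    \forall t \ae @lebesgue_measure R, f t = expi alpha * gaussian t.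
Proof.
have [m1 m2] := measurable_weighted f_L2.
have iW := integrable_weighted f_L2.
have q0 : 0 < 2 `^ 4^-1 :> R by rewrite powR_gt0.
have q2 : (2 `^ 4^-1) ^+ 2 = Num.sqrt 2 :> R.
  rewrite -powR_mulrn ?powR_ge0// -powRrM -powR12_sqrt//; congr (_ `^ _); lra.
have norm_sample p : normc (sample a (weighted f) p) = (2 `^ 4^-1)^-1 *
    expR (pi * a ^+ 2 * (p.1%:~R ^+ 2 - p.2%:~R ^+ 2) / 2).
  have pl : square_lattice a (a * p.1%:~R, a * p.2%:~R) by exists p.1, p.2.
  have := f_lattice _ _ pl; rewrite gabor_sample// normcM normc_real.
  rewrite ger0_norm ?mulr_ge0 ?expR_ge0 ?(ltW q0)// => h.
  apply/eqP; rewrite -(@eqrXn2 _ 2) ?normc_ge0 ?mulr_ge0 ?expR_ge0 ?invr_ge0 ?(ltW q0)//.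
  have X0 : 0 < 2 `^ 4^-1 * expR (- pi * (a * p.1%:~R) ^+ 2) by rewrite mulr_gt0 ?expR_gt0.
  have X0' : (2 `^ 4^-1 * expR (- pi * (a * p.1%:~R) ^+ 2)) ^+ 2 != 0.
    by rewrite expf_neq0// gt_eqF.
  apply/eqP/(mulfI X0'); rewrite -exprMn h -exprMn.
  have -> : 2 `^ 4^-1 * expR (- pi * (a * p.1%:~R) ^+ 2) * ((2 `^ 4^-1)^-1 *
      expR (pi * a ^+ 2 * (p.1%:~R ^+ 2 - p.2%:~R ^+ 2) / 2)) =
      expR (- pi * (a * p.1%:~R) ^+ 2) *
      expR (pi * a ^+ 2 * (p.1%:~R ^+ 2 - p.2%:~R ^+ 2) / 2).
    by field; rewrite gt_eqF.
  by rewrite -expRD [RHS]expr2 -expRD; congr expR; field.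
have [gamma hgamma] := ae_eq_gaussian a_gt0 a_lt1 m1 m2 iW norm_sample.
(* The sample at the origin is [gamma] times the integral of [e^(- 2 pi t^2)], which is [2^(-1/2)],
   and its modulus is [2^(-1/4)]. *)
have ngamma : normc gamma = 2 `^ 4^-1.
  have := norm_sample (0, 0).
  rewrite (_ : pi * a ^+ 2 * _ / 2 = 0) ?expR0 ?mulr1; last by rewrite subrr mulr0 mul0r.
  have -> : sample a (weighted f) (0, 0) = cint setT (weighted f).
    apply: eq_cint => t _; rewrite /= !mulr0 oppr0 !mul0r.
    by rewrite (_ : 0 +i* 0 = 0)// cexp0 mulr1.
  rewrite (cint_ae_gaussian f_L2 hgamma) normcM normc_real ger0_norm ?sqrtr_ge0//.
  rewrite sqrtrV// -q2 => h.
  have q0' := gt_eqF q0.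
  have : normc gamma * (2 `^ 4^-1) ^- 2 * (2 `^ 4^-1) ^+ 2 = 2 `^ 4^-1.
    by rewrite h; field; rewrite q0'.
  by rewrite divfK// expf_neq0// q0'.
(* Dividing out the normalization of the Gaussian leaves a factor of modulus 1, which is the phase
   sought. *)
have [|alpha ha] := @expi_polar _ (gamma * (2 `^ 4^-1)^-1%:C).
  by rewrite normcM normc_real ngamma ger0_norm ?invr_ge0 ?(ltW q0)// mulfV// gt_eqF.
exists alpha; apply: filterS hgamma; first exact: (ae_filter_ringOfSetsType (@lebesgue_measure R)).
move=> t; rewrite /weighted -ha /gaussian => h.
have e0 : (expR (- pi * t ^+ 2))%:C != 0 :> R[i].
  by rewrite (fmorph_eq0 (real_complex R)) gt_eqF ?expR_gt0.
apply: (mulIf e0); rewrite h -!mulrA -!(rmorphM (real_complex R)) /=; congr (_ * _%:C).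
by rewrite -mulrA mulKf ?gt_eqF// -expRD; congr expR; ring.
Qed.
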